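(* The following are equivalent for a matroid $N$. (i) $N$ is ternary and laminar. (ii) $N$ has no minor isomorphic to a member of $\{U_{2,5},U_{3,5},Y_3\}$. (iii) Each component of $\mathrm{si}(N)$ has rank at most one, is $U_{2,4}$ or $U_{2,4}\oplus_2 U_{2,4}$, or can be obtained from an $n$-circuit for some $n\ge 3$ by $2$-summing on copies of $U_{2,4}$ across $k$ distinct elements of the circuit for some $k$ in $\{0,1,\dots,n\}$.
   Context: All matroids are finite. A family $\mathcal{A}$ of subsets of a finite set $E$ is laminar if, for all $A,B\in\mathcal{A}$ with $A\cap B\neq\emptyset$, either $A\subseteq B$ or $B\subseteq A$. Given a laminar family $\mathcal{A}$ of subsets of $E$ and a capacity function $c:\mathcal{A}\to\mathbb{Z}_{\ge 0}$, $M(E,\mathcal{A},c)$ is the matroid on $E$ whose independent sets are exactly the sets $I\subseteq E$ with $|I\cap A|\le c(A)$ for all $A\in\mathcal{A}$. A matroid is laminar if it is isomorphic to some $M(E,\mathcal{A},c)$. $Y_3$ is the matroid obtained by truncating, to rank $3$, the parallel connection of two $3$-element circuits; it is isomorphic to a single-element deletion of the cycle matroid $M(K_4)$. $\mathrm{si}(N)$ is the simplification of $N$; $\oplus_2$ denotes the $2$-sum (the parallel connection of two matroids across a common basepoint, with the basepoint then deleted); an $n$-circuit, as a matroid, is $U_{n-1,n}$. Matroids are identified up to isomorphism. Ternary means representable over the field with three elements. *)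

(* Defs.v *)
From HB Require Import structures.
From mathcomp Require Import all_boot all_order all_algebra.
From mathcomp Require Import zify.

Set Implicit Arguments.
Unset Strict Implicit.
Unset Printing Implicit Defensive.

(* The ground set is a subset of a finite type, not the whole type, so that
   restrictions, minors and sums all live on the same type. *)
Record matroid (T : finType) := Matroid {
  ground : {set T};
  indep : pred {set T};
  indep_ground : forall I, indep I -> I \subset ground;
  indep0 : indep set0;
  indepS : forall I J : {set T}, I \subset J -> indep J -> indep I;
  indep_aug : forall I J : {set T}, indep I -> indep J -> #|I| < #|J| ->
    exists2 x, x \in J :\: I & indep (x |: I)
}.

(* The bijection is between the ground sets as subtypes: a function between
   the ambient types need not exist when one of these is empty. *)
Definition isomorphic (T U : finType) (M : matroid T) (N : matroid U) : Prop :=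
  exists f : {x : T | x \in ground M} -> {y : U | y \in ground N},
    bijective f /\
    forall I : {set {x : T | x \in ground M}},
      indep N [set val y | y in [set f x | x in I]] = indep M [set val x | x in I].

Section Basics.
Variables (T : finType) (M : matroid T).
Implicit Types (x y : T) (X C I : {set T}).

Definition rank X := \max_(I : {set T} | (I \subset X) && indep M I) #|I|.

Definition dependent X := (X \subset ground M) && ~~ indep M X.

Definition circuits : {set {set T}} := [set C | minset dependent C].

Lemma rank_ge I X : I \subset X -> indep M I -> #|I| <= rank X.
Proof.
by move=> sIX iI; apply: (@leq_bigmax_cond _ _ (fun I : {set T} => #|I|));
  rewrite sIX.
Qed.

Lemma rank_ex X : exists2 I : {set T}, (I \subset X) && indep M I & rank X = #|I|.
Proof.
have [|I PI eI] := @eq_bigmax_cond _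
  [pred I : {set T} | (I \subset X) && indep M I] (fun I => #|I|).
  by apply/card_gt0P; exists set0; rewrite inE sub0set indep0.
by exists I.
Qed.

Lemma rank_le X k :
  (forall I, I \subset X -> indep M I -> #|I| <= k) -> rank X <= k.
Proof. by move=> h; apply/bigmax_leqP => I /andP[]; apply: h. Qed.

Lemma rankUl_le I X : rank (I :|: X) <= #|I| + rank X.
Proof.
apply: rank_le => K sK iK.
have -> : K = (K :&: I) :|: (K :&: X) by rewrite -setIUr (setIidPl sK).
apply: leq_trans (leq_card_setU _ _) _; apply: leq_add.
  by rewrite subset_leq_card // subsetIr.
by apply: rank_ge (subsetIr _ _) (indepS (subsetIl _ _) iK).
Qed.

Lemma dependent_circuit X : dependent X -> exists2 C, C \in circuits & C \subset X.
Proof. by case/minset_exists=> C mC sC; exists C; rewrite // inE. Qed.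

Lemma circuit_dep C : C \in circuits -> dependent C.
Proof. by rewrite inE => /minsetp. Qed.

End Basics.

Section Restriction.
Variables (T : finType) (M : matroid T) (X : {set T}).

Definition restrict_indep : pred {set T} :=
  [pred I : {set T} | (I \subset X) && indep M I].

Fact restrict_ground I : restrict_indep I -> I \subset ground M :&: X.
Proof. by case/andP=> sI iI; rewrite subsetI sI indep_ground. Qed.

Fact restrict0 : restrict_indep set0.
Proof. by rewrite /restrict_indep /= sub0set indep0. Qed.

Fact restrictS (I J : {set T}) :
  I \subset J -> restrict_indep J -> restrict_indep I.
Proof.
by move=> sIJ /andP[sJ iJ]; rewrite /restrict_indep /= (subset_trans sIJ sJ) (indepS sIJ).
Qed.

Fact restrict_aug (I J : {set T}) :
  restrict_indep I -> restrict_indep J -> #|I| < #|J| ->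
  exists2 x, x \in J :\: I & restrict_indep (x |: I).
Proof.
case/andP=> sI iI /andP[sJ iJ] /(indep_aug iI iJ)[x xJI ixI]; exists x => //.
rewrite /restrict_indep /= ixI andbT subUset sI sub1set andbT.
by case/setDP: xJI => xJ _; apply: (subsetP sJ).
Qed.

Definition restrict : matroid T :=
  Matroid restrict_ground restrict0 restrictS restrict_aug.

End Restriction.

Definition delete (T : finType) (M : matroid T) (X : {set T}) : matroid T :=
  restrict M (ground M :\: X).

Section Contraction.
Variables (T : finType) (M : matroid T) (X : {set T}).

(* I is independent in M/X when r(I u X) - r(X) = |I|. *)
Definition contract_indep : pred {set T} :=
  [pred I : {set T} | (I \subset ground M :\: X)
                        && (rank M (I :|: X) == #|I| + rank M X)].

Fact contract_ground I : contract_indep I -> I \subset ground M :\: X.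
Proof. by case/andP. Qed.

Fact contract0 : contract_indep set0.
Proof. by rewrite /contract_indep /= sub0set set0U cards0 add0n eqxx. Qed.

Fact contractS (I J : {set T}) :
  I \subset J -> contract_indep J -> contract_indep I.
Proof.
move=> sIJ /andP[sJ /eqP rJ]; rewrite /contract_indep /= (subset_trans sIJ sJ) /=.
rewrite eqn_leq rankUl_le /=.
have := rankUl_le M (J :\: I) (I :|: X).
have -> : J :\: I :|: (I :|: X) = J :|: X.
  by rewrite setUA -{2}(setIidPr sIJ) [_ :|: (J :&: I)]setUC setID.
rewrite rJ.
rewrite cardsDS // => h; rewrite -(leq_add2l (#|J| - #|I|)) addnA.
by rewrite subnK // subset_leq_card.
Qed.

Fact contract_aug (I J : {set T}) :
  contract_indep I -> contract_indep J -> #|I| < #|J| ->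
  exists2 x, x \in J :\: I & contract_indep (x |: I).
Proof.
move=> /andP[sI /eqP rI] /andP[sJ /eqP rJ] ltIJ.
have [K /andP[sK iK] eK] := rank_ex M (I :|: X).
have [L /andP[sL iL] eL] := rank_ex M (J :|: X).
have dIX : [disjoint I & X].
  by move: sI; rewrite subsetD => /andP[].
have ltKL : #|K| < #|L| by rewrite -eK -eL rI rJ ltn_add2r.
have [x /setDP[xL xK] ixK] := indep_aug iK iL ltKL.
have cK : #|K| = #|K :&: I| + #|K :&: X|.
  have {1}-> : K = (K :&: I) :|: (K :&: X) by rewrite -setIUr (setIidPl sK).
  rewrite cardsU [X in _ - X](_ : _ = 0) ?subn0 //; apply/eqP.
  by rewrite cards_eq0 setIACA setIid (disjoint_setI0 dIX) setI0.
have leI : #|K :&: I| <= #|I| by rewrite subset_leq_card // subsetIr.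
have leX : #|K :&: X| <= rank M X.
  exact: rank_ge (subsetIr _ _) (indepS (subsetIl _ _) iK).
have eKX : #|K :&: X| = rank M X.
  apply/eqP; rewrite eqn_leq leX /= -(leq_add2l #|I|) -rI eK cK leq_add2r.
  exact: leI.
have eKI : K :&: I = I.
  apply/eqP; rewrite eqEcard subsetIr /= -(leq_add2r (rank M X)) -rI eK cK eKX.
  exact: leqnn.
have xX : x \notin X.
  apply/negP => xX; have := @rank_ge _ M (x |: (K :&: X)) X.
  rewrite subUset sub1set xX subsetIr cardsU1 inE (negbTE xK) /= add1n eKX ltnn.
  move=> h; have//: false; apply: h => //; apply: indepS ixK.
  by rewrite setUS // subsetIl.
have xI : x \notin I by apply: contra xK; rewrite -{1}eKI inE => /andP[].
have xJ : x \in J by move/subsetP: sL => /(_ x xL); rewrite inE (negbTE xX) orbF.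
exists x; first by rewrite inE xI.
rewrite /contract_indep /= subUset sub1set (subsetP sJ _ xJ) sI /= eqn_leq rankUl_le /=.
have := @rank_ge _ M (x |: K) (x |: I :|: X).
rewrite !cardsU1 xK xI -eK rI !add1n addSn; apply=> //.
by rewrite -setUA setUS.
Qed.

Definition contract : matroid T :=
  Matroid contract_ground contract0 contractS contract_aug.

End Contraction.

Definition has_minor (T U : finType) (M : matroid T) (N : matroid U) : Prop :=
  exists C D : {set T}, [/\ C \subset ground M, D \subset ground M,
    [disjoint C & D] & isomorphic (delete (contract M C) D) N].

Section Truncation.
Variables (T : finType) (r : nat) (M : matroid T).

Definition truncate_indep : pred {set T} :=
  [pred I : {set T} | indep M I && (#|I| <= r)].

Fact truncate_ground I : truncate_indep I -> I \subset ground M.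
Proof. by case/andP=> /indep_ground. Qed.

Fact truncate0 : truncate_indep set0.
Proof. by rewrite /truncate_indep /= indep0 cards0. Qed.

Fact truncateS (I J : {set T}) :
  I \subset J -> truncate_indep J -> truncate_indep I.
Proof.
move=> sIJ /andP[iJ cJ].
by rewrite /truncate_indep /= (indepS sIJ iJ) (leq_trans (subset_leq_card sIJ) cJ).
Qed.

Fact truncate_aug (I J : {set T}) :
  truncate_indep I -> truncate_indep J -> #|I| < #|J| ->
  exists2 x, x \in J :\: I & truncate_indep (x |: I).
Proof.
case/andP=> iI cI /andP[iJ cJ] lt; have [x xJI ixI] := indep_aug iI iJ lt.
exists x => //; rewrite /truncate_indep /= ixI cardsU1; case/setDP: xJI => _ -> /=.
by rewrite add1n (leq_trans lt).
Qed.

Definition truncate : matroid T :=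
  Matroid truncate_ground truncate0 truncateS truncate_aug.

End Truncation.

Section Uniform.
Variables (T : finType) (E : {set T}) (r : nat).

Definition uniform_indep : pred {set T} :=
  [pred I : {set T} | (I \subset E) && (#|I| <= r)].

Fact uniform_ground I : uniform_indep I -> I \subset E.
Proof. by case/andP. Qed.

Fact uniform0 : uniform_indep set0.
Proof. by rewrite /uniform_indep /= sub0set cards0. Qed.

Fact uniformS (I J : {set T}) :
  I \subset J -> uniform_indep J -> uniform_indep I.
Proof.
move=> sIJ /andP[sJ cJ].
by rewrite /uniform_indep /= (subset_trans sIJ sJ) (leq_trans (subset_leq_card sIJ) cJ).
Qed.

Fact uniform_aug (I J : {set T}) :
  uniform_indep I -> uniform_indep J -> #|I| < #|J| ->
  exists2 x, x \in J :\: I & uniform_indep (x |: I).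
Proof.
case/andP=> sI cI /andP[sJ cJ] lt.
have /subsetPn[x xJ xI] : ~~ (J \subset I).
  by apply/negP => /subset_leq_card; rewrite leqNgt lt.
exists x; first by rewrite inE xI.
by rewrite /uniform_indep /= subUset sub1set (subsetP sJ _ xJ) sI cardsU1 xI add1n (leq_trans lt).
Qed.

Definition uniform_on : matroid T :=
  Matroid uniform_ground uniform0 uniformS uniform_aug.

End Uniform.

(* U_{r,n} *)
Definition uniform (r n : nat) : matroid 'I_n := uniform_on [set: 'I_n] r.

Definition circuit_on (T : finType) (C : {set T}) : matroid T :=
  uniform_on C #|C|.-1.

Section Laminar.
Variables (T : finType) (E : {set T}) (A : {set {set T}}) (c : {set T} -> nat).

Definition laminar_family :=
  [forall X in A, X \subset E] &&
  [forall X in A, forall Y in A,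
     (X :&: Y != set0) ==> ((X \subset Y) || (Y \subset X))].

Definition laminar_indep : pred {set T} :=
  [pred I : {set T} | (I \subset E) && [forall X in A, #|I :&: X| <= c X]].

Fact laminar_ground I : laminar_indep I -> I \subset E.
Proof. by case/andP. Qed.

Fact laminar0 : laminar_indep set0.
Proof. by rewrite /laminar_indep /= sub0set; apply/forall_inP => X _; rewrite set0I cards0. Qed.

Fact laminarS (I J : {set T}) :
  I \subset J -> laminar_indep J -> laminar_indep I.
Proof.
move=> sIJ /andP[sJ /forall_inP cJ]; rewrite /laminar_indep /= (subset_trans sIJ sJ) /=.
apply/forall_inP => X XA; apply: leq_trans (cJ X XA).
by rewrite subset_leq_card // setSI.
Qed.

Hypothesis lamA : laminar_family.

Fact laminar_aug (I J : {set T}) :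
  laminar_indep I -> laminar_indep J -> #|I| < #|J| ->
  exists2 x, x \in J :\: I & laminar_indep (x |: I).
Proof.
case/andP=> sI /forall_inP cI /andP[sJ /forall_inP cJ] ltIJ.
apply/exists_inP; apply: contraLR ltIJ => /exists_inPn nox; rewrite -leqNgt.
pose tight := [pred X : {set T} | (X \in A) && (#|I :&: X| == c X)].
pose P := [set X | maxset tight X].
have tP X : X \in P -> tight X by rewrite inE => /maxsetp.
have trP : trivIset P.
  apply/trivIsetP => X Y XP YP neXY; rewrite -setI_eq0.
  apply: contraNT neXY => XY0.
  have /andP[XA _] := tP _ XP; have /andP[YA _] := tP _ YP.
  case/andP: lamA => _ /forall_inP/(_ X XA)/forall_inP/(_ Y YA).
  rewrite XY0 /=; move: (XP) (YP); rewrite !inE => mX mY.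
  case/orP=> sXY; [rewrite eq_sym|]; apply/eqP.
    by case/maxsetP: mX => _ /(_ Y (tP _ YP) sXY).
  by case/maxsetP: mY => _ /(_ X (tP _ XP) sXY).
have cov x : x \in J -> x \notin I -> x \in cover P.
  move=> xJ xI; have := nox x; rewrite inE xI xJ => /(_ isT).
  rewrite /laminar_indep /= subUset sub1set (subsetP sJ _ xJ) sI /=.
  case/forall_inPn=> X XA; rewrite -ltnNge => ltX.
  have tX : tight X.
    rewrite inE XA /= eqn_leq cI //= -ltnS (leq_trans ltX) //.
    rewrite setIUl (leq_trans (leq_card_setU _ _)) // -add1n leq_add2r.
    by rewrite -(cards1 x) subset_leq_card // subsetIl.
  have xX : x \in X.
    apply: contraLR ltX => xX; rewrite -leqNgt setIUl.
    suff -> : [set x] :&: X = set0 by rewrite set0U cI.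
    by apply/eqP; rewrite setI_eq0 disjoints1.
  have [Y mY sXY] := maxset_exists tX.
  by apply/bigcupP; exists Y; rewrite ?inE // (subsetP sXY).
have cardE (K : {set T}) : #|K :&: cover P| = \sum_(X in P) #|K :&: X|.
  have F (Y : {set T}) : #|K :&: Y| = \sum_(x in Y) (x \in K).
    rewrite -sum1_card big_mkcond [RHS]big_mkcond; apply: eq_bigr => x _.
    by rewrite inE; case: (x \in K); case: (x \in Y).
  by rewrite F big_trivIset //; apply: eq_bigr => X _; rewrite F.
rewrite -(cardsID (cover P) J) -(cardsID (cover P) I) leq_add //.
  rewrite !cardE leq_sum // => X XP; have /andP[XA /eqP ->] := tP _ XP.
  exact: cJ.
apply/subset_leq_card/subsetP => x /setDP[xJ xC]; rewrite inE xC /=.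
by apply: contraR xC; apply: cov.
Qed.

(* M(E, A, c) *)
Definition laminar_matroid : matroid T :=
  Matroid laminar_ground laminar0 laminarS laminar_aug.

End Laminar.

Definition laminar (T : finType) (M : matroid T) : Prop :=
  exists (U : finType) (E : {set U}) (A : {set {set U}}) (c : {set U} -> nat)
    (lamA : laminar_family E A), isomorphic M (laminar_matroid c lamA).

(* [free] is about sequences, so equal or zero vectors make a set dependent. *)
Definition representable (F : fieldType) (T : finType) (M : matroid T) : Prop :=
  exists (m : nat) (v : T -> 'rV[F]_m),
    forall I : {set T}, I \subset ground M ->
      indep M I = free [seq v x | x in I].

Definition ternary (T : finType) (M : matroid T) : Prop := representable 'F_3 M.

Fact arith_p i j a b a' b' : i < j -> i = a + b -> j + 1 = a' + b' ->
  a' <= a -> b' <= b.+1 -> False.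
Proof. lia. Qed.

Fact arith_np i j a b a' b' : i < j -> i = a + b -> j + 0 = a' + b' ->
  a' <= a -> b' <= b.+1 -> a <= a' /\ b.+1 <= b'.
Proof. lia. Qed.

Section ParallelConnection.
Variables (T : finType) (p : T) (M N : matroid T).

(* p is the only common element of the ground sets and is a loop of neither
   matroid; the circuit family below is the usual one under this condition. *)
Definition basepoint :=
  [&& ground M :&: ground N == [set p], indep M [set p] & indep N [set p]].

Definition parallel_circuits : {set {set T}} :=
  circuits M :|: circuits N :|:
  [set (C :\ p) :|: (D :\ p) | C in [set C in circuits M | p \in C],
                               D in [set D in circuits N | p \in D]].

Definition parallel_indep : pred {set T} :=
  [pred I : {set T} | (I \subset ground M :|: ground N)
     && [forall C in parallel_circuits, ~~ (C \subset I)]].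

Fact parallel_ground I : parallel_indep I -> I \subset ground M :|: ground N.
Proof. by case/andP. Qed.

Fact parallelS (I J : {set T}) :
  I \subset J -> parallel_indep J -> parallel_indep I.
Proof.
move=> sIJ /andP[sJ /forall_inP cJ]; rewrite /parallel_indep /= (subset_trans sIJ sJ) /=.
apply/forall_inP => C /cJ; apply: contra => sCI; exact: subset_trans sIJ.
Qed.

Hypothesis bp : basepoint.

Let pM : p \in ground M.
Proof. by case/and3P: bp => _ /indep_ground; rewrite sub1set. Qed.

Let pN : p \in ground N.
Proof. by case/and3P: bp => _ _ /indep_ground; rewrite sub1set. Qed.

Lemma parallel_indepE (I : {set T}) :
  parallel_indep I =
  [&& I \subset ground M :|: ground N, indep M (I :&: ground M),
      indep N (I :&: ground N) &
      indep M (p |: I :&: ground M) || indep N (p |: I :&: ground N)].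
Proof.
have key (L : matroid T) : p \in ground L -> indep L (I :&: ground L) ->
    ~~ indep L (p |: I :&: ground L) ->
    exists2 C, C \in [set C in circuits L | p \in C] & C :\ p \subset I.
  move=> pL iI dI; have [|C cC sC] := @dependent_circuit _ L (p |: I :&: ground L).
    by rewrite /dependent dI subUset sub1set pL subsetIr.
  have sCI : C :\ p \subset I :&: ground L by rewrite subDset.
  exists C; last exact: subset_trans sCI (subsetIl _ _).
  rewrite inE cC /=; have /andP[_] := circuit_dep cC.
  apply: contraR => pC; apply: indepS iI.
  by move: sCI; rewrite (setDidPl _) // disjoint_sym disjoints1.
have key2 (L : matroid T) C : C \in circuits L -> C :\ p \subset I ->
    ~~ indep L (p |: I :&: ground L).
  move=> /circuit_dep/andP[sC dC] sCI; apply: contra dC; apply: indepS.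
  rewrite -subDset subsetI sCI (subset_trans _ sC) //; exact: subsetDl.
have key3 (L : matroid T) : indep L (I :&: ground L) =
    [forall C in circuits L, ~~ (C \subset I)].
  apply/idP/forall_inP => [iI C /circuit_dep/andP[sC dC]|h].
    by apply: contra dC => sCI; apply: indepS iI; rewrite subsetI sCI.
  apply/negPn/negP => dI; have [|C cC] := @dependent_circuit _ L (I :&: ground L).
    by rewrite /dependent dI subsetIr.
  by rewrite subsetI => /andP[sCI _]; have := h C cC; rewrite sCI.
rewrite /parallel_indep /=; case: (I \subset _) => //=.
apply/forall_inP/and3P => [h|[]].
  have iM : indep M (I :&: ground M).
    by rewrite key3; apply/forall_inP => C cC; apply: h; rewrite !in_setU cC.
  have iN : indep N (I :&: ground N).
    by rewrite key3; apply/forall_inP => C cC; apply: h; rewrite !in_setU cC orbT.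
  split=> //; apply/negPn/negP; rewrite negb_or => /andP[dM dN].
  have [C cC sC] := key M pM iM dM; have [D cD sD] := key N pN iN dN.
  have := h ((C :\ p) :|: (D :\ p)); rewrite subUset sC sD /= => h'.
  by have//: false; apply: h'; rewrite in_setU (imset2_f _ cC cD) orbT.
rewrite !key3 => /forall_inP cM /forall_inP cN ip C.
rewrite !in_setU => /orP[/orP[/cM|/cN] //|/imset2P[X Y]].
move=> /setIdP[cX pX] /setIdP[cY pY] ->; rewrite subUset.
apply/negP => /andP[sX sY]; case/orP: ip; apply/negP.
  exact: key2 sX.
exact: key2 sY.
Qed.

Fact parallel0 : parallel_indep set0.
Proof.
rewrite parallel_indepE sub0set !set0I !indep0 setU0.
by case/and3P: bp => _ -> _.
Qed.

Let card_split (K : {set T}) : K \subset ground M :|: ground N ->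
  #|K| + (p \in K) = #|K :&: ground M| + #|K :&: ground N|.
Proof.
move=> sK; rewrite -cardsUI -setIUr (setIidPl sK) setIACA setIid.
case/and3P: bp => /eqP -> _ _; congr addn.
case: (boolP (p \in K)) => pK; last first.
  by apply/esym/eqP; rewrite cards_eq0 setI_eq0 disjoint_sym disjoints1.
by rewrite (setIidPr _) ?cards1 // sub1set.
Qed.

Let only_p x : x \in ground M -> x \in ground N -> x = p.
Proof.
by move=> xM xN; apply/set1P; case/and3P: bp => /eqP <- _ _; rewrite inE xM.
Qed.

(* Adding an element x <> p of one ground set to I only changes I on that side. *)
Let add_M (I : {set T}) x : parallel_indep I -> x \in ground M ->
  x != p -> indep M (x |: I :&: ground M) ->
  indep N (p |: I :&: ground N) || indep M (x |: (p |: I :&: ground M)) ->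
  parallel_indep (x |: I).
Proof.
rewrite !parallel_indepE => /and4P[sI _ iN _] xM xp ix ip.
have eM : (x |: I) :&: ground M = x |: I :&: ground M.
  by rewrite setIUl (setIidPl _) // sub1set.
have eN : (x |: I) :&: ground N = I :&: ground N.
  rewrite setIUl [X in X :|: _](_ : _ = set0) ?set0U //.
  apply/eqP; rewrite setI_eq0 disjoints1; apply: contra xp => xN.
  by rewrite (only_p xM xN).
rewrite eM eN subUset sub1set inE xM sI ix iN /= setUCA orbC.
exact: ip.
Qed.

Let add_N (I : {set T}) x : parallel_indep I -> x \in ground N ->
  x != p -> indep N (x |: I :&: ground N) ->
  indep M (p |: I :&: ground M) || indep N (x |: (p |: I :&: ground N)) ->
  parallel_indep (x |: I).
Proof.
rewrite !parallel_indepE => /and4P[sI iM _ _] xN xp ix ip.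
have eN : (x |: I) :&: ground N = x |: I :&: ground N.
  by rewrite setIUl (setIidPl _) // sub1set.
have eM : (x |: I) :&: ground M = I :&: ground M.
  rewrite setIUl [X in X :|: _](_ : _ = set0) ?set0U //.
  apply/eqP; rewrite setI_eq0 disjoints1; apply: contra xp => xM.
  by rewrite (only_p xM xN).
by rewrite eM eN subUset sub1set inE xN orbT sI ix iM /= setUCA.
Qed.

Let add_p (I : {set T}) : parallel_indep I ->
  indep M (p |: I :&: ground M) -> indep N (p |: I :&: ground N) ->
  parallel_indep (p |: I).
Proof.
rewrite !parallel_indepE => /and4P[sI _ _ _] iM iN.
rewrite subUset sub1set inE pM sI /= !setIUl.
rewrite ((@setIidPl _ [set p] (ground M)) _) ?sub1set //.
rewrite ((@setIidPl _ [set p] (ground N)) _) ?sub1set //.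
by rewrite iM iN setUA setUid iM.
Qed.

Let up_M (I J K : {set T}) : parallel_indep I ->
  indep N (p |: I :&: ground N) ->
  ~~ indep M (p |: I :&: ground M) || (p \notin K) ->
  indep M K -> K \subset p |: J :&: ground M -> #|I :&: ground M| < #|K| ->
  exists2 x, x \in J :\: I & parallel_indep (x |: I).
Proof.
move=> iI iNp hp iK sK lt.
have iM : indep M (I :&: ground M) by move: iI; rewrite parallel_indepE => /and4P[].
have [x /setDP[xK xI] ix] := indep_aug iM iK lt.
have xp : x != p.
  by apply: contraTneq hp => e; rewrite -e xK ix.
move: (subsetP sK _ xK); rewrite in_setU1 (negbTE xp) => /setIP[xJ xM].
have {}xI : x \notin I by move: xI; rewrite inE xM andbT.
by exists x; rewrite ?inE ?xI // add_M // iNp.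
Qed.

Let up_Mp (I J K : {set T}) : parallel_indep I ->
  indep M (p |: I :&: ground M) ->
  indep M K -> K \subset p |: J :&: ground M ->
  #|p |: I :&: ground M| < #|K| ->
  exists2 x, x \in J :\: I & parallel_indep (x |: I).
Proof.
move=> iI ip iK sK lt.
have [x /setDP[xK]] := indep_aug ip iK lt; rewrite in_setU1 negb_or.
case/andP=> xp xI ix.
move: (subsetP sK _ xK); rewrite in_setU1 (negbTE xp) => /setIP[xJ xM].
have {}xI : x \notin I by move: xI; rewrite inE xM andbT.
exists x; rewrite ?inE ?xI // add_M // ?ix ?orbT //.
by apply: indepS ix; rewrite setUS // subsetUr.
Qed.

Let up_N (I J K : {set T}) : parallel_indep I ->
  indep M (p |: I :&: ground M) ->
  ~~ indep N (p |: I :&: ground N) || (p \notin K) ->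
  indep N K -> K \subset p |: J :&: ground N -> #|I :&: ground N| < #|K| ->
  exists2 x, x \in J :\: I & parallel_indep (x |: I).
Proof.
move=> iI iNp hp iK sK lt.
have iM : indep N (I :&: ground N) by move: iI; rewrite parallel_indepE => /and4P[].
have [x /setDP[xK xI] ix] := indep_aug iM iK lt.
have xp : x != p.
  by apply: contraTneq hp => e; rewrite -e xK ix.
move: (subsetP sK _ xK); rewrite in_setU1 (negbTE xp) => /setIP[xJ xM].
have {}xI : x \notin I by move: xI; rewrite inE xM andbT.
by exists x; rewrite ?inE ?xI // add_N // iNp.
Qed.

Let up_Np (I J K : {set T}) : parallel_indep I ->
  indep N (p |: I :&: ground N) ->
  indep N K -> K \subset p |: J :&: ground N ->
  #|p |: I :&: ground N| < #|K| ->
  exists2 x, x \in J :\: I & parallel_indep (x |: I).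
Proof.
move=> iI ip iK sK lt.
have [x /setDP[xK]] := indep_aug ip iK lt; rewrite in_setU1 negb_or.
case/andP=> xp xI ix.
move: (subsetP sK _ xK); rewrite in_setU1 (negbTE xp) => /setIP[xJ xM].
have {}xI : x \notin I by move: xI; rewrite inE xM andbT.
exists x; rewrite ?inE ?xI // add_N // ?ix ?orbT //.
by apply: indepS ix; rewrite setUS // subsetUr.
Qed.

Fact parallel_aug (I J : {set T}) :
  parallel_indep I -> parallel_indep J -> #|I| < #|J| ->
  exists2 x, x \in J :\: I & parallel_indep (x |: I).
Proof.
move=> hI hJ ltIJ.
move: (hI) (hJ); rewrite !parallel_indepE.
move=> /and4P[/card_split cI iMI iNI ipI] /and4P[/card_split cJ iMJ iNJ ipJ].
have sMJ : J :&: ground M \subset p |: J :&: ground M by apply: subsetUr.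
have sNJ : J :&: ground N \subset p |: J :&: ground N by apply: subsetUr.
have cMI : #|p |: I :&: ground M| = #|I :&: ground M| + (p \notin I).
  by rewrite cardsU1 inE pM andbT addnC.
have cNI : #|p |: I :&: ground N| = #|I :&: ground N| + (p \notin I).
  by rewrite cardsU1 inE pN andbT addnC.
have cMJ : #|p |: J :&: ground M| = #|J :&: ground M| + (p \notin J).
  by rewrite cardsU1 inE pM andbT addnC.
have cNJ : #|p |: J :&: ground N| = #|J :&: ground N| + (p \notin J).
  by rewrite cardsU1 inE pN andbT addnC.
have pI_M : p \in I -> indep M (p |: I :&: ground M).
  by move=> pI; rewrite (setUidPr _) // sub1set inE pI.
have pI_N : p \in I -> indep N (p |: I :&: ground N).
  by move=> pI; rewrite (setUidPr _) // sub1set inE pI.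
case iMp: (indep M (p |: I :&: ground M)) ipI => ipI;
case iNp: (indep N (p |: I :&: ground N)) ipI => // _.
- case pI: (p \in I) cI cMI cNI => cI cMI cNI.
    have [lt|leM] := ltnP #|I :&: ground M| #|J :&: ground M|.
      by apply: (@up_Mp _ _ (J :&: ground M)); rewrite // cMI addn0.
    have [lt|leN] := ltnP #|I :&: ground N| #|J :&: ground N|.
      by apply: (@up_Np _ _ (J :&: ground N)); rewrite // cNI addn0.
    have pJ : p \in J = false.
      apply/negP => pJ; have := leq_add leM leN; rewrite -cI -cJ pJ.
      by rewrite leq_add2r leqNgt ltIJ.
    have e : #|I :&: ground M| + #|I :&: ground N|
               <= #|J :&: ground M| + #|J :&: ground N|.
      by rewrite -cI -cJ pJ addn0 addn1.
    case/orP: ipJ => ipJ.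
      apply: (@up_Mp _ _ (p |: J :&: ground M)); rewrite // cMI cMJ pJ addn0 addn1.
      by rewrite ltnS -(leq_add2r #|I :&: ground N|) (leq_trans e) // leq_add2l.
    apply: (@up_Np _ _ (p |: J :&: ground N)); rewrite // cNI cNJ pJ addn0 addn1.
    by rewrite ltnS -(leq_add2l #|I :&: ground M|) (leq_trans e) // leq_add2r.
  case pJ: (p \in J) cJ cMJ cNJ => /= cJ cMJ cNJ.
    by exists p; rewrite ?inE ?pI ?pJ ?add_p.
  have [lt|leM] := ltnP #|I :&: ground M| #|J :&: ground M|.
    by apply: (@up_M _ _ (J :&: ground M)); rewrite // inE pJ orbT.
  have [lt|leN] := ltnP #|I :&: ground N| #|J :&: ground N|.
    by apply: (@up_N _ _ (J :&: ground N)); rewrite // inE pJ orbT.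
  by have := leq_add leM leN; rewrite -cI -cJ !addn0 leqNgt ltIJ.
- have pI : p \in I = false by apply: contraFF iNp => /pI_N.
  have cI0 : #|I| = #|I :&: ground M| + #|I :&: ground N| by rewrite -cI pI addn0.
  move: cI0 => {}cI; rewrite pI /= addn1 in cNI; rewrite pI /= addn1 in cMI.
  have [lt|leM] := ltnP #|I :&: ground N| #|J :&: ground N|.
    by apply: (@up_N _ _ (J :&: ground N)); rewrite // iNp.
  have [lt|leN] := ltnP #|I :&: ground M|.+1 #|J :&: ground M|.
    by apply: (@up_Mp _ _ (J :&: ground M)); rewrite // cMI.
  case pJ: (p \in J) cJ cMJ cNJ => /= cJ cMJ cNJ.
    by case: (arith_p ltIJ (etrans cI (addnC _ _)) (etrans cJ (addnC _ _)) leM leN).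
  have [ge1 ge2] := arith_np ltIJ (etrans cI (addnC _ _)) (etrans cJ (addnC _ _)) leM leN.
  case/orP: ipJ => ipJ.
    by apply: (@up_Mp _ _ (p |: J :&: ground M));
      rewrite // cMI cMJ addn1 ltnS.
  by apply: (@up_N _ _ (p |: J :&: ground N));
      rewrite // ?iNp // cNJ addn1 ltnS.
- have pI : p \in I = false by apply: contraFF iMp => /pI_M.
  have cI0 : #|I| = #|I :&: ground M| + #|I :&: ground N| by rewrite -cI pI addn0.
  move: cI0 => {}cI; rewrite pI /= addn1 in cMI; rewrite pI /= addn1 in cNI.
  have [lt|leM] := ltnP #|I :&: ground M| #|J :&: ground M|.
    by apply: (@up_M _ _ (J :&: ground M)); rewrite // iMp.
  have [lt|leN] := ltnP #|I :&: ground N|.+1 #|J :&: ground N|.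
    by apply: (@up_Np _ _ (J :&: ground N)); rewrite // cNI.
  case pJ: (p \in J) cJ cMJ cNJ => /= cJ cMJ cNJ.
    by case: (arith_p ltIJ cI cJ leM leN).
  have [ge1 ge2] := arith_np ltIJ cI cJ leM leN.
  case/orP: ipJ => ipJ.
    by apply: (@up_M _ _ (p |: J :&: ground M));
      rewrite // ?iMp // cMJ addn1 ltnS.
  by apply: (@up_Np _ _ (p |: J :&: ground N));
      rewrite // cNI cNJ addn1 ltnS.
Qed.

Definition parallel_connection : matroid T :=
  Matroid parallel_ground parallel0 parallelS parallel_aug.

Definition two_sum : matroid T := delete parallel_connection [set p].

End ParallelConnection.

(* Two triangles {0,1,2} and {2,3,4} glued at 2. *)
Fact Y3_basepoint :
  basepoint (Ordinal (isT : 2 < 5)) (circuit_on [set x : 'I_5 | x <= 2])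
                                    (circuit_on [set x : 'I_5 | 2 <= x]).
Proof.
have c1 : #|[set x : 'I_5 | x <= 2]| = 3.
  by rewrite -sum1_card big_mkcond !big_ord_recl big_ord0 !inE.
have c2 : #|[set x : 'I_5 | 2 <= x]| = 3.
  by rewrite -sum1_card big_mkcond !big_ord_recl big_ord0 !inE.
rewrite /basepoint /circuit_on /= /uniform_indep /= !cards1 c1 c2 !sub1set !inE.
rewrite !andbT; apply/eqP/setP => x; rewrite !inE -val_eqE /=.
by rewrite eqn_leq.
Qed.

Definition Y3 : matroid 'I_5 := truncate 3 (parallel_connection Y3_basepoint).

Section Simplification.
Variables (T : finType) (M : matroid T).

Definition nonloops : {set T} := [set x | indep M [set x]].

Definition parallel : rel T :=
  [rel x y | (x == y) || ([set x; y] \in circuits M)].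

(* One representative is kept from each parallel class of non-loops. *)
Definition simplification : matroid T :=
  restrict M (transversal (equivalence_partition parallel nonloops) nonloops).

End Simplification.

Definition connected_elts (T : finType) (M : matroid T) : rel T :=
  [rel x y | (x == y) || [exists C in circuits M, (x \in C) && (y \in C)]].

Definition components (T : finType) (M : matroid T) : {set {set T}} :=
  equivalence_partition (connected_elts M) (ground M).

Definition is_two_sum (T T1 T2 : finType) (M : matroid T)
    (N1 : matroid T1) (N2 : matroid T2) : Prop :=
  exists (U : finType) (p : U) (M1 M2 : matroid U) (bp : basepoint p M1 M2),
    [/\ isomorphic M1 N1, isomorphic M2 N2 & isomorphic M (two_sum bp)].

(* [attach_U24 C K M]: M arises from the circuit with ground set C by
   2-summing on a copy of U_{2,4} across each element of K, a subset of C. *)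
Inductive attach_U24 (T : finType) (C : {set T}) : {set T} -> matroid T -> Prop :=
| attach_none : attach_U24 C set0 (circuit_on C)
| attach_one (K : {set T}) (M Q : matroid T) (p : T) (bp : basepoint p M Q) :
    attach_U24 C K M -> p \in C -> p \notin K -> isomorphic Q (uniform 2 4) ->
    attach_U24 C (p |: K) (two_sum bp).

Definition circuit_with_U24s (T : finType) (n k : nat) (M : matroid T) : Prop :=
  exists (U : finType) (C K : {set U}) (L : matroid U),
    [/\ #|C| = n, #|K| = k, attach_U24 C K L & isomorphic M L].

(* Main.v *)
(** The bridge between excluded minors and laminar capacities is the "shape" of
    a component: a set [S] and disjoint triples [P] such that a set is
    independent exactly when it contains no triple and has fewer than
    [|S| + 2|P|] elements. These are the matroids obtained from a circuit with
    [|S| + |P|] elements by 2-summing a [U_{2,4}] across [|P|] of them.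

    To find the shape in a simple connected matroid of rank at least two without
    the excluded minors, take a circuit [C] of maximum size. If [C] did not span,
    a minimal set [Z] outside its closure and not skew to it would give a union
    [C u Z] of corank two, whose series classes form either a larger circuit or
    a [Y_3]-minor. If [C] spans and has at least four elements, excluding
    [U_{3,5}] and [Y_3] puts every other element on a line with exactly two
    elements of [C], and excluding [U_{2,5}] and [Y_3] makes these lines
    pairwise disjoint; exchanging elements along them shows that every
    transversal of the lines is a spanning circuit.

    Conversely a shape gives a laminar family, with the ranks as capacities, and
    a ternary code of relations in which each triple together with its basepoint
    carries the tetracode. *)
Require Import Defs.
From mathcomp Require Import all_boot all_order all_algebra.
From mathcomp Require Import zify ring.

Set Implicit Arguments.
Unset Strict Implicit.
Unset Printing Implicit Defensive.

(** * Rank, circuits and connectedness *)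

(** Corank two is where the excluded minors become visible. If [W] has nullity two and no coloops,
    its dual is a line, and a rank-two matroid without loops is just a partition into parallel
    classes, here the series classes of [W]. The dual of [U_{3,5}] has five singleton classes; the
    dual of [Y_3] has classes of sizes two, one, two. Hence without these minors [W] has at most
    four series classes, and if it has three or more, at most one of them is not a singleton. The
    bound [|S| + 2|P|] of a shape is its rank plus one: 2-summing a [U_{2,4}] trades an element of
    [S] for a triple and raises the rank by one. Shapes describe the nontrivial components of the
    simplification only. To get back to the whole matroid, loops and parallel classes are handled by
    a map to representatives, and components of rank at most one by a flag that suspends the size
    bound. *)

Section Rank.
Variables (T : finType) (M : matroid T).
Implicit Types (x y e : T) (A B C D I J X Y Z W : {set T}).

Lemma rank_card X : rank M X <= #|X|.
Proof. by apply: rank_le => I sI _; apply: subset_leq_card. Qed.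

Lemma rankS X Y : X \subset Y -> rank M X <= rank M Y.
Proof.
by move=> sXY; apply: rank_le => I sI iI; apply: rank_ge iI; apply: subset_trans sXY.
Qed.

Lemma indep_rank I : indep M I = (rank M I == #|I|).
Proof.
apply/idP/eqP => [iI|eI]; first by apply/eqP; rewrite eqn_leq rank_card rank_ge.
have [J /andP[sJ iJ] eJ] := rank_ex M I.
by move: sJ; rewrite subEproper properEcard -eJ eI ltnn andbF orbF => /eqP <-.
Qed.

Lemma indep_extend I X : indep M I -> I \subset X ->
  exists J, [/\ I \subset J, J \subset X, indep M J & #|J| = rank M X].
Proof.
move=> iI sI; pose P := [pred J : {set T} | (J \subset X) && indep M J].
have [|J /maxsetP[/andP[sJ iJ] mJ] sIJ] := @maxset_exists _ P I.
  by rewrite /P /= sI iI.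
exists J; split=> //; apply/eqP; rewrite eqn_leq rank_ge //= leqNgt.
apply/negP; have [K /andP[sK iK] ->] := rank_ex M X => lt.
have [x /setDP[xK xJ] ix] := indep_aug iJ iK lt.
have := mJ (x |: J); rewrite /P /= ix subUset sub1set (subsetP sK _ xK) sJ subsetUr.
by move=> /(_ isT isT) eJ; move: xJ; rewrite -eJ setU11.
Qed.

Lemma rank_submod X Y :
  rank M (X :|: Y) + rank M (X :&: Y) <= rank M X + rank M Y.
Proof.
have [I /andP[sI iI] eI] := rank_ex M (X :&: Y).
have [|J [sIJ sJ iJ eJ]] := @indep_extend I (X :|: Y) iI.
  by rewrite (subset_trans sI) // subIset // subsetUl.
rewrite eI -eJ; have h Z : #|J :&: Z| <= rank M Z.
  by apply: rank_ge (subsetIr _ _) (indepS (subsetIl _ _) iJ).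
apply: leq_trans (leq_add (h X) (h Y)); rewrite -(cardsUI (J :&: X)) -setIUr (setIidPl sJ) leq_add2l.
apply/subset_leq_card; rewrite setIACA setIid subsetI sIJ; exact: sI.
Qed.

Lemma rank1U x X : rank M (x |: X) <= (rank M X).+1.
Proof. by have := rankUl_le M [set x] X; rewrite cards1 add1n. Qed.

(** Membership in the closure. A point outside the ground set lies in no independent set, so every
    set spans it; this is why [spans_circuit] asks for [x \in ground M]. *)
Definition spans X x := rank M (x |: X) == rank M X.

Lemma spans_mem X x : x \in X -> spans X x.
Proof. by move=> xX; rewrite /spans (setUidPr _) ?sub1set. Qed.

Lemma spansS X Y x : X \subset Y -> spans X x -> spans Y x.
Proof.
move=> sXY /eqP e; rewrite /spans eqn_leq (rankS (subsetUr _ _)) andbT.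
have := rank_submod (x |: X) Y; rewrite -setUA (setUidPr sXY) e.
have : rank M X <= rank M ((x |: X) :&: Y) by apply: rankS; rewrite subsetI subsetUr.
lia.
Qed.

Lemma spansNE X x : spans X x = false -> rank M (x |: X) = (rank M X).+1.
Proof. by rewrite /spans; have := rank1U x X; have := rankS (subsetUr [set x] X); lia. Qed.

Lemma rank_span X Y : {in Y, forall y, spans X y} -> rank M (X :|: Y) = rank M X.
Proof.
have [n] := ubnP #|Y|; elim: n Y => // n IH Y leY hY.
have [->|[y yY]] := set_0Vmem Y; first by rewrite setU0.
have hD : rank M (X :|: (Y :\ y)) = rank M X.
  apply: IH => [|z]; last by rewrite inE => /andP[_]; apply: hY.
  by rewrite (cardsD1 y) yY in leY.
rewrite -(setD1K yY) setUCA -hD; apply/eqP.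
exact: spansS (subsetUl _ _) (hY y yY).
Qed.

Lemma spans_trans X Y x : {in Y, forall y, spans X y} -> spans Y x -> spans X x.
Proof.
move=> hY /(spansS (subsetUr X Y)) /eqP e; rewrite /spans eqn_leq.
rewrite (rankS (subsetUr _ _)) andbT -(rank_span hY) -e rankS //.
by rewrite setUS // subsetUl.
Qed.

Lemma circuitP C : reflect [/\ C \subset ground M, ~~ indep M C
    & {in C, forall x, indep M (C :\ x)}] (C \in circuits M).
Proof.
apply: (iffP idP) => [cC|[sC dC hC]]; last first.
  rewrite inE; apply/minsetP; split; first exact/andP.
  move=> B /andP[sB dB] sBC; apply/eqP; rewrite eqEsubset sBC.
  apply/subsetP => x xC; apply: contraR dB => xB; apply: indepS (hC x xC).
  by rewrite subsetD1 sBC.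
have /andP[sC dC] := circuit_dep cC; split=> // x xC.
apply/negPn/negP => dx; move: cC; rewrite inE => /minsetP[_ /(_ (C :\ x))].
rewrite /dependent dx (subset_trans (subD1set _ _) sC) subD1set => /(_ isT isT) e.
by move: xC; rewrite -e !inE eqxx.
Qed.

Lemma circuit_ground C : C \in circuits M -> C \subset ground M.
Proof. by case/circuitP. Qed.

Lemma circuit_neq0 C : C \in circuits M -> exists x, x \in C.
Proof.
by case/circuitP=> _ d _; apply/set0Pn; apply: contraNneq d => ->; apply: indep0.
Qed.

Lemma circuit_rank C : C \in circuits M -> (rank M C).+1 = #|C|.
Proof.
move=> cC; have [x xC] := circuit_neq0 cC.
case/circuitP: cC => _ d /(_ x xC) ix; have := rank_card C.
have := rankS (subD1set C x); move: d ix; rewrite !indep_rank (cardsD1 x C) xC; lia.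
Qed.

Lemma circuit_proper C X : C \in circuits M -> X \proper C -> indep M X.
Proof.
case/circuitP=> _ _ hC /properP[sX [x xC xX]]; apply: indepS (hC x xC).
by rewrite subsetD1 sX.
Qed.

Lemma circuit_spans C x : C \in circuits M -> x \in C -> spans (C :\ x) x.
Proof.
move=> cC xC; rewrite /spans setD1K //; have := circuit_rank cC.
case/circuitP: cC => _ _ /(_ x xC); rewrite indep_rank (cardsD1 x C) xC; lia.
Qed.

Lemma spans_circuit X x : x \in ground M -> x \notin X -> spans X x ->
  exists D, [/\ D \in circuits M, x \in D & D \subset x |: X].
Proof.
move=> xM xX /eqP e; have [J /andP[sJ iJ] eJ] := rank_ex M X.
have xJ : x \notin J by apply: contra xX; apply: (subsetP sJ).
have [|D cD sD] := @dependent_circuit _ M (x |: J).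
  rewrite /dependent subUset sub1set xM (indep_ground iJ) /=.
  apply/negP => /(rank_ge (setUS [set x] sJ)); rewrite e eJ cardsU1 xJ; lia.
exists D; split=> //; last exact: subset_trans sD (setUS _ sJ).
apply: contraT => xD; have /circuitP[_ /negP[]] := cD.
apply: indepS iJ; rewrite -(setU1K xJ); by rewrite subsetD1 sD.
Qed.

(** A closure argument: [D] shows that the union without [x] and [y] spans [y], so it spans [C :\ x]
    and therefore [x]. The required circuit is a fundamental circuit of [x]. *)
Lemma strong_elim C D x y : C \in circuits M -> D \in circuits M ->
  x \in C -> x \notin D -> y \in C -> y \in D ->
  exists F, [/\ F \in circuits M, x \in F & F \subset (C :|: D) :\ y].
Proof.
move=> cC cD xC xD yC yD; pose V := (C :|: D) :\ y :\ x.
have nyx : y != x by apply: contraNneq xD => <-.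
have sy : spans V y.
  apply: spansS (circuit_spans cD yD); apply/subsetP => z; rewrite !inE.
  case/andP=> -> zD; rewrite zD orbT !andbT /=.
  by apply: contraNneq xD => <-.
have sx : spans V x.
  apply: (@spans_trans V (C :\ x)); last exact: circuit_spans.
  move=> z; rewrite !inE => /andP[zx zC]; have [->//|zy] := eqVneq z y.
  by apply: spans_mem; rewrite !inE zx zy zC.
have [||F [cF xF sF]] := spans_circuit _ _ sx.
- exact: (subsetP (circuit_ground cC)).
- by rewrite !inE eqxx.
exists F; split=> //; rewrite (subset_trans sF) // /V setD1K //.
by rewrite !inE eq_sym nyx xC.
Qed.

(** Nullity is supermodular. Two sets of positive nullity whose union has nullity at most one meet
    in a set of positive nullity. *)
Lemma dep_cap A B : ~~ indep M A -> ~~ indep M B ->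
  #|A :|: B| <= (rank M (A :|: B)).+1 -> ~~ indep M (A :&: B).
Proof.
rewrite !indep_rank; have := rank_submod A B; have := cardsUI A B.
have := rank_card A; have := rank_card B; have := rank_card (A :&: B); lia.
Qed.

Lemma connected_refl x : connected_elts M x x.
Proof. by rewrite /connected_elts /= eqxx. Qed.

Lemma connected_sym x y : connected_elts M x y = connected_elts M y x.
Proof.
rewrite /connected_elts /= eq_sym; congr orb.
by apply/exists_inP/exists_inP => -[C cC h]; exists C; rewrite // andbC.
Qed.

(* Choose the circuits with the smallest union; eliminating a common element
   on either side yields another such pair inside a smaller union. *)
Lemma connected_trans y x z :
  connected_elts M x y -> connected_elts M y z -> connected_elts M x z.
Proof.
rewrite /connected_elts /=.
case: eqVneq => [->//|_] /=; case: (eqVneq y z) => [->|_] /=.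
  by move=> ->; rewrite orbT.
case/exists_inP => C cC /andP[xC yC] /exists_inP[D cD /andP[yD zD]].
apply/orP; right.
have [n] := ubnP #|C :|: D|; elim: n => // n IH in C D cC cD xC zD y yC yD *.
rewrite ltnS => leCD.
have [zC|zC] := boolP (z \in C); first by apply/exists_inP; exists C; rewrite ?xC.
have [xD|xD] := boolP (x \in D); first by apply/exists_inP; exists D; rewrite ?xD.
have yCD : y \in C :|: D by rewrite inE yC.
have [F [cF xF sF]] := strong_elim cC cD xC xD yC yD.
have [G [cG zG sG]] := strong_elim cD cC zD zC yD yC.
have {}sG : G \subset (C :|: D) :\ y by rewrite setUC.
have [zF|zF] := boolP (z \in F); first by apply/exists_inP; exists F; rewrite ?xF.
have sub A B : A \in circuits M -> B \in circuits M ->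
    A \subset (C :|: D) :\ y -> B \in [set C; D] -> {w | w \in A & w \notin B}.
  move=> cA cB sA BCD; apply/sig2W => /=; apply/exists_inP.
  rewrite -[X in is_true X]negbK negb_exists_in; apply/negP => /forall_inP h.
  have sAB : A \subset B by apply/subsetP => w /h; rewrite negbK.
  have /circuitP[_ /negP[]] := cA; apply: circuit_proper cB _.
  rewrite properE sAB /=; apply/subsetPn; exists y.
    by move: BCD; rewrite !inE => /orP[] /eqP->.
  by apply/negP => /(subsetP sA); rewrite !inE eqxx.
have small A B w : A \in circuits M -> B \in circuits M -> x \in A -> z \in B ->
   w \in A -> w \in B -> #|A :|: B| < #|C :|: D| -> 
   [exists C in circuits M, (x \in C) && (z \in C)].
  by move=> cA cB xA zB wA wB lt; apply: (IH A B cA cB xA zB w wA wB); apply: leq_trans lt leCD.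
have sFU := subset_trans sF (subD1set _ _).
have sGU := subset_trans sG (subD1set _ _).
have [w wF wC] := sub F C cF cC sF (set21 _ _).
have wD : w \in D by move: (subsetP sFU w wF); rewrite inE (negbTE wC).
have ltU A B : A :|: B \subset C :|: D -> A :|: B != C :|: D ->
    #|A :|: B| < #|C :|: D|.
  by move=> sAB neAB; apply: proper_card; rewrite properEneq neAB.
(* If [C] and [G] cover the whole union, then [w] lies in both [F] and [G], whose union misses [y].
   Otherwise [C] and [G] meet, because [G] leaves [D], and their union is already smaller. *)
have [eqG|neG] := eqVneq (C :|: G) (C :|: D); last first.
  have [v vG vD] := sub G D cG cD sG (set22 _ _).
  have vC : v \in C by move: (subsetP sGU v vG); rewrite inE (negbTE vD) orbF.
  by apply: (small C G v) => //; apply: ltU; rewrite ?subUset ?subsetUl.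
have wG : w \in G by move/setP/(_ w): eqG; rewrite !inE (negbTE wC) wD.
apply: (small F G w) => //; apply: ltU; first by rewrite subUset sFU.
apply/eqP => /setP/(_ y); rewrite yCD inE => /orP[/(subsetP sF)|/(subsetP sG)];
  by rewrite !inE eqxx.
Qed.
End Rank.

(** * Isomorphisms and minors *)

(** A working form of [isomorphic]: the map is total on the ambient type but constrained only on the
    ground set. Obtaining one from a bijection of subtypes takes a point of the target type as value
    elsewhere, hence the arguments [u0] and [t0] below. *)
Definition iso_via (T U : finType) (f : T -> U) (M : matroid T) (N : matroid U) :=
  [/\ {in ground M &, injective f}, f @: ground M = ground N
    & forall I : {set T}, I \subset ground M -> indep N (f @: I) = indep M I].

Section Iso.
Variables (T U : finType) (M : matroid T) (N : matroid U).

Lemma iso_via_isomorphic f : iso_via f M N -> isomorphic M N.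
Proof.
case=> injf imf hI.
have fP (u : {x : T | x \in ground M}) : f (val u) \in ground N.
  by rewrite -imf imset_f // (valP u).
pose g u : {y : U | y \in ground N} :=
  Sub (f (val u)) (fP u).
have gval u : val (g u) = f (val u) by rewrite SubK.
have g_inj : injective g.
  move=> u v /(congr1 val); rewrite !gval => /injf e; apply: val_inj; apply: e; exact: valP.
exists g; split=> [|I].
  by apply: inj_card_bij => //; rewrite !card_sig -(card_in_imset injf) imf.
rewrite -hI; last by apply/subsetP => _ /imsetP[u _ ->]; apply: valP.
congr (indep N _); rewrite -!imset_comp; exact: eq_imset.
Qed.

Lemma isomorphic_via (u0 : U) : isomorphic M N -> exists f, iso_via f M N.
Proof.
case=> f [[g fK gK] hI].
pose F x := if insub x is Some u then val (f u) else u0.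
have FE u : F (val u) = val (f u) by rewrite /F valK.
exists F; split=> [x y xM yM||I sI].
- rewrite -[x](SubK {x : T | x \in ground M} xM) -[y](SubK {x : T | x \in ground M} yM).
  by rewrite !FE => /val_inj /(can_inj fK) ->.
- apply/setP => y; apply/imsetP/idP => [[x xM ->]|yN].
    rewrite -[x](SubK {x : T | x \in ground M} xM) FE; exact: valP.
  exists (val (g (Sub y yN))); first exact: valP.
  by rewrite FE gK SubK.
have -> : I = [set val x | x in [set x : {x : T | x \in ground M} | val x \in I]].
  apply/setP => x; apply/idP/imsetP => [xI|[u]]; last by rewrite inE => uI ->.
  exists (Sub x (subsetP sI x xI)); by rewrite ?inE SubK.
rewrite -hI; congr (indep N _); rewrite -!imset_comp; exact: eq_imset.
Qed.

Lemma iso_via_inv (t0 : T) f : iso_via f M N ->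
  exists g, iso_via g N M /\ {in ground M, cancel f g}.
Proof.
case=> injf imf hI.
pose g y := odflt t0 [pick x in ground M | f x == y].
have gK : {in ground M, cancel f g}.
  move=> x xM; rewrite /g; case: pickP => [z /andP[zM /eqP /injf -> //]|/(_ x)].
  by rewrite xM eqxx.
have fK : {in ground N, cancel g f}.
  by move=> y; rewrite -imf => /imsetP[x xM ->]; rewrite gK.
exists g; split=> //; split.
- by move=> x y xN yN e; rewrite -(fK x) // -(fK y) // e.
- rewrite -imf -imset_comp -[RHS]imset_id; exact: eq_in_imset.
move=> I sI.
have sgI : g @: I \subset ground M.
  apply/subsetP => _ /imsetP[y yI ->]; move: (subsetP sI y yI); rewrite -imf.
  by case/imsetP=> x xM ->; rewrite gK.
rewrite -hI // -imset_comp; congr (indep N _); rewrite -[RHS]imset_id.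
by apply: eq_in_imset => y yI; apply: fK; apply: (subsetP sI).
Qed.
End Iso.

Lemma isomorphic_sym (T U : finType) (M : matroid T) (N : matroid U) :
  isomorphic M N -> isomorphic N M.
Proof.
case=> f [[g fK gK] hI]; exists g; split=> [|I]; first by exists f.
rewrite -hI; suff -> : f @: (g @: I) = I by [].
apply/setP => y; rewrite -imset_comp; apply/imsetP/idP => [[z zI ->]|yI].
  by rewrite /= gK.
by exists y; rewrite //= gK.
Qed.

Section Minor.
Variables (T U : finType) (M : matroid T) (N : matroid U).

(** A basis of the contracted set has the same closure, so joining it to [I] has the same rank as
    joining all of [C]. *)
Lemma contract_basis (C B I : {set T}) :
  B \subset C -> indep M B -> rank M C = #|B| -> I \subset ground M :\: C ->
  indep (contract M C) I = indep M (B :|: I).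
Proof.
move=> sB iB rC sI; rewrite /= /contract_indep /= sI /= rC indep_rank.
have dIC : [disjoint I & C] by move: sI; rewrite subsetD => /andP[].
have -> : rank M (I :|: C) = rank M (B :|: I).
  have -> : I :|: C = (B :|: I) :|: C by rewrite setUAC (setUidPr sB) setUC.
  apply: rank_span => y yC; apply: spansS (subsetUl B I) _.
  rewrite /spans eqn_leq (rankS _ (subsetUr _ _)) andbT.
  move: iB; rewrite indep_rank => /eqP ->; rewrite -rC; apply: rankS.
  by rewrite subUset sub1set yC.
rewrite cardsU disjoint_setI0 ?cards0 ?subn0 1?addnC // disjoint_sym.
exact: disjointWr sB dIC.
Qed.

(** A minor seen inside [M]: [C] is contracted, the image of [f] is kept and all the rest is
    deleted, so no deleted set is named. The last clause at the empty set forces [C] to be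
    independent. *)
Definition minor_config (C : {set T}) (f : U -> T) :=
  [/\ injective f, forall i, f i \notin C, forall i, f i \in ground M
    & forall I : {set U}, indep N I = indep M (C :|: f @: I)].

Hypothesis gN : ground N = [set: U].

Lemma has_minor_config (u0 : U) : has_minor M N ->
  exists C f, indep M C /\ minor_config C f.
Proof.
case=> C [D [sC sD dCD /(isomorphic_via u0)[h hV]]].
have [t0 _ _] : exists2 t0, t0 \in ground (delete (contract M C) D) & h t0 = u0.
  by case: hV => _ /setP/(_ u0); rewrite gN inE => /imsetP[t0]; exists t0.
have [g [[injg img hg] _]] := iso_via_inv t0 hV.
rewrite gN in injg img hg.
have gG i : g i \in ground (delete (contract M C) D) by rewrite -img imset_f.
have [B /andP[sB iB] rB] := rank_ex M C.
exists B, g; split=> //; split=> [i j|i|i|I].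
- by apply: injg; rewrite inE.
- by apply: contraTN (gG i) => /(subsetP sB) gC; rewrite !inE gC.
- by move: (gG i); rewrite !inE => /andP[/andP[]].
have sI : g @: I \subset ground (delete (contract M C) D).
  by apply/subsetP => _ /imsetP[i _ ->].
rewrite -hg ?subsetT //.
have -> : indep (delete (contract M C) D) (g @: I) = indep (contract M C) (g @: I).
  by rewrite /= /restrict_indep /= (subset_trans sI) // subsetIr.
apply: contract_basis => //; exact: subset_trans sI (subsetIl _ _).
Qed.

Lemma config_has_minor C f : minor_config C f -> has_minor M N.
Proof.
case=> injf fC fM hI.
have iC : indep M C by have := hI set0; rewrite indep0 imset0 setU0 => <-.
have sCM := indep_ground iC.
have sf (I : {set U}) : f @: I \subset ground M :\: C.
  by apply/subsetP => _ /imsetP[i _ ->]; rewrite inE fC fM.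
exists C, ((ground M :\: C) :\: f @: [set: U]); split=> //.
- by rewrite (subset_trans (subsetDl _ _)) ?subsetDl.
- rewrite -setI_eq0; apply/eqP/setP => x; rewrite !inE; by case: (x \in C); rewrite ?andbF.
set L := delete _ _.
have gL : ground L = f @: [set: U].
  by rewrite /L /= setDDr setDv set0U (setIidPr (sf _)) (setIidPr (sf _)).
have iV : iso_via f N L.
  split; rewrite ?gN //; first by move=> i j _ _ /injf.
  move=> I _; rewrite hI /L /= /restrict_indep /=.
  rewrite setDDr setDv set0U (setIidPr (sf _)) imsetS ?subsetT //.
  have iE : rank M C = #|C| by apply/eqP; rewrite -indep_rank.
  by have := contract_basis (subxx C) iC iE (sf I).
exact: isomorphic_sym (iso_via_isomorphic iV).
Qed.
End Minor.

(** A matroid is determined by its bases. On either side an independent set is extended inside its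
    union with the common base [J0]; it then reaches size [r], where [hr] carries it to the other
    side. *)
Lemma config_of_bases (T U : finType) (M : matroid T) (N : matroid U) r
    (C : {set T}) (f : U -> T) :
  injective f -> (forall i, f i \notin C) -> (forall i, f i \in ground M) ->
  (forall J : {set U}, #|J| = r -> indep N J = indep M (C :|: f @: J)) ->
  (exists2 J : {set U}, #|J| = r & indep N J) ->
  (forall J : {set U}, indep N J -> #|J| <= r) ->
  (forall J : {set U}, indep M (C :|: f @: J) -> #|J| <= r) ->
  minor_config M N C f.
Proof.
move=> injf fC fM hr [J0 cJ0 iJ0] hN hM; split=> // I.
have cCf (J : {set U}) : #|C :|: f @: J| = #|C| + #|J|.
  rewrite cardsU (card_imset _ injf) disjoint_setI0 ?cards0 ?subn0 //.
  rewrite disjoint_sym disjoint_subset; apply/subsetP => _ /imsetP[i _ ->].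
  by rewrite inE fC.
have iM0 : indep M (C :|: f @: J0) by rewrite -hr.
apply/idP/idP => iI.
  have [J [sIJ _ iJ cJ]] := indep_extend iI (subsetUl I J0).
  have rJ : #|J| = r.
    apply/eqP; rewrite eqn_leq hN //= cJ -cJ0.
    exact: rank_ge (subsetUr _ _) iJ0.
  by move: iJ; rewrite hr //; apply: indepS; rewrite setUS // imsetS.
have [K [sIK sK iK cK]] := indep_extend iI (subsetUl _ (f @: J0)).
pose J := [set i | f i \in K].
have eK : K = C :|: f @: J.
  apply/setP => x; apply/idP/setUP => [xK|[xC|/imsetP[i]]].
  - move: (subsetP sK x xK); rewrite !inE -orbA => /or3P[->|xf|xf]; try by left.
      by right; case/imsetP: xf xK => i _ -> iK'; apply/imsetP; exists i; rewrite ?inE.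
    by right; case/imsetP: xf xK => i _ -> iK'; apply/imsetP; exists i; rewrite ?inE.
  - by apply: (subsetP sIK); rewrite inE xC.
  by rewrite inE => iK' ->.
have rJ : #|J| = r.
  apply/eqP; rewrite eqn_leq hM -?eK //= -(leq_add2l #|C|) -cCf -eK cK -cJ0 -cCf.
  apply: rank_ge iM0; rewrite -setUA setUS // subsetUr //.
have iJ : indep N J by rewrite hr // -eK.
apply: indepS iJ; apply/subsetP => i iI'; rewrite inE; apply: (subsetP sIK).
by rewrite inE imset_f ?orbT.
Qed.

Lemma card_ord5 (I : {set 'I_5}) : #|I| =
  (@Ordinal 5 0 isT \in I) + (@Ordinal 5 1 isT \in I) + (@Ordinal 5 2 isT \in I)
  + (@Ordinal 5 3 isT \in I) + (@Ordinal 5 4 isT \in I).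
Proof.
rewrite -sum1_card big_mkcond !big_ord_recl big_ord0 /= addn0 !addnA.
have e b : (if b then 1 else 0) = nat_of_bool b by case: b.
rewrite !e; congr (_ + _ + _ + _ + _); congr nat_of_bool; congr (_ \in I); exact: val_inj.
Qed.

Lemma forall_ord5 (p : pred 'I_5) : [forall i, p i] =
  [&& p (@Ordinal 5 0 isT), p (@Ordinal 5 1 isT), p (@Ordinal 5 2 isT),
      p (@Ordinal 5 3 isT) & p (@Ordinal 5 4 isT)].
Proof.
apply/forallP/and5P => [h|[h0 h1 h2 h3 h4] [[|[|[|[|[|i]]]]] ltI]] //;
  by rewrite (bool_irrelevance ltI isT).
Qed.

(** The third circuit of the parallel connection, formed by the four points other than the
    basepoint, is too large for rank three; after truncation only the two triangles and the size
    bound remain. *)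
Lemma Y3_indepE (I : {set 'I_5}) : indep Y3 I =
  [&& #|I| <= 3, ~~ ([set x : 'I_5 | x <= 2] \subset I)
    & ~~ ([set x : 'I_5 | 2 <= x] \subset I)].
Proof.
have c1 : #|[set x : 'I_5 | x <= 2]| = 3 by rewrite card_ord5 !inE.
have c2 : #|[set x : 'I_5 | 2 <= x]| = 3 by rewrite card_ord5 !inE.
rewrite /= /truncate_indep /= (parallel_indepE Y3_basepoint) /= /uniform_indep /=.
rewrite c1 c2.
have sub (A B : {set 'I_5}) : (A \subset B) = [forall i, (i \in A) ==> (i \in B)].
  apply/subsetP/forall_inP; exact.
rewrite !sub !forall_ord5 !card_ord5 !inE /=.
move: (_ \in I) (_ \in I) (_ \in I) (_ \in I) (_ \in I).
by do 5!case.
Qed.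

Lemma Y3_indep_mem (I : {set 'I_5}) : indep Y3 I = [&& #|I| <= 3,
     ~~ [&& @Ordinal 5 0 isT \in I, @Ordinal 5 1 isT \in I & @Ordinal 5 2 isT \in I]
   & ~~ [&& @Ordinal 5 2 isT \in I, @Ordinal 5 3 isT \in I & @Ordinal 5 4 isT \in I]].
Proof.
have sub (A B : {set 'I_5}) : (A \subset B) = [forall i, (i \in A) ==> (i \in B)].
  by apply/subsetP/forall_inP; exact.
by rewrite Y3_indepE !sub !forall_ord5 !inE /= !andbT.
Qed.

Lemma Y3_ground : ground Y3 = [set: 'I_5].
Proof. by apply/setP => i; rewrite !inE leq_total. Qed.

(** * Excluded minors recognised from their duals *)

Section CorankTwo.
Variables (T : finType) (M : matroid T) (W : {set T}).
Hypotheses (WM : W \subset ground M) (depW : {in W, forall w, ~~ indep M (W :\ w)}).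

(** Contracting all of [W] except five points leaves a matroid whose bases are complements of pairs,
    so only pairs have to be compared. [depW] supplies the bound three on independent sets. *)
Lemma config_corank2 (N : matroid 'I_5) (f : 'I_5 -> T) :
  injective f -> (forall i, f i \in W) ->
  (forall i j, i != j -> indep N (~: [set i; j]) = indep M (W :\ f i :\ f j)) ->
  (exists i j, i != j /\ indep N (~: [set i; j])) ->
  (forall J, indep N J -> #|J| <= 3) ->
  minor_config M N (W :\: f @: [set: 'I_5]) f.
Proof.
move=> injf fW hf [i0 [j0 [ne0 i0j0]]] hN.
have cC (J : {set 'I_5}) : #|~: J| = 5 - #|J|.
  by have := cardsC J; rewrite card_ord; lia.
have eW (J : {set 'I_5}) : (W :\: f @: [set: 'I_5]) :|: f @: J = W :\: f @: (~: J).
  apply/setP => x; rewrite !inE; case: (boolP (x \in f @: J)) => [|xJ]; rewrite ?orbT ?orbF.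
    case/imsetP=> i iJ ->; rewrite fW andbT; apply/esym/negP => /imsetP[j].
    by rewrite inE => jJ /injf ej; move: jJ; rewrite -ej iJ.
  case: (x \in W); rewrite ?andbF // !andbT; congr negb.
  apply/imsetP/imsetP => -[i iJ e]; exists i; rewrite ?inE //.
  by apply: contra xJ => iJ'; rewrite e imset_f.
have pairW i j : W :\: f @: [set i; j] = W :\ f i :\ f j.
  by apply/setP => x; rewrite imsetU1 imset_set1 !inE negb_or andbA [(x != f i) && _]andbC.
apply: (config_of_bases (r := 3)) => //.
- by move=> i; rewrite inE imset_f // inE.
- by move=> i; apply: (subsetP WM).
- move=> J cJ; rewrite eW.
  have /cards2P[i [j [ij eJ]]] : #|~: J| == 2 by rewrite cC cJ.
  by rewrite eJ pairW -hf // -eJ setCK.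
- by exists (~: [set i0; j0]); rewrite // cC cards2 ne0.
move=> J; rewrite eW leqNgt; apply: contraTN => ltJ.
(* More than three of the five points omit at most one, so the set in question contains [W] minus a
   single point, which is dependent. *)
have [i hi] : exists i, ~: J \subset [set i].
  have := cC J; have [->|[i iJ]] := set_0Vmem (~: J) => e.
    by exists ord0; rewrite sub0set.
  exists i; have : #|~: J| == 1.
    have : 0 < #|~: J| by apply/card_gt0P; exists i.
    lia.
  by case/cards1P => k ek; move: iJ; rewrite ek inE => /eqP->.
apply: contra (depW (fW i)); apply: indepS.
rewrite -(imset_set1 f); apply: setDS; exact: imsetS.
Qed.

Let fun5 (x0 x1 x2 x3 x4 : T) (i : 'I_5) : T := nth x0 [:: x0; x1; x2; x3; x4] i.

Let fun5_inj x0 x1 x2 x3 x4 :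
  uniq [:: x0; x1; x2; x3; x4] -> injective (fun5 x0 x1 x2 x3 x4).
Proof.
by move=> u i j /eqP; rewrite nth_uniq // => /eqP/val_inj.
Qed.

(** In the dual line, five pairwise nonparallel points: the dual of [U_{3,5}] is [U_{2,5}]. *)
Lemma U35_corank2 x0 x1 x2 x3 x4 :
  uniq [:: x0; x1; x2; x3; x4] -> {subset [:: x0; x1; x2; x3; x4] <= W} ->
  {in [:: x0; x1; x2; x3; x4] &, forall x y, x != y -> indep M (W :\ x :\ y)} ->
  has_minor M (uniform 3 5).
Proof.
move=> u s h; have fs i : fun5 x0 x1 x2 x3 x4 i \in [:: x0; x1; x2; x3; x4].
  exact: mem_nth.
have injf := fun5_inj u.
have c2 (i j : 'I_5) : i != j -> indep (uniform 3 5) (~: [set i; j]).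
  move=> ij; rewrite /= /uniform_indep /= subsetT.
  by have := cardsC [set i; j]; rewrite card_ord cards2 ij => -[]; rewrite add0n => ->.
apply: (@config_has_minor _ _ _ _ _ _ (fun5 x0 x1 x2 x3 x4)) => //.
apply: config_corank2 => //.
- by move=> i; apply: s.
- by move=> i j ij; rewrite c2 // h // (inj_eq injf).
- by exists ord0, ord_max; rewrite c2.
- by move=> J /andP[].
Qed.

(** In the dual line, [x0] and [x1] are parallel, [x3] and [x4] are parallel, and [x2] is the shared
    point of the two triangles, alone in its class. *)
Lemma Y3_corank2 x0 x1 x2 x3 x4 :
  uniq [:: x0; x1; x2; x3; x4] -> {subset [:: x0; x1; x2; x3; x4] <= W} ->
  ~~ indep M (W :\ x0 :\ x1) -> ~~ indep M (W :\ x3 :\ x4) ->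
  {in [:: x0; x1; x3; x4], forall x, indep M (W :\ x2 :\ x)} ->
  {in [:: x0; x1] & [:: x3; x4], forall x y, indep M (W :\ x :\ y)} ->
  has_minor M Y3.
Proof.
move=> u s d01 d34 i2 i01; have fs i : fun5 x0 x1 x2 x3 x4 i \in [:: x0; x1; x2; x3; x4].
  exact: mem_nth.
have sw x y : W :\ x :\ y = W :\ y :\ x by apply/setP => z; rewrite !inE andbCA.
have i2' : {in [:: x0; x1; x3; x4], forall x, indep M (W :\ x :\ x2)}.
  by move=> x xI; rewrite sw i2.
have i34 : {in [:: x0; x1] & [:: x3; x4], forall x y, indep M (W :\ y :\ x)}.
  by move=> x y xI yI; rewrite sw i01.
have injf := fun5_inj u.
have cY (i j : 'I_5) : i != j ->
    indep Y3 (~: [set i; j]) = ~~ ((2 < i) && (2 < j)) && ~~ ((i < 2) && (j < 2)).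
  move=> ij; rewrite Y3_indepE.
  have -> : #|~: [set i; j]| <= 3.
    by have := cardsC [set i; j]; rewrite card_ord cards2 ij => -[]; rewrite add0n => ->.
  have sub (A : {set 'I_5}) : (A \subset ~: [set i; j]) = (i \notin A) && (j \notin A).
    by rewrite subsetC subUset !sub1set !inE.
  by rewrite !sub !inE -!ltnNge.
apply: (@config_has_minor _ _ _ _ _ _ (fun5 x0 x1 x2 x3 x4)) => //; first exact: Y3_ground.
apply: config_corank2 => //.
- by move=> i; apply: s.
- move=> i j ij; rewrite cY //.
  case: i j ij => [[|[|[|[|[|i]]]]] li] [[|[|[|[|[|j]]]]] lj] //= _; rewrite /fun5 /=;
    by [rewrite (negbTE d01) | rewrite (negbTE d34) | rewrite sw (negbTE d01)
      | rewrite sw (negbTE d34) | rewrite i2 ?inE ?eqxx ?orbT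
      | rewrite i2' ?inE ?eqxx ?orbT | rewrite i01 ?inE ?eqxx ?orbT
      | rewrite i34 ?inE ?eqxx ?orbT].
- by exists ord0, ord_max; rewrite cY.
- by move=> J; rewrite Y3_indepE => /andP[].
Qed.
End CorankTwo.

(** * Circuits whose union has corank two *)

Section Theta.
Variables (T : finType) (M : matroid T) (C Z : {set T}).
Hypotheses (cC : C \in circuits M) (ZM : Z \subset ground M) (dCZ : [disjoint C & Z])
  (iZ : indep M Z) (z0 : T) (z0Z : z0 \in Z)
  (rW : (rank M (C :|: Z)).+2 <= #|C| + #|Z|)
  (iCZ : {in C & Z, forall x z, indep M ((C :\ x) :|: (Z :\ z))}).

Let W := C :|: Z.
(* Being parallel in the dual of the restriction to [W]. *)
Definition codep x y := ~~ indep M (W :\ x :\ y).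

Let WM : W \subset ground M.
Proof. by rewrite subUset ZM circuit_ground. Qed.

Let cardW : #|W| = #|C| + #|Z|.
Proof. by rewrite cardsU disjoint_setI0 // cards0 subn0. Qed.

Let nCZ x : x \in C -> x \notin Z.
Proof. by move=> xC; rewrite (disjointFr dCZ xC). Qed.

Let depW : {in W, forall w, ~~ indep M (W :\ w)}.
Proof.
move=> w wW; rewrite indep_rank; have := rankS M (subD1set W w); move: rW.
rewrite -/W -cardW (cardsD1 w W) wW; lia.
Qed.

Lemma codep_refl x : x \in C -> codep x x.
Proof.
move=> xC; rewrite /codep (_ : W :\ x :\ x = W :\ x) ?depW // ?inE ?xC //.
by apply/setP => y; rewrite !inE andbA andbb.
Qed.

Lemma codep_sym x y : codep x y = codep y x.
Proof.
rewrite /codep; congr (~~ indep M _).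
by apply/setP => z; rewrite !inE andbCA.
Qed.

(** Removing [y] leaves nullity at most one, since deleting the further point [z0] already gives an
    independent set. This makes [dep_cap] applicable inside [W :\ y]. *)
Let nullity y (V : {set T}) : y \in C -> V \subset W :\ y -> #|V| <= (rank M V).+1.
Proof.
move=> yC sV; have := rankUl_le M ((W :\ y) :\: V) V.
have -> : (W :\ y) :\: V :|: V = W :\ y by rewrite setUC setDE setUIr setUCr setIT (setUidPr sV).
rewrite cardsDS //; have := subset_leq_card sV.
have : #|C :\ y :|: Z :\ z0| = #|C| + #|Z| - 2.
  rewrite cardsU disjoint_setI0; last first.
    by apply: disjointWl (subD1set _ _) _; apply: disjointWr (subD1set _ _) _.
  by rewrite cards0 subn0 (cardsD1 y C) (cardsD1 z0 Z) yC z0Z; lia.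
have : #|W :\ y| = #|C| + #|Z| - 1.
  have yW : y \in W by rewrite inE yC.
  by have := cardsD1 y W; rewrite yW cardW; lia.
have : #|C :\ y :|: Z :\ z0| <= rank M (W :\ y).
  apply: rank_ge (iCZ yC z0Z); apply/subsetP => v; rewrite !inE => /orP[/andP[-> ->]//|/andP[_ vZ]].
  by rewrite vZ orbT andbT; apply: contraTneq vZ => ->; apply: nCZ.
have : 0 < #|C| by apply/card_gt0P; exists y.
have : 0 < #|Z| by apply/card_gt0P; exists z0.
lia.
Qed.

(** The two dependent sets omit [y], so their union has nullity at most one. By [dep_cap] their
    intersection is dependent, and it avoids [x] and [z]. *)
Lemma codep_trans y x z : x \in C -> y \in C -> z \in C ->
  codep x y -> codep y z -> codep x z.
Proof.
move=> xC yC zC xy yz.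
have : ~~ indep M ((W :\ x :\ y) :&: (W :\ y :\ z)).
  apply: dep_cap xy yz _; apply: (nullity yC).
  apply/subsetP => v; rewrite !inE.
  by case: (v == x); case: (v == y); case: (v == z); rewrite //= ?orbF ?orbb.
apply: contra; apply: indepS; apply/subsetP => v; rewrite !inE.
by case/andP=> /and3P[_ -> ->] /andP[->].
Qed.

(** A circuit that avoids [x] avoids the whole series class of [x]: at a point [y] of that class
    [dep_cap] would cut the circuit down to a dependent proper subset. *)
Lemma codep_class x : x \in C ->
  ~~ indep M (Z :|: [set y in C | ~~ codep x y]).
Proof.
move=> xC.
have [|D cD sD] := @dependent_circuit _ M (W :\ x).
  by rewrite /dependent depW ?inE ?xC // (subset_trans (subD1set _ _)).
have /circuitP[_ dD _] := cD; apply: contra dD => h; apply: indepS h.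
apply/subsetP => y yD; move: (subsetP sD y yD); rewrite !inE => /andP[yx].
case/orP=> [yC|->//]; rewrite yC /=; apply/orP; right; apply/negP => xy.
have : ~~ indep M (D :&: (W :\ x :\ y)).
  have /circuitP[_ dD _] := cD.
  apply: dep_cap dD xy _; apply: (nullity xC).
  by rewrite subUset sD subD1set.
move/negP; apply; apply: (circuit_proper cD); rewrite properE subsetIl /=.
by apply/subsetPn; exists y; rewrite // !inE eqxx /= andbF.
Qed.

Lemma codep_ex x : x \in C -> exists2 y, y \in C & ~~ codep x y.
Proof.
move=> xC; apply/exists_inP; apply: contraR (codep_class xC).
move=> /exists_inPn h; suff -> : [set y in C | ~~ codep x y] = set0 by rewrite setU0.
by apply/setP => y; rewrite !inE; apply/negbTE; apply/negP => /andP[/h /negP].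
Qed.

Lemma indep_CZ x z : x \in C -> z \in Z -> indep M (W :\ x :\ z).
Proof.
move=> xC zZ; apply: indepS (iCZ xC zZ); apply/subsetP => v; rewrite !inE.
by case: (v == x) => //=; rewrite ?andbF //; case: (v == z).
Qed.

Let indep_ZC x z : x \in C -> z \in Z -> indep M (W :\ z :\ x).
Proof.
by move=> xC zZ; have := codep_sym x z; rewrite /codep indep_CZ // => /esym/negbFE.
Qed.

Let neCZ x z : x \in C -> z \in Z -> x != z.
Proof. by move=> xC; apply: contraTneq => <-; apply: nCZ. Qed.

(** By [iCZ] a point of [Z] is in series with no point of [C], so [z0] supplies the fifth class. *)
Lemma codep_uniform x1 x2 x3 x4 : uniq [:: x1; x2; x3; x4] ->
  {subset [:: x1; x2; x3; x4] <= C} ->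
  {in [:: x1; x2; x3; x4] &, forall x y, x != y -> ~~ codep x y} ->
  has_minor M (uniform 3 5).
Proof.
move=> u s h; apply: (@U35_corank2 _ _ W WM depW z0 x1 x2 x3 x4).
- rewrite cons_uniq u andbT; apply: contraTN z0Z => /s; exact: nCZ.
- by move=> x; rewrite !in_cons inE => /orP[/eqP->|/s ->//]; rewrite z0Z orbT.
move=> x y; rewrite in_cons => /orP[/eqP->|xs]; rewrite in_cons => /orP[/eqP->|ys].
- by rewrite eqxx.
- by rewrite indep_ZC // s.
- by rewrite indep_CZ // s.
by move/(h x y xs ys)/negPn.
Qed.

(** Two classes with two points each; [z0] is the point alone in its class. *)
Lemma codep_Y3 x x' y y' : x \in C -> x' \in C -> y \in C -> y' \in C ->
  x != x' -> y != y' -> codep x x' -> codep y y' -> ~~ codep x y -> has_minor M Y3.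
Proof.
move=> xC x'C yC y'C xx' yy' dx dy nxy.
have nx'y : ~~ codep x' y by apply: contra nxy; apply: codep_trans.
have nxy' : ~~ codep x y'.
  by apply: contra nxy => h; apply: (codep_trans (y := y')) => //; rewrite codep_sym.
have nx'y' : ~~ codep x' y'.
  by apply: contra nx'y => h; apply: (codep_trans (y := y')) => //; rewrite codep_sym.
have ne a b : ~~ codep a b -> a \in C -> a != b.
  by move=> n aC; apply: contraNneq n => <-; apply: codep_refl.
apply: (@Y3_corank2 _ _ W WM depW x x' z0 y y') => //.
- rewrite /= !inE !negb_or xx' yy' (eq_sym z0 y) (eq_sym z0 y').
  by rewrite (neCZ xC z0Z) (neCZ x'C z0Z) (neCZ yC z0Z) (neCZ y'C z0Z) (ne x y) ?(ne x y') ?(ne x' y) ?(ne x' y').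
- by move=> a; rewrite !inE => /or4P[| | |/orP[]] /eqP->; rewrite ?z0Z ?orbT ?xC ?x'C ?yC ?y'C.
- by move=> a; rewrite !inE => /or4P[] /eqP->; apply: indep_ZC.
by move=> a b; rewrite !inE => /orP[] /eqP-> /orP[] /eqP->; apply/negPn.
Qed.

(** Here [z] and [z'] form the second pair, because removing both leaves all of [C]; the single
    point comes from another class of [C]. *)
Lemma codep_Y3_long x x' z z' : x \in C -> x' \in C -> z \in Z -> z' \in Z ->
  x != x' -> z != z' -> codep x x' -> has_minor M Y3.
Proof.
move=> xC x'C zZ z'Z xx' zz' dx; have [y yC nxy] := codep_ex xC.
have nx'y : ~~ codep x' y by apply: contra nxy; apply: codep_trans.
have ne a b : ~~ codep a b -> a \in C -> a != b.
  by move=> n aC; apply: contraNneq n => <-; apply: codep_refl.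
apply: (@Y3_corank2 _ _ W WM depW x x' y z z') => //.
- by rewrite /= !inE !negb_or xx' zz' (neCZ xC zZ) (neCZ xC z'Z)
    (neCZ x'C zZ) (neCZ x'C z'Z) (neCZ yC zZ) (neCZ yC z'Z) (ne x y) ?(ne x' y).
- by move=> a; rewrite !inE => /or4P[| | |/orP[]] /eqP->; rewrite ?zZ ?z'Z ?orbT ?xC ?x'C ?yC.
- case/circuitP: cC => _ d _; apply: contra d; apply: indepS; apply/subsetP => v vC.
  by rewrite !inE (neCZ vC zZ) (neCZ vC z'Z) vC.
- move=> a; rewrite !inE => /or4P[] /eqP->; try exact: indep_CZ.
    by have := codep_sym x y; rewrite (negbTE nxy) => /esym/negbFE.
  by have := codep_sym x' y; rewrite (negbTE nx'y) => /esym/negbFE.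
by move=> a b; rewrite !inE => /orP[] /eqP-> /orP[] /eqP->; apply: indep_CZ.
Qed.
End Theta.

(** * Connected simple matroids without the excluded minors *)

(** After contracting [C] the five points are pairwise nonparallel in rank two. *)
Lemma U25_of_line (T : finType) (M : matroid T) (C : {set T}) (s : 5.-tuple T) :
  uniq s -> {in s, forall x, x \notin C} -> {subset s <= ground M} ->
  {in s &, forall x y, x != y -> indep M (C :|: [set x; y])} ->
  rank M (C :|: [set x in s]) <= #|C| + 2 -> has_minor M (uniform 2 5).
Proof.
move=> us sC sM h2 r2; have injf : injective (tnth s) by exact/tuple_uniqP.
have fs i : tnth s i \in s by apply: mem_tnth.
apply: (@config_has_minor _ _ M _ _ C (tnth s)) => //.
apply: (config_of_bases (r := 2)) => //.
- by move=> i; apply: sC.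
- by move=> i; apply: sM.
- move=> J J2; rewrite /= /uniform_indep /= subsetT J2 /=; apply/esym.
  have /cards2P[i [j [ij ->]]] : #|J| == 2 by rewrite J2.
  by rewrite imsetU1 imset_set1 h2 // (inj_eq injf).
- exists [set ord0; ord_max]; rewrite ?cards2 //.
  by rewrite /= /uniform_indep /= subsetT cards2.
- by move=> J /andP[].
move=> J iJ; rewrite -(leq_add2l #|C|); apply: leq_trans r2.
have -> : #|C| + #|J| = #|C :|: tnth s @: J|.
  rewrite cardsU (card_imset _ injf) disjoint_setI0 ?cards0 ?subn0 //.
  rewrite disjoint_sym disjoint_subset; apply/subsetP => _ /imsetP[i _ ->].
  by rewrite inE sC.
apply: rank_ge iJ; apply: setUS; apply/subsetP => _ /imsetP[i _ ->].
by rewrite inE fs.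
Qed.

Definition has_shape (T : finType) (M : matroid T) (S : {set T}) (P : {set {set T}}) :=
  [/\ trivIset P, {in P, forall B : {set T}, #|B| = 3}, [disjoint S & cover P],
      ground M = S :|: cover P
    & forall I : {set T}, I \subset ground M -> indep M I =
        [forall B in P, #|I :&: B| <= 2] && (#|I| < #|S| + 2 * #|P|)].

Lemma card_cover (T : finType) (P : {set {set T}}) (K : {set T}) :
  trivIset P -> #|K :&: cover P| = \sum_(B in P) #|K :&: B|.
Proof.
move=> tP; have F (Y : {set T}) : #|K :&: Y| = \sum_(x in Y) (x \in K).
  rewrite -sum1_card big_mkcond [RHS]big_mkcond; apply: eq_bigr => x _.
  by rewrite inE; case: (x \in K); case: (x \in Y).
by rewrite F big_trivIset //; apply: eq_bigr => B _; rewrite F.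
Qed.

Section Structure.
Variables (T : finType) (M : matroid T) (X : {set T}).
Hypotheses (XM : X \subset ground M)
  (no25 : ~ has_minor M (uniform 2 5)) (no35 : ~ has_minor M (uniform 3 5))
  (noY3 : ~ has_minor M Y3)
  (simpX : {in X &, forall x y, indep M [set x; y]})
  (connX : {in X &, forall x y, x != y ->
     exists2 C, C \in circuits M & [/\ x \in C, y \in C & C \subset X]}).

Lemma spanning_circuit : 1 < rank M X ->
  exists C, [/\ C \in circuits M, C \subset X & {in X, forall x, spans M C x}].
Proof.
move=> rX; have [C0 cC0 sC0] : exists2 C, C \in circuits M & C \subset X.
  have /card_gt1P[x [y [xX yX xy]]] := leq_trans rX (rank_card M X).
  by have [C cC [_ _ sC]] := connX xX yX xy; exists C.
case: (@arg_maxnP _ C0 (fun C => (C \in circuits M) && (C \subset X)) (fun C => #|C|)).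
  by rewrite cC0.
move=> C /andP[cC sC] maxC; exists C; split=> // x xX; apply: contraT => nx.
have [c cCc] := circuit_neq0 cC.
have cx : c != x by apply: contraNneq nx => <-; apply: spans_mem.
(* The circuit [D] meets [C] and also leaves its closure. Its part [Z0] outside the closure is
   independent, having lost [c], and is not skew to [C]. *)
have [D cD [cD' xD sD]] := connX (subsetP sC c cCc) xX cx.
(* The last condition says that [Z] is dependent once [C] is contracted. Its points are not loops
   there, so a minimal [Z] is a circuit of the contraction with at least two points. *)
pose P (Z : {set T}) := [&& Z \subset X, indep M Z, [forall z in Z, ~~ spans M C z]
  & rank M (C :|: Z) < rank M C + #|Z|].
pose Z0 := [set z in D | ~~ spans M C z].
have sZ0 : Z0 \subset D by apply/subsetP => z; rewrite inE => /andP[].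
have PZ0 : P Z0.
  rewrite /P (subset_trans sZ0 sD) /=; apply/and3P; split.
  - apply: circuit_proper cD _; rewrite properE sZ0; apply/subsetPn; exists c => //.
    by rewrite inE negb_and negbK spans_mem ?orbT.
  - by apply/forall_inP => z; rewrite inE => /andP[].
  have iD0 : indep M (D :\: Z0).
    apply: circuit_proper cD _; rewrite properE subsetDl; apply/subsetPn; exists x => //.
    by rewrite !inE nx xD.
  have h1 : rank M (C :|: (D :\: Z0)) = rank M C.
    apply: rank_span => y; rewrite !inE; by case: (y \in D); rewrite ?andbF // andbT negbK.
  have := rank_submod M (C :|: (D :\: Z0)) D; rewrite h1.
  have : rank M (C :|: Z0) <= rank M (C :|: D :\: Z0 :|: D).
    by apply: rankS; rewrite -setUA setUS // (subset_trans sZ0) ?subsetUr.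
  have : rank M (D :\: Z0) <= rank M ((C :|: D :\: Z0) :&: D).
    by apply: rankS; rewrite subsetI subsetUr subsetDl.
  have := circuit_rank cD; move: iD0; rewrite indep_rank cardsDS // => /eqP->.
  have := subset_leq_card sZ0; clear; lia.
have [Z mZ _] := minset_exists PZ0; case/minsetP: mZ => PZ minZ.
have /and4P[sZ iZ /forall_inP nZ rZ] := PZ.
have rZz z : z \in Z -> rank M C + #|Z :\ z| <= rank M (C :|: Z :\ z).
  move=> zZ; rewrite leqNgt; apply/negP => lt.
  suff e : Z :\ z = Z by move: zZ; rewrite -e !inE eqxx.
  apply: minZ (subD1set _ _); rewrite /P lt (subset_trans (subD1set _ _)) //=.
  rewrite (indepS (subD1set _ _) iZ) /= andbT.
  by apply/forall_inP => y /setD1P[_]; apply: nZ.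
have [z0 z0Z] : exists z0, z0 \in Z.
  by apply/set0Pn; apply: contraTneq rZ => ->; rewrite cards0 setU0 addn0 ltnn.
have [z1 z1Z z01] : exists2 z1, z1 \in Z & z0 != z1.
  apply/exists_inP; apply: contraT => /exists_inPn h; have := nZ z0 z0Z.
  move/negbTE/spansNE; have e : Z = [set z0].
    apply/setP => z; rewrite !inE; apply/idP/eqP => [/h/negPn/eqP//|->//].
  by move: rZ; rewrite e setUC cards1 addn1 => + ee; rewrite ee ltnn.
have cC1 := circuit_rank cC.
have dCZ : [disjoint C & Z].
  rewrite disjoint_subset; apply/subsetP => y yC; rewrite inE; apply/negP => /nZ.
  by rewrite spans_mem.
have rW : (rank M (C :|: Z)).+2 <= #|C| + #|Z| by move: rZ cC1; clear; lia.
have iCZ : {in C & Z, forall x z, indep M ((C :\ x) :|: (Z :\ z))}.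
  move=> y z yC zZ; rewrite indep_rank eqn_leq rank_card /=.
  have := rZz z zZ; have e : rank M (C :|: Z :\ z) = rank M (C :\ y :|: Z :\ z).
    rewrite -{1}(setD1K yC) -setUA; apply/eqP.
    exact: spansS (subsetUl _ _) (circuit_spans cC yC).
  have := (leq_card_setU (C :\ y) (Z :\ z)).1; rewrite -e.
  by move: cC1; rewrite (cardsD1 y C) yC; clear; lia.
have ZM := subset_trans sZ XM.
have ncod y : y \in C -> c != y -> ~~ codep M C Z c y.
  by move=> yC cy; apply/negP => cod; apply: noY3; apply: (@codep_Y3_long _ _ C Z _ _ _ _ z0 _ _ _ c y z0 z1).
(* Since [c] is in series with no other point of the union, removing it leaves a circuit. Its size
   is [|C| + |Z| - 1], more than [|C|] because [Z] has two points. *)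
have cWc : (C :|: Z) :\ c \in circuits M.
  have cW : c \in C :|: Z by rewrite inE cCc.
  apply/circuitP; split.
  - rewrite (subset_trans (subD1set _ _)) // subUset ZM circuit_ground //.
  - rewrite indep_rank; have := rankS M (subD1set (C :|: Z) c); move: rW.
    have : #|C :|: Z| = #|C| + #|Z| by rewrite cardsU disjoint_setI0 // cards0 subn0.
    rewrite (cardsD1 c) cW; clear; lia.
  move=> v; rewrite !inE => /andP[vc /orP[vC|vZ]].
    by have := ncod v vC; rewrite eq_sym vc => /(_ isT)/negPn.
  exact: indep_CZ.
have := maxC _ (introT andP (conj cWc _)).
rewrite (subset_trans (subD1set _ _)) ?subUset ?sC // => /(_ isT).
have : #|C :|: Z| = #|C| + #|Z| by rewrite cardsU disjoint_setI0 // cards0 subn0.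
have : 1 < #|Z| by apply/card_gt1P; exists z0, z1.
rewrite (cardsD1 c (C :|: Z)) inE cCc /=; clear; lia.
Qed.

(** * Triangles on a long circuit *)

Section Triangle.
Variables (C : {set T}) (e : T).
Hypotheses (cC : C \in circuits M) (sC : C \subset X) (C4 : 3 < #|C|)
  (eX : e \in X) (eC : e \notin C) (Ce : spans M C e).

Let dCe : [disjoint C & [set e]].
Proof. by rewrite disjoint_sym disjoints1. Qed.

Let ie : indep M [set e].
Proof. by have := simpX eX eX; rewrite setUid. Qed.

Let eM : [set e] \subset ground M.
Proof. by rewrite sub1set (subsetP XM). Qed.

Let rCe : (rank M (C :|: [set e])).+2 <= #|C| + #|[set e]|.
Proof. by have := circuit_rank cC; rewrite setUC (eqP Ce) cards1; clear; lia. Qed.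

Let iCe : {in C & [set e], forall x z, indep M ((C :\ x) :|: ([set e] :\ z))}.
Proof.
move=> x z xC /set1P ->; rewrite setDv setU0.
by case/circuitP: cC => _ _; apply.
Qed.

(** Take [Z] to be [e]. Without [U_{3,5}] some two points of [C] are in series; without [Y_3] every
    other class in [C] is a singleton, and by [U_{3,5}] again there are at most two of those.
    [codep_class] makes them dependent together with [e], and simplicity then forces exactly two:
    the triangle. *)
Lemma triangle_ex :
  exists a b, [/\ a \in C, b \in C, a != b & ~~ indep M (e |: [set a; b])].
Proof.
have /exists_inP[x xC /exists_inP[x' x'C /andP[xx' cxx']]] :
    [exists x in C, exists x' in C, (x != x') && codep M C [set e] x x'].
  apply: contraT => /exists_inPn h; exfalso; apply: no35.
  pose s := take 4 (enum C).
  have us : uniq s by rewrite take_uniq // enum_uniq.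
  have szs : size s = 4 by rewrite size_takel // -cardE.
  have sC' : {subset s <= C} by move=> y /mem_take; rewrite mem_enum.
  have hs : {in s &, forall x y, x != y -> ~~ codep M C [set e] x y}.
    move=> x y /sC' xC /sC' yC xy; apply/negP => cod.
    by have /exists_inPn/(_ y yC) := h x xC; rewrite xy cod.
  case: s us szs sC' hs => [|x1 [|x2 [|x3 [|x4 [|]]]]] // us _ sC' hs.
  exact: (codep_uniform cC eM dCe ie (set11 e) rCe iCe us sC' hs).
pose U := [set y in C | ~~ codep M C [set e] x y].
have dU : ~~ indep M (e |: U).
  exact: (codep_class cC eM dCe ie (set11 e) rCe iCe xC).
have nU y y' : y \in U -> y' \in U -> y != y' -> ~~ codep M C [set e] y y'.
  rewrite !inE => /andP[yC nxy] /andP[y'C _] yy'; apply/negP => cyy'; apply: noY3.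
  exact: (codep_Y3 cC eM dCe ie (set11 e) rCe iCe xC x'C yC y'C xx' yy' cxx' cyy' nxy).
have U2 : #|U| <= 2.
  rewrite leqNgt; apply/negP => U3; apply: no35.
  have [s [us szs sU]] : exists s : seq T, [/\ uniq s, size s = 3 & {subset s <= U}].
    exists (take 3 (enum U)); split; first by rewrite take_uniq // enum_uniq.
      by rewrite size_takel // -cardE.
    by move=> y /mem_take; rewrite mem_enum.
  case: s us szs sU => [|y1 [|y2 [|y3 []]]] // us _ sU.
  have nx y : y \in U -> ~~ codep M C [set e] x y by rewrite inE => /andP[].
  have nxU y : y \in U -> x != y.
    move=> /nx; apply: contraNneq => <-.
    exact: (codep_refl cC eM dCe ie (set11 e) rCe xC).
  apply: (codep_uniform cC eM dCe ie (set11 e) rCe iCe (x1 := x) (x2 := y1) (x3 := y2) (x4 := y3)).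
  - by rewrite cons_uniq us andbT; apply/negP => /sU /nxU; rewrite eqxx.
  - by move=> y; rewrite in_cons => /predU1P[->//|/sU]; rewrite inE => /andP[].
  move=> y y'; rewrite in_cons => /predU1P[->|ys]; rewrite in_cons => /predU1P[->|ys'].
  - by rewrite eqxx.
  - by move=> _; apply: nx; apply: sU.
  - by move=> _; rewrite codep_sym; apply: nx; apply: sU.
  by apply: nU; apply: sU.
have sUC : U \subset C by apply/subsetP => y; rewrite inE => /andP[].
have eU : e \notin U by apply: contra eC => /(subsetP sUC).
have UX : {subset U <= X} by move=> y /(subsetP sUC) /(subsetP sC).
have [U1|U1] := leqP #|U| 1.
  case/negP: dU; have [->|[a aU]] := set_0Vmem U; first by rewrite setU0.
  have -> : U = [set a].
    apply/eqP; rewrite eq_sym eqEcard sub1set aU cards1; exact: U1.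
  by apply: simpX => //; apply: UX.
have /cards2P[a [b [ab eUab]]] : #|U| == 2 by rewrite eqn_leq U2.
exists a, b; rewrite -eUab; split=> //; apply: (subsetP sUC); rewrite eUab !inE eqxx ?orbT //.
Qed.

Variables (a b : T).
Hypotheses (aC : a \in C) (bC : b \in C) (ab : a != b)
  (dabe : ~~ indep M (e |: [set a; b])).

Let ea : a != e. Proof. by apply: contraNneq eC => <-. Qed.
Let eb : b != e. Proof. by apply: contraNneq eC => <-. Qed.
Let aX : a \in X. Proof. exact: (subsetP sC). Qed.
Let bX : b \in X. Proof. exact: (subsetP sC). Qed.

Let rabe : rank M (e |: [set a; b]) = 2.
Proof.
have := rank_card M (e |: [set a; b]); have := rankS M (subsetUr [set e] [set a; b]).
have := simpX aX bX; move: dabe; rewrite !indep_rank cardsU1 cards2 ab !inE.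
rewrite (eq_sym e a) (eq_sym e b) (negbTE ea) (negbTE eb) /=; clear; lia.
Qed.

Lemma triangle_spans x y : x \in e |: [set a; b] -> y \in e |: [set a; b] -> x != y ->
  {in e |: [set a; b], forall z, spans M [set x; y] z}.
Proof.
move=> xB yB xy z zB.
have BX : {subset e |: [set a; b] <= X} by move=> v; rewrite !inE => /or3P[] /eqP->.
have := simpX (BX x xB) (BX y yB); rewrite indep_rank cards2 xy => /eqP rxy.
rewrite /spans eqn_leq rxy -[1.+1]rxy (rankS _ (subsetUr _ _)) andbT rxy -rabe.
by apply: rankS; rewrite !subUset !sub1set xB yB zB.
Qed.

(** The kept points [e] and [a] span [b]. The set therefore spans [C :\ v], which is independent of
    the same size. *)
Lemma triangle_out v : v \in C -> v != a -> v != b -> indep M (e |: (C :\ b :\ v)).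
Proof.
move=> vC va vb; rewrite indep_rank eqn_leq rank_card /=.
set V := e |: _.
have sb : spans M V b.
  apply: (@spansS _ _ [set e; a]).
    by rewrite /V setUS // sub1set !inE ab aC (eq_sym a v) va.
  by apply: triangle_spans; rewrite ?inE ?eqxx ?orbT // eq_sym.
have -> : #|V| = #|C :\ v|.
  rewrite /V cardsU1 !inE (negbTE eC) !andbF /= (cardsD1 b (C :\ v)) !inE bC eq_sym vb.
  by congr (_ + #|pred_of_set _|); apply/setP => y; rewrite !inE andbCA.
case/circuitP: cC => _ _ /(_ v vC); rewrite indep_rank => /eqP <-.
rewrite -(eqP sb); apply: rankS; apply/subsetP => y; rewrite /V !inE => /andP[-> ->].
by case: (y == b); rewrite //= orbT.
Qed.
End Triangle.

Section Exchange.
Variables (C : {set T}) (e : T).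
Hypotheses (cC : C \in circuits M) (sC : C \subset X) (C4 : 3 < #|C|)
  (eX : e \in X) (eC : e \notin C) (Ce : spans M C e).

(** The delicate case is the removal of both [a] and [b]. Were they in series, two further points
    [y], [y'] of [C] would form a second series pair, because their complement contains the
    triangle, and [codep_Y3] would apply. The bound [3 < #|C|] provides [y] and [y']. *)
Lemma exchange a b : a \in C -> b \in C -> a != b -> ~~ indep M (e |: [set a; b]) ->
  e |: (C :\ b) \in circuits M.
Proof.
move=> aC bC ab dabe.
have dbae : ~~ indep M (e |: [set b; a]) by rewrite [[set b; a]]setUC.
have ba : b != a by rewrite eq_sym.
have outb v : v \in C -> v != a -> v != b -> indep M (e |: (C :\ b :\ v)).
  exact: triangle_out.
have outa v : v \in C -> v != a -> v != b -> indep M (e |: (C :\ a :\ v)).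
  by move=> vC va vb; exact: (triangle_out cC sC eX eC bC aC ba dbae vC vb va).
have dCe : [disjoint C & [set e]] by rewrite disjoint_sym disjoints1.
have ie : indep M [set e] by have := simpX eX eX; rewrite setUid.
have eM : [set e] \subset ground M by rewrite sub1set (subsetP XM).
have rCe : (rank M (C :|: [set e])).+2 <= #|C| + #|[set e]|.
  by have := circuit_rank cC; rewrite setUC (eqP Ce) cards1; clear; lia.
have iCe : {in C & [set e], forall x z, indep M ((C :\ x) :|: ([set e] :\ z))}.
  move=> x z xC /set1P ->; rewrite setDv setU0.
  by case/circuitP: cC => _ _; apply.
have iab : indep M (e |: (C :\ b :\ a)).
  have [y [y' [yC y'C yy' [ya yb y'a y'b]]]] :
     exists y y', [/\ y \in C, y' \in C, y != y' & [/\ y != a, y != b, y' != a & y' != b]].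
    have /card_gt1P[y [y' [+ + yy']]] : 1 < #|C :\ a :\ b|.
      by move: C4; rewrite (cardsD1 a C) (cardsD1 b (C :\ a)) !inE aC bC ba; clear; lia.
    by rewrite !inE => /and3P[yb ya yC] /and3P[y'b y'a y'C]; exists y, y'.
  have eW u v : (C :|: [set e]) :\ u :\ v = (e |: C) :\ u :\ v by rewrite setUC.
  have eWC u v : u \in C -> v \in C -> e |: (C :\ u :\ v) = (C :|: [set e]) :\ u :\ v.
    move=> uC vC; apply/setP => w; rewrite !inE; case: (eqVneq w e) => [->|_]; rewrite ?orbF //=.
    by rewrite orbT andbT; apply/esym/andP; split; apply: contraNneq eC => ->.
  rewrite eWC //; apply: contraT => cod; exfalso; apply: noY3.
  apply: (codep_Y3 cC eM dCe ie (set11 e) rCe iCe bC aC yC y'C ba yy' cod) => //.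
    rewrite /codep -eWC //; apply: contra dabe; apply: indepS.
    by rewrite setUS // subUset !sub1set !inE aC bC ![_ == y]eq_sym ![_ == y']eq_sym ya yb y'a y'b.
  by rewrite /codep negbK -eWC // outb.
have Cb : #|C :\ b| = rank M C.
  by have := circuit_rank cC; rewrite (cardsD1 b C) bC; clear; lia.
apply/circuitP; split.
- by rewrite subUset eM (subset_trans (subD1set _ _)) ?circuit_ground.
- rewrite indep_rank cardsU1 !inE (negbTE eC) andbF /= Cb.
  have : rank M (e |: C :\ b) <= rank M C by rewrite -(eqP Ce) rankS // setUS // subD1set.
  by clear; lia.
move=> v; rewrite !inE => /orP[/eqP->|/andP[vb vC]].
  rewrite setU1K ?inE ?(negbTE eC) ?andbF //; by case/circuitP: cC => _ _; apply.
have ve : v != e by apply: contraNneq eC => <-.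
have -> : (e |: C :\ b) :\ v = e |: (C :\ b :\ v).
  by apply/setP => w; rewrite !inE; case: (eqVneq w e) => [->|_]; rewrite //= eq_sym ve.
have [->//|va] := eqVneq v a; exact: outb.
Qed.
End Exchange.

(** * Two triangles on the same circuit are disjoint *)

Section TwoTriangles.
Variables (C : {set T}) (e f : T).
Hypotheses (cC : C \in circuits M) (sC : C \subset X) (C4 : 3 < #|C|)
  (eX : e \in X) (eC : e \notin C) (Ce : spans M C e)
  (fX : f \in X) (fC : f \notin C) (Cf : spans M C f) (ef : e != f).

(** Contract all of [C] except [a], [b] and one more point [c]: rank two remains, and [a], [b], [c],
    [e], [f] are pairwise nonparallel. *)
Lemma triangles_same a b : a \in C -> b \in C -> a != b ->
  ~~ indep M (e |: [set a; b]) -> ~~ indep M (f |: [set a; b]) -> False.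
Proof.
move=> aC bC ab de df; apply: no25.
have ba : b != a by rewrite eq_sym.
have swap : [set b; a] = [set a; b] by rewrite setUC.
have de' : ~~ indep M (e |: [set b; a]) by rewrite swap.
have df' : ~~ indep M (f |: [set b; a]) by rewrite swap.
have [c cIC [ca cb]] : exists2 c, c \in C & [/\ c != a & c != b].
  have /card_gt0P[c] : 0 < #|C :\ a :\ b|.
    by move: C4; rewrite (cardsD1 a C) (cardsD1 b (C :\ a)) !inE aC bC ba; clear; lia.
  by rewrite !inE => /and3P[? ? ?]; exists c.
have nC x y : x \notin C -> y \in C -> y != x by move=> xC; apply: contraTneq => ->.
have [ae be ce] := And3 (nC e a eC aC) (nC e b eC bC) (nC e c eC cIC).
have [af bf cf] := And3 (nC f a fC aC) (nC f b fC bC) (nC f c fC cIC).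
pose D := C :\ a :\ b :\ c.
have sDV (V : {set T}) : (forall x, x \in C -> x != a -> x != b -> x != c -> x \in V) ->
    D \subset V.
  by move=> h; apply/subsetP => x; rewrite !inE => /and4P[? ? ? ?]; apply: h.
have eD x : x \in C -> indep M (C :\ x) by case/circuitP: cC => _ _; apply.
(* The pairs with [a] and [b] lie in sets known to be independent from [triangle_out] with [c]
   removed; the pair with [c] lies properly in the circuit obtained by exchanging [b] for [g]. *)
have key g : g \in X -> g \notin C -> spans M C g -> ~~ indep M (g |: [set a; b]) ->
    [/\ indep M (D :|: [set a; g]), indep M (D :|: [set b; g]) & indep M (D :|: [set c; g])].
  move=> gX gC Cg dg.
  have dg' : ~~ indep M (g |: [set b; a]) by rewrite swap.
  have [ag bg cg] := And3 (nC g a gC aC) (nC g b gC bC) (nC g c gC cIC).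
  split.
  - apply: indepS (triangle_out cC sC gX gC aC bC ab dg cIC ca cb).
    rewrite !subUset !sub1set !inE ab (eq_sym a c) ca aC eqxx orbT andbT.
    by apply: sDV => x xC xa xb xc; rewrite !inE ?xa ?xb ?xc xC ?orbT.
  - apply: indepS (triangle_out cC sC gX gC bC aC ba dg' cIC cb ca).
    rewrite !subUset !sub1set !inE ba (eq_sym b c) cb bC eqxx orbT andbT.
    by apply: sDV => x xC xa xb xc; rewrite !inE ?xa ?xb ?xc xC ?orbT.
  have cyc := exchange cC sC C4 gX gC Cg aC bC ab dg.
  apply: (circuit_proper cyc); rewrite properE; apply/andP; split.
    rewrite !subUset !sub1set !inE cb cIC eqxx orbT andbT.
    by apply: sDV => x xC xa xb xc; rewrite !inE ?xa ?xb ?xc xC ?orbT.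
  apply/subsetPn; exists a; rewrite !inE ?ab ?aC ?orbT //.
  by rewrite !eqxx !andbF (eq_sym a c) (negbTE ca) (negbTE ag).
have [iae ibe ice] := key e eX eC Ce de.
have [iaf ibf icf] := key f fX fC Cf df.
have sub x y z : x \in C -> D :|: [set y; z] \subset C :\ x -> indep M (D :|: [set y; z]).
  by move=> xC; move/indepS; apply; apply: eD.
have iab : indep M (D :|: [set a; b]).
  apply: (sub c) => //; rewrite !subUset !sub1set !inE (eq_sym a c) ca aC (eq_sym b c) cb bC.
  by rewrite !andbT; apply: sDV => x xC xa xb xc; rewrite !inE xc.
have iac : indep M (D :|: [set a; c]).
  apply: (sub b) => //; rewrite !subUset !sub1set !inE ab aC cb cIC.
  by rewrite !andbT; apply: sDV => x xC xa xb xc; rewrite !inE xb.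
have ibc : indep M (D :|: [set b; c]).
  apply: (sub a) => //; rewrite !subUset !sub1set !inE ba bC ca cIC.
  by rewrite !andbT; apply: sDV => x xC xa xb xc; rewrite !inE xa.
(* The points [e] and [f] span the line through [a] and [b], so they can replace that pair without
   loss of rank. *)
have ief : indep M (D :|: [set e; f]).
  have sa := triangle_spans sC eX eC aC bC ab de.
  have sb := triangle_spans sC fX fC aC bC ab df.
  rewrite indep_rank eqn_leq rank_card /=.
  have Dab : #|D :|: [set e; f]| <= #|D :|: [set a; b]|.
    rewrite !(cardsU D) !cards2 ef ab.
    have -> : #|D :&: [set a; b]| = 0.
      apply/eqP; rewrite cards_eq0; apply/eqP/setP => x; rewrite !inE.
      by case: (x == a); case: (x == b); rewrite ?andbF.
    by rewrite subn0 leq_subr.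
  apply: leq_trans Dab _; move: iab; rewrite indep_rank => /eqP <-.
  have sef : {in [set a; b], forall x, spans M [set e; f] x}.
    have r2 : rank M ([set a; b] :|: [set e; f]) = 2.
      rewrite rank_span; last first.
        by move=> x; rewrite !inE => /orP[] /eqP->; [apply: sa | apply: sb]; rewrite ?inE ?eqxx ?orbT.
      by have := simpX (subsetP sC a aC) (subsetP sC b bC); rewrite indep_rank cards2 ab => /eqP.
    have := simpX eX fX; rewrite indep_rank cards2 ef => /eqP r2' x xab.
    rewrite /spans eqn_leq (rankS _ (subsetUr _ _)) andbT r2' -[1.+1]r2; apply: rankS.
    by rewrite subUset sub1set inE xab subsetUr.
  have := @rank_span _ M (D :|: [set e; f]) [set a; b].
  move=> <-; first by rewrite rankS // -setUA setUS // subsetUr.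
  by move=> x /sef; apply: spansS; rewrite subsetUr.
apply: (@U25_of_line _ M D [tuple a; b; c; e; f]).
- by rewrite /= !inE !negb_or ab (eq_sym a c) ca (eq_sym b c) cb ae af be bf ce cf ef.
- move=> x; rewrite !inE => /or4P[| | |/orP[]] /eqP->; rewrite ?eqxx ?andbF ?(negbTE eC) ?(negbTE fC) ?andbF //.
- move=> x xs; apply: (subsetP XM); move: xs; rewrite !inE => /or4P[| | |/orP[]] /eqP-> //; exact: (subsetP sC).
- have swp x y : D :|: [set x; y] = D :|: [set y; x] by rewrite [[set x; y]]setUC.
  move=> x y; rewrite !inE => /or4P[| | |/orP[]] /eqP-> /or4P[| | |/orP[]] /eqP->; rewrite ?eqxx // => _; by [|rewrite swp].
have CD : #|C| = #|D| + 3.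
  rewrite (cardsD1 a C) (cardsD1 b (C :\ a)) (cardsD1 c (C :\ a :\ b)) !inE aC bC cIC ca cb ba /D.
  by clear; lia.
apply: (@leq_trans (rank M (C :|: [set e; f]))).
  apply: rankS; apply/subsetP => x; rewrite !inE => /orP[/and4P[_ _ _ ->]//|].
  by move=> /or4P[| | |/orP[]] /eqP->; rewrite ?aC ?bC ?cIC ?eqxx ?orbT.
rewrite rank_span; first by have := circuit_rank cC; rewrite CD; clear; lia.
by move=> x; rewrite !inE => /orP[] /eqP->.
Qed.

(** These five points already restrict to [Y_3], with [a] as shared point: the rank is three because
    [a], [b], [b'] lie properly in [C]. The triangle on [e] plays the circuit and [b'], [f] play
    [Z], so [codep_Y3_long] finishes. *)
Lemma triangles_meet a b b' : a \in C -> b \in C -> b' \in C ->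
  a != b -> a != b' -> b != b' ->
  ~~ indep M (e |: [set a; b]) -> ~~ indep M (f |: [set a; b']) -> False.
Proof.
move=> aC bC b'C ab ab' bb' de df; apply: noY3.
have nC x y : x \notin C -> y \in C -> y != x by move=> xC; apply: contraTneq => ->.
have [ae be b'e] := And3 (nC e a eC aC) (nC e b eC bC) (nC e b' eC b'C).
have [af bf b'f] := And3 (nC f a fC aC) (nC f b fC bC) (nC f b' fC b'C).
have se := triangle_spans sC eX eC aC bC ab de.
have sf := triangle_spans sC fX fC aC b'C ab' df.
pose C1 := e |: [set a; b]; pose Z := [set b'; f].
have [aX bX b'X] := And3 (subsetP sC a aC) (subsetP sC b bC) (subsetP sC b' b'C).
have C1X : C1 \subset X by rewrite !subUset !sub1set eX aX bX.
have C1P x : x \in C1 -> [\/ x = e, x = a | x = b].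
  by rewrite !inE => /or3P[] /eqP->; [constructor 1 | constructor 2 | constructor 3].
have C1D x : x \in C1 -> exists y y', [/\ y \in C1, y' \in C1, y != y' & C1 :\ x = [set y; y']].
  move=> /C1P[] ->.
  - exists a, b; rewrite ab /C1 setU1K !inE ?eqxx ?orbT //.
    by rewrite negb_or ![e == _]eq_sym ae be.
  - exists e, b; rewrite !inE ?eqxx ?orbT [e == b]eq_sym be; split=> //.
    by apply/setP => y; rewrite !inE; case: (eqVneq y a) => [->|_]; rewrite ?(negbTE ae) ?(negbTE ab).
  exists e, a; rewrite !inE ?eqxx ?orbT [e == a]eq_sym ae; split=> //.
  apply/setP => y; rewrite !inE; case: (eqVneq y b) => [->|_]; rewrite ?orbF //=.
  by rewrite (negbTE be) eq_sym (negbTE ab).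
have cC1 : C1 \in circuits M.
  apply/circuitP; split=> //; first exact: subset_trans C1X XM.
  move=> x /C1D[y [y' [yC1 y'C1 _ ->]]]; apply: simpX; exact: (subsetP C1X).
have r3 : rank M (b' |: [set a; b]) = 3.
  have c3 : #|b' |: [set a; b]| = 3.
    by rewrite cardsU1 cards2 ab !inE ![b' == _]eq_sym negb_or ab' bb'.
  rewrite -c3; apply/eqP; rewrite -indep_rank; apply: circuit_proper cC _.
  by rewrite properEcard c3 C4 andbT !subUset !sub1set aC bC b'C.
have dZ : [disjoint C1 & Z].
  rewrite disjoint_subset; apply/subsetP => x /C1P[] ->; rewrite !inE negb_or.
  - by rewrite eq_sym b'e ef.
  - by rewrite ab' af.
  by rewrite bb' bf.
have Z2 : #|Z| = 2 by rewrite cards2 b'f.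
have C13 : #|C1| = 3 by rewrite cardsU1 cards2 ab !inE ![e == _]eq_sym negb_or ae be.
have ZX : Z \subset X by rewrite subUset !sub1set b'X fX.
have rW : (rank M (C1 :|: Z)).+2 <= #|C1| + #|Z|.
  rewrite Z2 C13 /= !ltnS -r3.
  rewrite -(@rank_span _ M (b' |: [set a; b]) [set e; f]).
    apply: rankS; rewrite !subUset !sub1set !inE !eqxx ?orbT //.
  move=> x; rewrite !inE => /orP[] /eqP->.
    by apply: (@spansS _ _ [set a; b]); rewrite ?subsetUr // se // !inE eqxx ?orbT.
  apply: (@spansS _ _ [set a; b']); first by rewrite subUset !sub1set !inE !eqxx ?orbT.
  by apply: sf; rewrite // !inE eqxx ?orbT.
have iCZ : {in C1 & Z, forall x z, indep M ((C1 :\ x) :|: (Z :\ z))}.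
  move=> x z xC1 zZ; set V := _ :|: _.
  have V3 : #|V| <= 3.
    apply: leq_trans (leq_card_setU _ _) _.
    by have := cardsD1 x C1; have := cardsD1 z Z; rewrite xC1 zZ C13 Z2; clear; lia.
  have sV1 w : w \in C1 -> spans M V w.
    move=> wC1; apply: spansS (subsetUl _ _) _.
    by have [y [y' [yC1 y'C1 yy' ->]]] := C1D x xC1; apply: se.
  have sV2 : spans M V b'.
    have [zb|zb] := eqVneq b' z; last by apply: spans_mem; rewrite !inE eqxx zb orbT.
    apply: (@spans_trans _ _ _ [set a; f]).
      move=> w; rewrite !inE => /orP[] /eqP->; first by apply: sV1; rewrite !inE eqxx orbT.
      by apply: spans_mem; rewrite !inE -zb eqxx [f == b']eq_sym b'f !orbT.
    by apply: sf; rewrite // !inE eqxx ?orbT.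
  rewrite indep_rank eqn_leq rank_card (leq_trans V3) // -r3.
  rewrite -(@rank_span _ M V (b' |: [set a; b])) ?rankS ?subsetUr //.
  move=> w; rewrite !inE => /or3P[] /eqP-> //; by apply: sV1; rewrite !inE eqxx ?orbT.
have iZ := simpX b'X fX.
apply: (codep_Y3_long cC1 (subset_trans ZX XM) dZ iZ (set21 b' f) rW iCZ (x := b) (x' := e) (z := b') (z' := f)) => //.
- by rewrite !inE eqxx !orbT.
- by rewrite !inE eqxx ?orbT.
- by rewrite !inE eqxx ?orbT.
- by rewrite !inE eqxx ?orbT.
rewrite /codep; apply: contra df; apply: indepS; rewrite !subUset !sub1set !inE !eqxx ?orbT.
by rewrite ![f == _]eq_sym ef bf ae ab [b' == b]eq_sym bb' b'e.
Qed.

Lemma triangles_disjoint a b a' b' : a \in C -> b \in C -> a' \in C -> b' \in C ->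
  a != b -> a' != b' -> ~~ indep M (e |: [set a; b]) -> ~~ indep M (f |: [set a'; b']) ->
  [disjoint e |: [set a; b] & f |: [set a'; b']].
Proof.
move=> aC bC a'C b'C ab a'b' de df.
have nC x y : x \notin C -> y \in C -> y != x by move=> xC; apply: contraTneq => ->.
have swap (x y z : T) : x |: [set y; z] = x |: [set z; y] by rewrite [[set y; z]]setUC.
have key x y y' : x \in C -> y \in C -> y' \in C -> x != y -> x != y' ->
    ~~ indep M (e |: [set x; y]) -> ~~ indep M (f |: [set x; y']) -> False.
  move=> xC yC y'C xy xy' dx dy; have [eyy|yy'] := eqVneq y y'.
    by apply: (triangles_same xC yC xy dx); rewrite eyy.
  exact: (triangles_meet xC yC y'C xy xy' yy' dx dy).
have [ba b'a'] : b != a /\ b' != a' by rewrite eq_sym ab eq_sym a'b'.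
rewrite disjoint_subset; apply/subsetP => x; rewrite !inE => xB.
apply/negP => xB'; case/or3P: xB xB' => /eqP->; case/or3P=> /eqP ex.
- by case/eqP: ef.
- by case/negP: eC; rewrite ex.
- by case/negP: eC; rewrite ex.
- by case/negP: fC; rewrite -ex.
- by subst a'; exact: (key a b b').
- by subst b'; apply: (key a b a') => //; rewrite swap.
- by case/negP: fC; rewrite -ex.
- by subst a'; apply: (key b a b') => //; rewrite swap.
- by subst b'; apply: (key b a a') => //; rewrite swap.
Qed.
End TwoTriangles.

Lemma shape_restrict (S : {set T}) (P : {set {set T}}) : trivIset P -> {in P, forall B : {set T}, #|B| = 3} ->
  [disjoint S & cover P] -> X = S :|: cover P ->
  (forall I : {set T}, I \subset X -> indep M I =
     [forall B in P, #|I :&: B| <= 2] && (#|I| < #|S| + 2 * #|P|)) ->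
  has_shape (restrict M X) S P.
Proof.
move=> tP cP dSP eX hI; have eG : ground (restrict M X) = X by apply/setIidPr.
by split; rewrite ?eG // => I sI; rewrite -hI //= /restrict_indep /= sI.
Qed.

(** * Reading the shape off a spanning circuit with at least four points *)

Section Big.
Variable C : {set T}.
Hypotheses (cC : C \in circuits M) (sC : C \subset X) (C4 : 3 < #|C|)
  (CX : {in X, forall x, spans M C x}).

Let rX : rank M X = rank M C.
Proof. by rewrite -(setUidPr sC) rank_span. Qed.

Lemma shape_big :
  exists (S : {set T}) (P : {set {set T}}), has_shape (restrict M X) S P /\ #|C| = #|S| + 2 * #|P|.
Proof.
pose F := X :\: C.
have /fin_all_exists[B hB] : forall e, exists B : {set T}, e \in F ->
    exists a b, [/\ a \in C, b \in C, a != b, ~~ indep M (e |: [set a; b]) & B = e |: [set a; b]].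
  move=> e; have [|_] := boolP (e \in F); last by exists set0.
  rewrite inE => /andP[eC eX].
  have [a [b [aC bC ab d]]] := triangle_ex cC sC C4 eX eC (CX eX).
  by exists (e |: [set a; b]) => _; exists a, b.
have FP e : e \in F -> e \in X /\ e \notin C by rewrite inE => /andP[].
have B3 e : e \in F -> #|B e| = 3.
  move=> eF; have [a [b [aC bC ab _ ->]]] := hB e eF; have [_ eC] := FP e eF.
  rewrite cardsU1 cards2 ab !inE.
  by case: eqVneq => [e1|_]; [rewrite e1 aC in eC | case: eqVneq => // e2; rewrite e2 bC in eC].
have BX e : e \in F -> B e \subset X.
  move=> eF; have [a [b [aC bC _ _ ->]]] := hB e eF; have [eX _] := FP e eF.
  by rewrite !subUset !sub1set eX !(subsetP sC).
have Bdep e : e \in F -> ~~ indep M (B e).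
  by move=> eF; have [a [b [_ _ _ ? ->]]] := hB e eF.
have Be e : e \in F -> e \in B e.
  by move=> eF; have [a [b [_ _ _ _ ->]]] := hB e eF; rewrite setU11.
have Bdisj e f : e \in F -> f \in F -> e != f -> [disjoint B e & B f].
  move=> eF fF ef; have [a [b [aC bC ab d ->]]] := hB e eF.
  have [a' [b' [a'C b'C a'b' d' ->]]] := hB f fF.
  have [[eX eC] [fX fC]] := (FP e eF, FP f fF).
  exact: (triangles_disjoint cC sC C4 eX eC (CX eX) fX fC (CX fX) ef).
have BF e z : e \in F -> z \in B e -> z \in F -> z = e.
  move=> eF + /FP[_ zC]; have [a [b [aC bC _ _ ->]]] := hB e eF.
  by rewrite !inE => /or3P[] /eqP // ez; rewrite ez ?aC ?bC in zC.
pose P := B @: F; pose S := X :\: cover P.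
have Pe D : D \in P -> exists2 e, e \in F & D = B e by case/imsetP=> e eF ->; exists e.
have injB : {in F &, injective B}.
  by move=> e f eF fF eB; apply: (BF f e) => //; rewrite -eB Be.
have cP : #|P| = #|F| by rewrite card_in_imset.
have tP : trivIset P.
  apply/trivIsetP => _ _ /Pe[e eF ->] /Pe[f fF ->] nef; apply: Bdisj => //.
  by apply: contraNneq nef => ->.
have P3 : {in P, forall D : {set T}, #|D| = 3} by move=> _ /Pe[e eF ->]; apply: B3.
have sPX : cover P \subset X by apply/bigcupsP => _ /Pe[e eF ->]; apply: BX.
have dSP : [disjoint S & cover P].
  by rewrite disjoints_subset /S setDE subsetIr.
have eX : X = S :|: cover P by rewrite setUC -{1}(setID X (cover P)) (setIidPr sPX).
(* Each triple has exactly one point outside [C], so [C] consists of [S] and two points from every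
   triple. *)
have cCS : #|C| = #|S| + 2 * #|P|.
  have c1 : #|cover P| = 3 * #|P|.
    rewrite -(setIidPr (subxx (cover P))) card_cover //.
    rewrite (eq_bigr (fun _ => 3)) => [|D DP]; first by rewrite sum_nat_const mulnC.
    by rewrite (setIidPr _) ?P3 //; apply: bigcup_sup.
  have c2 : #|F| = #|X| - #|C| by rewrite cardsDS.
  have c3 : #|S| = #|X| - #|cover P| by rewrite cardsDS.
  have := subset_leq_card sC; have := subset_leq_card sPX; move: c1 c2 c3.
  by rewrite -cP; clear; lia.
(* Induction on the points outside [C]. A point [e] of [A] outside [C] is traded for the point [b]
   of its triple that [A] omits; the result is a circuit by induction, and [exchange] turns it back
   into [A]. *)
have circ (A : {set T}) : A \subset X -> #|A| = #|C| -> {in F, forall e, #|A :&: B e| = 2} ->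
    A \in circuits M.
  have [n] := ubnP #|A :\: C|; elim: n A => // n IH A leA AX cA hA.
  have [AC|/subsetPn[e eA eC]] := boolP (A \subset C).
    by have -> : A = C by apply/eqP; rewrite eqEcard AC cA leqnn.
  have eX' := subsetP AX e eA; have eF : e \in F by rewrite inE eC.
  have [b [a [aA bA aB bB [ab ae be dab]]]] : exists b a, [/\ a \in A, b \notin A,
      a \in B e, b \in B e & [/\ a != b, a != e, b != e & ~~ indep M (e |: [set a; b])]].
    have := hA e eF; have [a [b [aC bC ab d eB]]] := hB e eF; rewrite eB.
    have ne x : x \in C -> x != e by apply: contraTneq => ->.
    have [ae be] := (ne a aC, ne b bC).
    have [aA|aA] := boolP (a \in A); have [bA|bA] := boolP (b \in A).
    - rewrite (setIidPr _) -?eB ?B3 //.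
      by rewrite eB !subUset !sub1set eA aA bA.
    - by move=> _; exists b, a; rewrite !inE !eqxx !orbT.
    - move=> _; exists a, b; rewrite !inE !eqxx !orbT [[set b; a]]setUC.
      by rewrite [b == a]eq_sym.
    suff -> : A :&: (e |: [set a; b]) = [set e] by rewrite cards1.
    apply/setP => x; rewrite !inE; case: (eqVneq x e) => [->|_]; first by rewrite eA.
    case: (eqVneq x a) => [->|_]; first by rewrite (negbTE aA).
    by case: (eqVneq x b) => [->|_]; rewrite ?andbF // (negbTE bA).
  pose A1 := b |: (A :\ e).
  have bC : b \in C.
    apply: contraR be => bC; apply/eqP; apply: (BF e b) => //.
    by rewrite inE bC (subsetP (BX e eF)).
  have cA1 : #|A1| = #|C|.
    by rewrite cardsU1 !inE (negbTE bA) andbF /= -cA (cardsD1 e A) eA.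
  have A1X : A1 \subset X.
    by rewrite subUset sub1set (subsetP sC _ bC) (subset_trans (subD1set _ _)).
  have cA1' : A1 \in circuits M.
    apply: IH => // [|f fF].
      apply: (@leq_trans #|A :\: C|) leA; apply: proper_card; rewrite properE.
      apply/andP; split.
        apply/subsetP => x; rewrite !inE => /andP[xC]; rewrite xC.
        by case/orP=> [/eqP xb|/andP[]//]; rewrite xb bC in xC.
      by apply/subsetPn; exists e; rewrite !inE ?eC // eqxx /= orbF eq_sym be.
    have [<-|ef] := eqVneq e f.
      have -> : A1 :&: B e = b |: ((A :&: B e) :\ e).
        apply/setP => x; rewrite !inE; case: (eqVneq x b) => [->|_]; rewrite ?bB //=.
        by case: (x == e).
      have := hA e eF; rewrite (cardsD1 e (A :&: B e)) inE eA Be // cardsU1.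
      by rewrite !inE (negbTE bA) andbF.
    suff -> : A1 :&: B f = A :&: B f by apply: hA.
    have dis := Bdisj e f eF fF ef; apply/setP => x; rewrite !inE.
    have [xB|//] := boolP (x \in B f); rewrite ?andbF // !andbT.
    have nx : x \notin B e by rewrite (disjointFl dis).
    have xb : x != b by apply: contraNneq nx => ->.
    have xe : x != e by apply: contraNneq nx => ->; apply: Be.
    by rewrite (negbTE xb) xe.
  have A14 : 3 < #|A1| by rewrite cA1.
  have eA1 : e \notin A1 by rewrite !inE eqxx /= orbF eq_sym.
  have A1e : spans M A1 e.
    rewrite /spans eqn_leq (rankS _ (subsetUr _ _)) andbT.
    have -> : rank M A1 = rank M X.
      by have := circuit_rank cA1'; have := circuit_rank cC; rewrite cA1 rX => <- [].
    by apply: rankS; rewrite subUset sub1set eX' A1X.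
  have aA1 : a \in A1 by rewrite !inE aA ae orbT.
  have := exchange cA1' A1X A14 eX' eA1 A1e aA1 (setU11 _ _) ab dab.
  rewrite setU1K ?setD1K // !inE (negbTE bA) andbF //.
exists S, P; split=> //; apply: shape_restrict => // I sI.
apply/idP/andP => [iI|[/forall_inP hI ltI]].
  split; last by rewrite -cCS -(circuit_rank cC) -rX ltnS rank_ge.
  apply/forall_inP => _ /Pe[e eF ->]; rewrite leqNgt; apply/negP => gt.
  case/negP: (Bdep e eF); apply: indepS iI; apply/setIidPr/eqP.
  by rewrite eqEcard subsetIr B3.
(* A maximal set with at most two points in each triple must contain [S] and exactly two points of
   every triple, so it is a circuit by [circ]. The size bound makes [I] a proper subset of it. *)
pose Q := [pred J : {set T} | (J \subset X) && [forall D in P, #|J :&: D| <= 2]].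
have [|J /maxsetP[/andP[sJ /forall_inP hJ] mJ] sIJ] := @maxset_exists _ Q I.
  by rewrite /Q /= sI; apply/forall_inP.
have mJx x : x \in X -> x \notin J ->
    exists2 D, D \in P & (x \in D) && (2 <= #|J :&: D|).
  move=> xX xJ; apply/exists_inP; apply: contraR xJ => /exists_inPn h.
  rewrite -(mJ (x |: J)) ?setU11 ?subsetUr //= subUset sub1set xX sJ /=.
  apply/forall_inP => D DP; have := h D DP; rewrite negb_and -ltnNge ltnS => /orP[xD|le1].
    rewrite (_ : _ :&: _ = J :&: D) ?hJ //; apply/setP => y; rewrite !inE.
    by case: (eqVneq y x) => [->|]; rewrite // (negbTE xD) !andbF.
  rewrite setIUl (leq_trans (leq_card_setU _ _)) // -[2]/(1 + 1) leq_add //.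
  by rewrite -(cards1 x) subset_leq_card // subsetIl.
have SJ : S \subset J.
  apply/subsetP => x; rewrite inE => /andP[xP xX]; apply: contraR xP => /(mJx x xX)[D DP /andP[xD _]].
  by apply/bigcupP; exists D.
have J2 D : D \in P -> #|J :&: D| = 2.
  move=> DP; apply/eqP; rewrite eqn_leq hJ //=.
  have /subsetPn[x xD xJ] : ~~ (D \subset J).
    by apply/negP => DJ; have := hJ D DP; rewrite (setIidPr DJ) P3.
  have xX : x \in X by apply: (subsetP sPX); apply/bigcupP; exists D.
  have [D' D'P /andP[xD' le2]] := mJx x xX xJ.
  suff -> : D = D' by [].
  apply: contraTeq xD' => neD; rewrite (disjointFr _ xD) //.
  by have /trivIsetP := tP; apply.
have cJ : #|J| = #|C|.
  rewrite -(cardsID (cover P) J) card_cover // (eq_bigr (fun _ => 2)) //.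
  rewrite sum_nat_const mulnC addnC cCS; congr (_ + _).
  suff -> : J :\: cover P = S by [].
  apply/eqP; rewrite eqEsubset; apply/andP; split; first exact: setSD.
  by rewrite subsetD SJ.
have cirJ : J \in circuits M.
  by apply: circ => // e eF; apply: J2; apply: imset_f.
by apply: (circuit_proper cirJ); rewrite properEcard sIJ cJ cCS.
Qed.
End Big.

Lemma small_indep (I : {set T}) : I \subset X -> #|I| <= 2 -> indep M I.
Proof.
move=> sI.
rewrite leq_eqVlt ltnS leq_eqVlt ltnS leqn0 cards_eq0 => /or3P[/cards2P|/cards1P|/eqP->].
- move=> [x [y [_ eI]]]; move: sI; rewrite eI subUset !sub1set => /andP[]; exact: simpX.
- move=> [x eI]; move: sI; rewrite eI sub1set => xX.
  by have := simpX xX xX; rewrite setUid.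
by rewrite indep0.
Qed.

(** In rank two, excluding [U_{2,5}] leaves three or four points. A fourth point [e] forms a triple
    with any two points of [C]; the choice of [a] as the remaining one is arbitrary. *)
Lemma shape_small (C : {set T}) : C \in circuits M -> C \subset X -> #|C| = 3 ->
  {in X, forall x, spans M C x} ->
  exists (S : {set T}) (P : {set {set T}}),
    has_shape (restrict M X) S P /\ #|C| = #|S| + 2 * #|P|.
Proof.
move=> cC sC C3 CX.
have rX : rank M X = 2.
  rewrite -(setUidPr sC) rank_span //; by have := circuit_rank cC; rewrite C3 => -[].
have iX (I : {set T}) : I \subset X -> indep M I = (#|I| <= 2).
  move=> sI; apply/idP/idP => [iI|]; [by rewrite -rX rank_ge | exact: small_indep].
have /set0Pn[a aC] : C != set0 by rewrite -cards_eq0 C3.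
have /cards2P[b [c [bc eCa]]] : #|C :\ a| == 2 by move: C3; rewrite (cardsD1 a) aC add1n => -[->].
have eC : C = a |: [set b; c] by rewrite -eCa setD1K.
have [ab ac] : a != b /\ a != c.
  by apply/andP; rewrite -negb_or -in_set2 -eCa !inE eqxx.
have inX x : x \in C -> x \in X by apply: (subsetP sC).
have [XC|[e]] := set_0Vmem (X :\: C).
  have eXC : X = C by apply/eqP; rewrite eqEsubset sC andbT -setD_eq0 XC.
  exists C, set0; rewrite cards0 addn0; split=> //; apply: shape_restrict.
  - by apply/trivIsetP => B B'; rewrite inE.
  - by move=> B; rewrite inE.
  - by rewrite /cover big_set0 disjoints_subset setC0 subsetT.
  - by rewrite /cover big_set0 setU0.
  move=> I sI; rewrite iX // C3 cards0 /= addn0 -ltnS.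
  by rewrite [X in X && _](_ : _ = true) //; apply/forall_inP => B; rewrite inE.
rewrite inE => /andP[eC' eX].
have ne x : x \in C -> x != e by apply: contraTneq => ->.
have [aC' bC cC'] : [/\ a \in C, b \in C & c \in C] by rewrite eC !inE !eqxx !orbT.
have eXe : X = e |: C.
  apply/eqP; rewrite eqEsubset subUset sub1set eX sC !andbT; apply/subsetP => f fX.
  rewrite inE; apply: contraT; rewrite negb_or inE => /andP[fe fC]; case: no25.
  have nf x : x \in C -> x != f by apply: contraTneq => ->.
  have sX : {subset [:: a; b; c; e; f] <= X}.
    by move=> x; rewrite !inE => /or4P[| | |/orP[]] /eqP->; rewrite // inX.
  apply: (@U25_of_line _ M set0 [tuple a; b; c; e; f]).
  - by rewrite /= !inE !negb_or ab ac bc (ne a aC) (ne b bC) (ne c cC') (nf a aC) (nf b bC) (nf c cC') eq_sym fe.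
  - by move=> x _; rewrite inE.
  - by move=> x /sX /(subsetP XM).
  - by move=> x y /sX xX /sX yX xy; rewrite set0U; apply: simpX.
  rewrite set0U cards0 (leq_trans _ (eq_leq rX)) //; apply: rankS.
  by apply/subsetP => x; rewrite inE => /sX.
have c3 : #|e |: [set b; c]| = 3.
  by rewrite cardsU1 cards2 bc !inE ![e == _]eq_sym negb_or (ne b bC) (ne c cC').
exists [set a], [set e |: [set b; c]]; rewrite !cards1; split; last exact: C3.
apply: shape_restrict.
- by apply/trivIsetP => B B' /set1P-> /set1P->; rewrite eqxx.
- by move=> B /set1P->.
- by rewrite /cover big_set1 disjoints1 !inE !negb_or ab ac (ne a aC).
- by rewrite /cover big_set1 eXe eC setUCA.
move=> I sI; rewrite iX // !cards1; apply/idP/andP => [le2|[_ lt]] //.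
split=> //; apply/forall_inP => B /set1P->; apply: leq_trans le2.
by rewrite subset_leq_card // subsetIl.
Qed.

Theorem shape_of_no_minors : 1 < rank M X -> exists (S : {set T}) (P : {set {set T}}),
  has_shape (restrict M X) S P /\ 3 <= #|S| + 2 * #|P|.
Proof.
move=> /spanning_circuit[C [cC sC CX]].
have C3 : 2 < #|C|.
  have /circuitP[_ + _] := cC; apply: contraR; rewrite -leqNgt; exact: small_indep.
have [C4|] := ltnP 3 #|C|; last first.
  move=> le3; have eC : #|C| = 3 by apply/eqP; rewrite eqn_leq le3.
  by have [S [P [h e]]] := shape_small cC sC eC CX; exists S, P; rewrite -e.
by have [S [P [h e]]] := shape_big cC sC C4 CX; exists S, P; rewrite -e.
Qed.

End Structure.

(** * Two-sums with [U_{2,4}] *)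

Section ShapeIso.
Variables (T U : finType) (M : matroid T) (N : matroid U) (f : T -> U).
Variables (S : {set T}) (P : {set {set T}}).
Hypotheses (shM : has_shape M S P) (injf : {in ground M &, injective f}).

Let imP := [set f @: B | B : {set T} in P].

Let PM B : B \in P -> B \subset ground M.
Proof. by move=> BP; case: shM => _ _ _ -> _; apply: subsetU; rewrite bigcup_sup ?orbT. Qed.

Let SM : S \subset ground M.
Proof. by case: shM => _ _ _ -> _; apply: subsetUl. Qed.

Let imI (I J : {set T}) : I \subset ground M -> J \subset ground M ->
  f @: I :&: f @: J = f @: (I :&: J).
Proof.
move=> sI sJ; apply/esym/imsetI => x y xI yJ; apply: injf.
  exact: (subsetP sI).
exact: (subsetP sJ).
Qed.

Let im_inj : {in P &, injective (fun B : {set T} => f @: B)}.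
Proof.
move=> B B' /PM sB /PM sB' e; apply/setP => x.
have h (D D' : {set T}) : D \subset ground M -> D' \subset ground M -> f @: D = f @: D' -> x \in D -> x \in D'.
  move=> sD sD' eD xD; have : f x \in f @: D' by rewrite -eD imset_f.
  case/imsetP=> y yD' /injf -> //; [exact: (subsetP sD) | exact: (subsetP sD')].
by apply/idP/idP; apply: h.
Qed.

Let card_im (I : {set T}) : I \subset ground M -> #|f @: I| = #|I|.
Proof. by move=> sI; apply: card_in_imset; apply: sub_in2 injf; apply: (subsetP sI). Qed.

Let bound_im (I : {set T}) : I \subset ground M ->
  ([forall B in imP, #|f @: I :&: B| <= 2] && (#|f @: I| < #|f @: S| + 2 * #|imP|))
  = ([forall B in P, #|I :&: B| <= 2] && (#|I| < #|S| + 2 * #|P|)).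
Proof.
move=> sI; rewrite !card_im // (card_in_imset im_inj); congr andb.
apply/forall_inP/forall_inP => h B.
  move=> BP; have := h (f @: B) (imset_f _ BP); rewrite imI // ?PM // card_im //.
  by apply: subset_trans (subsetIl _ _) sI.
case/imsetP=> D DP ->; rewrite imI // ?PM // card_im ?h //.
by apply: subset_trans (subsetIl _ _) sI.
Qed.

Let cover_im : cover imP = f @: cover P.
Proof.
apply/setP => y; apply/bigcupP/imsetP => [[_ /imsetP[B BP ->] /imsetP[x xB ->]]|[x /bigcupP[B BP xB] ->]].
  by exists x => //; apply/bigcupP; exists B.
by exists (f @: B); rewrite imset_f.
Qed.

(** A shape determines its matroid, so a map that carries one shape to the other is an
    isomorphism. *)
Lemma shape_iso_via : has_shape N (f @: S) imP -> iso_via f M N.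
Proof.
case: (shM) => _ _ _ gM hM [_ _ _ gN hN]; split=> //.
  by rewrite gM imsetU gN cover_im.
move=> I sI; rewrite hM // hN ?bound_im //.
by rewrite gN cover_im -imsetU -gM imsetS.
Qed.

Lemma iso_via_shape : iso_via f M N -> has_shape N (f @: S) imP.
Proof.
case: (shM) => tP cP dSP gM hM [_ gN hN].
have cM : cover P \subset ground M by rewrite gM subsetUr.
split.
- apply/trivIsetP => _ _ /imsetP[B BP ->] /imsetP[D DP ->] ne.
  rewrite -setI_eq0 imI ?PM // disjoint_setI0 ?imset0 //.
  by move/trivIsetP: tP; apply=> //; apply: contraNneq ne => ->.
- by move=> _ /imsetP[B BP ->]; rewrite card_im ?PM ?cP.
- by rewrite -setI_eq0 cover_im imI // disjoint_setI0 // imset0.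
- by rewrite -gN gM imsetU cover_im.
move=> J; rewrite -gN => sJ.
have -> : J = f @: [set x in ground M | f x \in J].
  apply/setP => y; apply/idP/imsetP => [yJ|[x]]; last by rewrite inE => /andP[_ ?] ->.
  have /imsetP[x xM ey] := subsetP sJ y yJ; exists x => //; by rewrite inE xM -ey.
have sI : [set x in ground M | f x \in J] \subset ground M.
  by apply/subsetP => x; rewrite inE => /andP[].
by rewrite hN // bound_im // hM.
Qed.
End ShapeIso.

Lemma uniform_isoP (T : finType) (M : matroid T) r n : 0 < n ->
  isomorphic M (uniform r n) <->
  #|ground M| = n /\ forall I : {set T}, I \subset ground M -> indep M I = (#|I| <= r).
Proof.
case: n => // n _; split=> [/(isomorphic_via ord0)[f [injf imf hI]]|[cM hM]].
  split=> [|I sI]; first by rewrite -(card_in_imset injf) imf cardsT card_ord.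
  rewrite -hI //= /uniform_indep /= subsetT card_in_imset //.
  by apply: sub_in2 injf; apply: (subsetP sI).
pose f x : 'I_n.+1 := inord (index x (enum (ground M))).
have injf : {in ground M &, injective f}.
  move=> x y xM yM /(congr1 val) /=.
  have ltn z : z \in ground M -> index z (enum (ground M)) < n.+1.
    by move=> zM; rewrite -cM cardE index_mem mem_enum.
  rewrite !inordK ?ltn // => /(congr1 (nth x (enum (ground M)))).
  by rewrite !nth_index ?mem_enum.
apply: (@iso_via_isomorphic _ _ _ _ f); split=> //.
  apply/eqP; rewrite eqEcard subsetT /= (card_in_imset injf) cM.
  by rewrite cardsT card_ord.
move=> I sI; rewrite hM //= /uniform_indep /= subsetT card_in_imset //.
by apply: sub_in2 injf; apply: (subsetP sI).
Qed.

Section TwoSumShape.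
Variables (T : finType) (p : T) (M Q : matroid T) (bp : basepoint p M Q).
Variables (S : {set T}) (P : {set {set T}}).
Hypotheses (shM : has_shape M S P) (pS : p \in S)
  (cQ : #|ground Q| = 4)
  (hQ : forall I : {set T}, I \subset ground Q -> indep Q I = (#|I| <= 2)).

Let B0 := ground Q :\ p.

Let GH : ground M :&: ground Q = [set p].
Proof. by case/and3P: bp => /eqP. Qed.

Let pQ : p \in ground Q.
Proof. by have /setIP[] : p \in ground M :&: ground Q by rewrite GH set11. Qed.

Let pM : p \in ground M.
Proof. by have /setIP[] : p \in ground M :&: ground Q by rewrite GH set11. Qed.

Let dB0 : [disjoint ground M & B0].
Proof. by rewrite -setI_eq0 setIDA GH setDv. Qed.

Let cB0 : #|B0| = 3.
Proof. by move: cQ; rewrite (cardsD1 p) pQ add1n => -[]. Qed.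

Lemma two_sum_new : B0 \notin P.
Proof.
apply/negP => BP; have /card_gt0P[x xB] : 0 < #|B0| by rewrite cB0.
have : x \in ground M by case: shM => _ _ _ -> _; rewrite inE (subsetP (bigcup_sup _ BP)) ?orbT.
by rewrite (disjointFl dB0).
Qed.

(** The basepoint leaves [S] and the other three points of [Q] enter as a triple. The bound thus
    rises by one, in agreement with the rank of a 2-sum. *)
Lemma two_sum_shape : has_shape (two_sum bp) (S :\ p) (B0 |: P).
Proof.
case: (shM) => tP cP dSP gM hM.
have PM B : B \in P -> B \subset ground M.
  by move=> BP; rewrite gM; apply: subsetU; rewrite bigcup_sup ?orbT.
have pP : p \notin cover P by rewrite (disjointFr dSP pS).
have cov : cover (B0 |: P) = B0 :|: cover P.
  by rewrite /cover bigcup_setU big_set1.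
have dSM : S \subset ground M by rewrite gM subsetUl.
have gE : ground (two_sum bp) = S :\ p :|: cover (B0 |: P).
  rewrite /= setIDA setIid cov gM; apply/setP => x; rewrite !inE.
  by case: eqVneq => [->|] /=; rewrite ?(negbTE pP) // orbAC orbA.
split=> //.
- apply/trivIsetP => B D /setU1P[->|BP] /setU1P[->|DP].
  + by rewrite eqxx.
  + by move=> _; rewrite disjoint_sym; apply: disjointWl (PM D DP) dB0.
  + by move=> _; apply: disjointWl (PM B BP) dB0.
  by move: B D BP DP; apply/trivIsetP.
- by move=> B /setU1P[->|/cP].
- rewrite cov disjoints_subset setCU subsetI -!disjoints_subset; apply/andP; split.
    apply: disjointWl dB0; exact: subset_trans (subD1set _ _) dSM.
  by apply: disjointWl dSP; apply: subD1set.
move=> I sI.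
have pI : p \notin I.
  by apply/negP => /(subsetP sI); rewrite !inE eqxx andbF.
have IQ : I :&: ground Q = I :&: B0.
  by apply/setP => x; rewrite !inE; case: eqVneq => [->|] //; rewrite (negbTE pI).
have sI' : I \subset ground M :|: ground Q.
  by apply: subset_trans sI _; rewrite /= setIDA setIid subD1set.
have cI : #|I| = #|I :&: ground M| + #|I :&: B0|.
  rewrite -[in LHS](setIidPl sI') setIUr IQ cardsU setIACA setIid.
  by rewrite (disjoint_setI0 dB0) setI0 cards0 subn0.
have IB B : B \in P -> I :&: ground M :&: B = I :&: B.
  by move=> BP; rewrite -setIA (setIidPr (PM B BP)).
have pIB B : B \in P -> (p |: I :&: ground M) :&: B = I :&: B.
  move=> BP; rewrite setIUl IB // (_ : [set p] :&: B = set0) ?set0U //.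
  apply/eqP; rewrite setI_eq0 disjoints1; apply: contra pP; apply/subsetP; exact: bigcup_sup.
have eM : indep M (I :&: ground M) =
   [forall B in P, #|I :&: B| <= 2] && (#|I :&: ground M| < #|S| + 2 * #|P|).
  rewrite hM ?subsetIr //; congr andb; apply: eq_forallb_in => B BP; by rewrite IB.
have epM : indep M (p |: I :&: ground M) =
   [forall B in P, #|I :&: B| <= 2] && (#|I :&: ground M|.+1 < #|S| + 2 * #|P|).
  rewrite hM ?subUset ?sub1set ?pM ?subsetIr //.
  rewrite cardsU1 inE (negbTE pI) add1n; congr andb.
  by apply: eq_forallb_in => B BP; rewrite pIB.
have eQ : indep Q (I :&: ground Q) = (#|I :&: B0| <= 2) by rewrite hQ ?subsetIr // IQ.
have epQ : indep Q (p |: I :&: ground Q) = (#|I :&: B0| <= 1).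
  rewrite hQ ?subUset ?sub1set ?pQ ?subsetIr // cardsU1 inE (negbTE pI) add1n IQ.
  by [].
have -> : indep (two_sum bp) I = parallel_indep p M Q I.
  by rewrite /= /restrict_indep /=; rewrite (subset_trans sI) //= subsetIr.
rewrite parallel_indepE // sI' eM epM eQ epQ cardsU1 two_sum_new.
rewrite cI (cardsD1 p S) pS.
have -> : [forall B in B0 |: P, #|I :&: B| <= 2] =
    (#|I :&: B0| <= 2) && [forall B in P, #|I :&: B| <= 2].
  apply/forall_inP/andP => [h|[h0 /forall_inP h] B /setU1P[->|]//]; last exact: h.
  by split; [apply: h; rewrite setU11 | apply/forall_inP => B BP; apply: h; rewrite setU1r].
have [/forall_inP hall|_] := boolP [forall B in P, #|I :&: B| <= 2]; last by rewrite !andbF.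
(* Two points per triple and no basepoint already make [I] independent on the side of [M]. What
   remains is that [p] can be added on one of the sides, which is exactly the joint size bound. *)
have : #|I :&: ground M| <= #|S :\ p| + 2 * #|P|.
  rewrite {1}gM setIUr; apply: leq_trans (leq_card_setU _ _) _; apply: leq_add.
    apply: subset_leq_card; apply/subsetP => x; rewrite !inE => /andP[xI ->].
    by rewrite andbT; apply: contraNneq pI => <-.
  rewrite card_cover // mulnC -sum_nat_const; exact: leq_sum.
rewrite !andTb; move: (#|_ :&: ground M|) (#|_ :&: B0|) (#|S :\ p|) (#|P|) => a b c d.
clear; lia.
Qed.
End TwoSumShape.

Lemma circuit_on_shape (T : finType) (C : {set T}) :
  C != set0 -> has_shape (circuit_on C) C set0.
Proof.
rewrite -card_gt0 => C0; rewrite /has_shape /cover big_set0 cards0 addn0 setU0; split=> //.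
- by apply/trivIsetP => B D; rewrite inE.
- by move=> B; rewrite inE.
- by rewrite disjoints_subset setC0 subsetT.
move=> I /= sI; rewrite /uniform_indep /= sI -ltnS prednK //.
by rewrite [X in _ = X && _](_ : _ = true) //; apply/forall_inP => B; rewrite inE.
Qed.

(** Any point may be singled out: every set with fewer than three elements omits part of any given
    triple. For a 2-sum the chosen point is the basepoint. *)
Lemma U24_shape (T : finType) (M : matroid T) a :
  #|ground M| = 4 -> (forall I : {set T}, I \subset ground M -> indep M I = (#|I| <= 2)) ->
  a \in ground M -> has_shape M [set a] [set ground M :\ a].
Proof.
move=> cM hM aM; have c3 : #|ground M :\ a| = 3.
  by move: cM; rewrite (cardsD1 a) aM add1n => -[].
rewrite /has_shape /cover big_set1 !cards1; split.
- by apply/trivIsetP => B B' /set1P-> /set1P->; rewrite eqxx.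
- by move=> B /set1P->.
- by rewrite disjoints1 !inE eqxx.
- by rewrite setD1K.
move=> I sI; rewrite hM //; apply/idP/andP => [le2|[_ lt]] //.
split=> //; apply/forall_inP => B /set1P->; apply: leq_trans le2.
by rewrite subset_leq_card // subsetIl.
Qed.

Lemma attach_shape (T : finType) (C K : {set T}) (M : matroid T) :
  C != set0 -> attach_U24 C K M -> K \subset C /\ exists P, has_shape M (C :\: K) P.
Proof.
move=> C0; elim=> {K M} [|K M Q p bp _ [sK [P shP]] pC pK isoQ].
  by rewrite sub0set setD0; split=> //; exists set0; apply: circuit_on_shape.
have [cQ hQ] := (uniform_isoP Q 2 (isT : 0 < 4)).1 isoQ.
split; first by rewrite subUset sub1set pC.
exists ((ground Q :\ p) |: P).
have -> : C :\: (p |: K) = (C :\: K) :\ p.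
  by apply/setP => x; rewrite !inE negb_or andbA.
by apply: two_sum_shape; rewrite // inE pK.
Qed.

Section Build.
Variables (T : finType) (M : matroid T) (S : {set T}) (P : {set {set T}}).
Hypotheses (shM : has_shape M S P).

Let U : finType := (T + {set T})%type.
Let l (x : T) : U := inl x.
Let r (B : {set T}) : U := inr B.

(* The elements of [T] keep their names; the basepoint used for the triple [B]
   is [inr B]. *)
Let C : {set U} := (l @: S) :|: (r @: P).

Let l_inj : injective l. Proof. by move=> x y []. Qed.
Let r_inj : injective r. Proof. by move=> x y []. Qed.
Let lr (A : {set T}) B : r B \in l @: A = false.
Proof. by apply/negP => /imsetP[]. Qed.
Let rl (A : {set {set T}}) x : l x \in r @: A = false.
Proof. by apply/negP => /imsetP[]. Qed.
Let mem_l x (A : {set T}) : (l x \in l @: A) = (x \in A).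
Proof. exact: mem_imset. Qed.
Let mem_r x (A : {set {set T}}) : (r x \in r @: A) = (x \in A).
Proof. exact: mem_imset. Qed.

Definition U24_over (B : {set T}) : matroid U := uniform_on (r B |: l @: B) 2.

Lemma card_build : #|C| = #|S| + #|P|.
Proof.
rewrite cardsU !card_imset // disjoint_setI0 ?cards0 ?subn0 //.
rewrite disjoint_subset; apply/subsetP => _ /imsetP[x _ ->]; by rewrite inE rl.
Qed.

Lemma attach_build (P' : {set {set T}}) : 1 < #|S| + #|P| -> P' \subset P ->
  exists2 L : matroid U, attach_U24 C (r @: P') L &
    has_shape L (C :\: r @: P') [set l @: B | B : {set T} in P'].
Proof.
move=> SP1; have [n] := ubnP #|P'|; elim: n P' => // n IH P' leP sP.
have [->|[B BP']] := set_0Vmem P'.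
  exists (circuit_on C); rewrite !imset0 ?setD0; first exact: attach_none.
  by apply: circuit_on_shape; rewrite -card_gt0 card_build ltnW.
have [||L attL shL] := IH (P' :\ B).
- by move: leP; rewrite (cardsD1 B) BP'.
- by apply: subset_trans sP; apply: subD1set.
have BP := subsetP sP B BP'.
have [tP cP dSP gM _] := shM.
pose Q := U24_over B.
have cQ : #|ground Q| = 4 by rewrite /= cardsU1 lr card_imset ?cP.
have hQ (I : {set U}) : I \subset ground Q -> indep Q I = (#|I| <= 2).
  by move=> sI; rewrite /= /uniform_indep /= sI.
have rC : r B \in C by rewrite inE mem_r BP orbT.
have rB : r B \notin r @: (P' :\ B) by rewrite mem_r !inE eqxx.
have [tL cL dL gL hL] := shL.
(* Attaching triples never lowers the size bound below that of the initial circuit, so the next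
   basepoint stays a nonloop. *)
have SPL : #|S| + #|P| <= #|C :\: r @: (P' :\ B)| + 2 * #|[set l @: D | D : {set T} in P' :\ B]|.
  rewrite -card_build -(cardsID (r @: (P' :\ B)) C) addnC leq_add2l.
  rewrite (setIidPr _); last first.
    apply: subset_trans (subsetUr _ _); apply: imsetS; apply: subset_trans sP; exact: subD1set.
  rewrite !card_imset; first exact: leq_pmull.
    exact: imset_inj.
  exact: r_inj.
have bp : basepoint (r B) L Q.
  apply/and3P; split.
  - apply/eqP/setP => y; rewrite gL !inE; case: (eqVneq y (r B)) => [->|yB] /=.
      by rewrite (negbTE rB) lr mem_r BP.
    rewrite andbC; apply/negbTE/negP => /andP[/imsetP[x xB ->]].
    have xM : x \in cover P by apply/bigcupP; exists B.
    rewrite !rl mem_l /= orbF (disjointFl dSP xM) /=.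
    case/bigcupP => _ /imsetP[D /setD1P[DB DP'] ->]; rewrite mem_l => xD.
    have := trivIsetP tP B D BP (subsetP sP D DP'); rewrite eq_sym DB => /(_ isT) dBD.
    by rewrite (disjointFr dBD xB) in xD.
  - have rL : [set r B] \subset ground L by rewrite gL sub1set inE inE rB rC.
    rewrite hL // cards1 (leq_trans SP1 SPL) andbT; apply/forall_inP => D _.
    by apply: leq_trans (subset_leq_card (subsetIl _ _)) _; rewrite cards1.
  by rewrite hQ ?cards1 // sub1set !inE eqxx.
exists (two_sum bp).
  rewrite -(setD1K BP') imsetU1; apply: attach_one => //.
  by apply/uniform_isoP.
have pS : r B \in C :\: r @: (P' :\ B) by rewrite inE rB rC.
have := two_sum_shape bp shL pS cQ hQ.
have -> : ground Q :\ r B = l @: B by rewrite /= setU1K // lr.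
have -> : (C :\: r @: (P' :\ B)) :\ r B = C :\: r @: P'.
  rewrite -[in RHS](setD1K BP') imsetU1.
  by apply/setP => x; rewrite !inE negb_or andbA.
by rewrite -imsetU1 setD1K.
Qed.

Lemma iso_build : 1 < #|S| + #|P| ->
  exists2 L : matroid U, attach_U24 C (r @: P) L & isomorphic M L.
Proof.
move=> SP1; have [L attL shL] := attach_build SP1 (subxx P).
exists L => //; apply: (iso_via_isomorphic (f := l)).
apply: (shape_iso_via shM) => [x y _ _|]; first exact: l_inj.
suff e : C :\: r @: P = l @: S by rewrite -e.
rewrite /C setDUl setDv setU0; apply/setDidPl.
rewrite disjoint_subset; apply/subsetP => _ /imsetP[x _ ->]; by rewrite inE rl.
Qed.
End Build.

Lemma shape_sound (T : finType) (L : matroid T) :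
  isomorphic L (uniform 2 4) \/ is_two_sum L (uniform 2 4) (uniform 2 4)
    \/ (exists n k : nat, 3 <= n /\ k <= n /\ circuit_with_U24s n k L) ->
  exists S P, has_shape L S P.
Proof.
have back (U : finType) (N : matroid U) (u0 : U) S P :
    isomorphic L N -> has_shape N S P -> exists S P, has_shape L S P.
  move=> isoLN shN.
  have [h [_ imh _]] := isomorphic_via u0 isoLN.
  (* Pulling a shape back needs a point of [T]. If [L] were empty, so would be [S] and [P], and the
     bound zero would make the empty set dependent. *)
  have [L0|[t0 _]] := set_0Vmem (ground L); last first.
    have [g gV] := isomorphic_via t0 (isomorphic_sym isoLN).
    have inj_g : {in ground N &, injective g} by case: gV.
    by exists (g @: S), [set g @: B | B : {set U} in P]; exact: (iso_via_shape shN inj_g gV).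
  have [_ cP _ gN hN] := shN; move: imh; rewrite L0 imset0 => N0.
  have S0 : S = set0 by apply/eqP; rewrite -subset0 N0 gN subsetUl.
  have := hN set0; rewrite sub0set indep0 => /(_ isT)/esym/andP[_].
  rewrite S0 !cards0 add0n muln_gt0 /= => /card_gt0P[B BP].
  have := cP B BP; suff -> : B = set0 by rewrite cards0.
  by apply/eqP; rewrite -subset0 N0 gN; apply: subsetU; rewrite bigcup_sup ?orbT.
case=> [iso|[[U [p [M1 [M2 [bp [iso1 iso2 iso]]]]]]|[n [k [n3 [_ [U [C [K [N [cC _ att iso]]]]]]]]]]].
- have [cL hL] := (uniform_isoP L 2 (isT : 0 < 4)).1 iso.
  have /card_gt0P[a aL] : 0 < #|ground L| by rewrite cL.
  by exists [set a], [set ground L :\ a]; apply: U24_shape.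
- have [c1 h1] := (uniform_isoP M1 2 (isT : 0 < 4)).1 iso1.
  have [c2 h2] := (uniform_isoP M2 2 (isT : 0 < 4)).1 iso2.
  have pM : p \in ground M1.
    by case/and3P: (bp) => _ /indep_ground; rewrite sub1set.
  have := two_sum_shape bp (U24_shape c1 h1 pM) (set11 p) c2 h2.
  exact: (back _ _ p _ _ iso).
have C0 : C != set0 by rewrite -card_gt0 cC; apply: leq_trans n3.
have [_ [P shP]] := attach_shape C0 att.
have /set0Pn[u0 _] := C0; exact: (back _ _ u0 _ _ iso shP).
Qed.

(** The circuit has [|S| + |P|] elements. If there are at most two, the lower bound leaves
    [|S| = |P| = 1] or [|S| = 0], [|P| = 2]. These are the two exceptional matroids: one or two
    copies of [U_{2,4}] on what would be a two-element circuit. *)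
Lemma shape_complete (T : finType) (L : matroid T) (S : {set T}) (P : {set {set T}}) :
  has_shape L S P -> 3 <= #|S| + 2 * #|P| ->
  isomorphic L (uniform 2 4) \/ is_two_sum L (uniform 2 4) (uniform 2 4)
    \/ (exists n k : nat, 3 <= n /\ k <= n /\ circuit_with_U24s n k L).
Proof.
move=> shL; have [tP cP dSP gL hL] := shL => le3.
have cG : #|ground L| = #|S| + 3 * #|P|.
  rewrite gL cardsU disjoint_setI0 // cards0 subn0; congr (_ + _).
  rewrite -(setIidPr (subxx (cover P))) card_cover //.
  rewrite (eq_bigr (fun _ => 3)) => [|D DP]; first by rewrite sum_nat_const mulnC.
  by rewrite (setIidPr _) ?cP //; apply: bigcup_sup.
have [n3|] := leqP 3 (#|S| + #|P|).
  right; right; exists (#|S| + #|P|), #|P|; rewrite leq_addl; split=> //; split=> //.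
  have [N attN isoN] := iso_build shL (ltnW n3).
  refine (ex_intro _ _ (ex_intro _ _ (ex_intro _ _ (ex_intro _ N (And4 _ _ attN isoN))))).
    exact: card_build.
  by apply: card_imset => x y [].
rewrite ltnS => n2; have [k1|k2] := leqP #|P| 1.
  have [s1 {}k1] : #|S| = 1 /\ #|P| = 1 by move: n2 le3 k1; clear; lia.
  left; apply/uniform_isoP => //; split; first by rewrite cG s1 k1.
  move=> I sI; rewrite hL // s1 k1; apply/andP/idP => [[_ lt]|le2] //.
  split=> //; apply/forall_inP => B _; apply: leq_trans le2.
  by rewrite subset_leq_card // subsetIl.
have [s0 {}k2] : #|S| = 0 /\ #|P| = 2 by move: n2 le3 k2; clear; lia.
have S0 : S = set0 by apply/eqP; rewrite -cards_eq0 s0.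
have /cards2P[B1 [B2 [neB eP]]] : #|P| == 2 by rewrite k2.
right; left; pose U : finType := (T + unit)%type; pose q : U := inr tt.
pose l (x : T) : U := inl x; have l_inj : injective l by move=> x y [].
have lq (B : {set T}) : q \in l @: B = false by apply/negP => /imsetP[].
have B1P : B1 \in P by rewrite eP set21.
have B2P : B2 \in P by rewrite eP set22.
pose Q (B : {set T}) : matroid U := uniform_on (q |: l @: B) 2.
have cQ B : B \in P -> #|ground (Q B)| = 4.
  by move=> BP; rewrite /= cardsU1 lq card_imset ?cP.
have hQ B (I : {set U}) : I \subset ground (Q B) -> indep (Q B) I = (#|I| <= 2).
  by move=> sI; rewrite /= /uniform_indep /= sI.
have dB : [disjoint B1 & B2] by apply: (trivIsetP tP).
have iq B : indep (Q B) [set q] by rewrite hQ ?cards1 // sub1set !inE eqxx.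
have bp : basepoint q (Q B1) (Q B2).
  apply/and3P; split=> //; apply/eqP/setP => y; rewrite !inE.
  case: (eqVneq y q) => //= _; apply/andP => -[/imsetP[x xB1 ->]].
  by rewrite mem_imset // (disjointFr dB xB1).
exists U, q, (Q B1), (Q B2), bp; split.
- by apply/uniform_isoP => //; split; [exact: cQ | exact: hQ].
- by apply/uniform_isoP => //; split; [exact: cQ | exact: hQ].
apply: (iso_via_isomorphic (f := l)).
apply: (shape_iso_via shL) => [x y _ _|]; first exact: l_inj.
have qQ (B : {set T}) : q \in ground (Q B) by rewrite !inE eqxx.
have := two_sum_shape bp (U24_shape (cQ _ B1P) (hQ B1) (qQ B1)) (set11 q) (cQ _ B2P) (hQ B2).
have e (B : {set T}) : ground (Q B) :\ q = l @: B by rewrite /= setU1K // lq.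
by rewrite !e setDv S0 imset0 eP imsetU1 imset_set1 setUC.
Qed.

(** * Simplification and components *)

Section Simple.
Variables (T : finType) (N : matroid T).
Implicit Types (x y : T) (I J C X Y Q : {set T}).

Lemma rank1 x : x \in nonloops N -> rank N [set x] = 1.
Proof. by rewrite inE indep_rank cards1 => /eqP. Qed.

(** Transitivity of parallelism is inherited from that of closure. *)
Lemma parallel_spans x y : x \in nonloops N -> y \in nonloops N ->
  parallel N x y = spans N [set x] y.
Proof.
move=> xN yN; rewrite /parallel /=; have [->|xy] := eqVneq x y.
  by rewrite spans_mem ?set11.
have c2 : #|[set x; y]| = 2 by rewrite cards2 xy.
rewrite /spans rank1 // [y |: _]setUC; apply/idP/eqP => [/circuit_rank|r1]; first by rewrite c2 => -[].
have [xM yM] : x \in ground N /\ y \in ground N.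
  by move: xN yN; rewrite !inE => /indep_ground + /indep_ground; rewrite !sub1set.
apply/circuitP; split; first by rewrite subUset !sub1set xM.
  by rewrite indep_rank r1 c2.
move=> z; rewrite !inE => /orP[] /eqP->.
  rewrite (_ : _ :\ _ = [set y]); first by rewrite inE in yN.
  by apply/setP => w; rewrite !inE; case: (eqVneq w x) => [->|]; rewrite ?(negbTE xy).
rewrite (_ : _ :\ _ = [set x]); first by rewrite inE in xN.
apply/setP => w; rewrite !inE; case: (eqVneq w y) => [->|]; rewrite ?orbF //=.
by rewrite eq_sym (negbTE xy).
Qed.

Lemma parallel_equiv : {in nonloops N & &, equivalence_rel (parallel N)}.
Proof.
have sym x y : x \in nonloops N -> y \in nonloops N ->
    spans N [set x] y -> spans N [set y] x.
  by move=> xN yN; rewrite /spans !rank1 // setUC.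
have trans x y z : spans N [set x] y -> spans N [set y] z -> spans N [set x] z.
  by move=> xy; apply: spans_trans => w /set1P->.
move=> x y z xN yN zN; split; first by rewrite parallel_spans // spans_mem ?set11.
rewrite !parallel_spans // => xy; apply/idP/idP; last exact: trans.
by apply: trans; apply: sym.
Qed.

(** [rho] sends a nonloop to the chosen point of its parallel class. As the two span each other,
    ranks can be computed on representatives. *)
Lemma simplification_repr : exists rho : T -> T,
  [/\ {in nonloops N, forall x, rho x \in ground (simplification N)
        /\ spans N [set x] (rho x) /\ spans N [set rho x] x},
      ground (simplification N) \subset nonloops N
    & {in ground (simplification N) &, forall x y, x != y -> indep N [set x; y]}].
Proof.
set P := equivalence_partition (parallel N) (nonloops N).
have pP : partition P (nonloops N) := equivalence_partitionP parallel_equiv.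
have tP := transversalP pP; have sub := transversal_sub tP.
have covP x : x \in nonloops N -> x \in cover P by rewrite (cover_partition pP).
have gR : ground (simplification N) = transversal P (nonloops N).
  rewrite /simplification /=; apply/setIidPr; apply: subset_trans sub _.
  by apply/subsetP => x; rewrite inE => /indep_ground; rewrite sub1set.
exists (fun x => transversal_repr x (transversal P (nonloops N)) (pblock P x)); rewrite gR.
split=> // [x xN|x y xR yR xy].
  have xP := pblock_mem (covP x xN); have rR := repr_mem_transversal tP x xP.
  split=> //; have := repr_mem_pblock tP x xP; have rN := subsetP sub _ rR.
  rewrite (pblock_equivalence_partition parallel_equiv) // => par.
  split; first by rewrite -parallel_spans.
  have [_ e] := parallel_equiv xN rN xN; move: (e par).
  have [-> _] := parallel_equiv xN xN xN; rewrite -parallel_spans //; exact: esym.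
have [xN yN] := (subsetP sub _ xR, subsetP sub _ yR).
rewrite indep_rank cards2 xy; apply/negPn/negP => ne; case/eqP: xy.
apply: (pblock_inj tP) => //; apply: same_pblock; first by case/and3P: pP.
rewrite (pblock_equivalence_partition parallel_equiv) // parallel_spans // /spans.
have := rank1U N x [set y]; have := rankS N (subsetUr [set x] [set y]).
by rewrite rank1 //; move: ne; clear; lia.
Qed.

Variables (rho : T -> T).
Let R := ground (simplification N).
Hypothesis rhoP : {in nonloops N, forall x, rho x \in R
  /\ spans N [set x] (rho x) /\ spans N [set rho x] x}.

Lemma repr_rank I : I \subset nonloops N -> rank N (rho @: I) = rank N I.
Proof.
move=> sI; transitivity (rank N (I :|: rho @: I)).
  rewrite setUC rank_span // => x xI; have [_ [_ ]] := rhoP (subsetP sI x xI).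
  by apply: spansS; rewrite sub1set imset_f.
rewrite rank_span // => _ /imsetP[x xI ->]; have [_ [+ _]] := rhoP (subsetP sI x xI).
by apply: spansS; rewrite sub1set.
Qed.

Lemma indep_nonloops I : indep N I -> I \subset nonloops N.
Proof.
by move=> iI; apply/subsetP => x xI; rewrite inE; apply: indepS iI; rewrite sub1set.
Qed.

(** Two parallel points would make the image smaller than its rank, which equals the size of [I]. *)
Lemma indep_repr_inj I : indep N I -> {in I &, injective rho}.
Proof.
move=> iI; have sI := indep_nonloops iI; apply/imset_injP.
rewrite eqn_leq leq_imset_card /=; move: (iI); rewrite indep_rank => /eqP <-.
by rewrite -repr_rank // rank_card.
Qed.

Lemma indep_repr I : I \subset nonloops N -> {in I &, injective rho} ->
  indep N I = indep N (rho @: I).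
Proof. by move=> sI injI; rewrite !indep_rank repr_rank // card_in_imset. Qed.

Lemma repr_sub I : I \subset nonloops N -> rho @: I \subset R.
Proof.
by move=> sI; apply/subsetP => _ /imsetP[x xI ->]; case: (rhoP (subsetP sI x xI)).
Qed.
End Simple.

Section Components.
Variables (T : finType) (N : matroid T).
Let M := simplification N.
Let R := ground M.

Lemma simplification_indep (I : {set T}) : I \subset R -> indep M I = indep N I.
Proof.
by move=> sI; rewrite /M /simplification /= /restrict_indep /= (subset_trans sI) // subsetIr.
Qed.

Lemma simplification_circuit (C : {set T}) : C \in circuits M -> C \in circuits N.
Proof.
move=> cC; have sC := circuit_ground cC; case/circuitP: cC => _ d h.
apply/circuitP; split; first exact: subset_trans sC (subsetIl _ _).
  by rewrite -simplification_indep.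
move=> x xC; rewrite -simplification_indep ?h //.
by apply: subset_trans sC; apply: subD1set.
Qed.

Lemma connected_equiv (L : matroid T) (A : {set T}) :
  {in A & &, equivalence_rel (connected_elts L)}.
Proof.
move=> x y z _ _ _; split; first exact: connected_refl.
move=> xy; apply/idP/idP; last exact: connected_trans.
by apply: connected_trans; rewrite connected_sym.
Qed.

Lemma components_partition : partition (components M) R.
Proof. exact: equivalence_partitionP (@connected_equiv M R). Qed.

Lemma component_connected X x y : X \in components M -> x \in X -> y \in X ->
  connected_elts M x y.
Proof.
move=> XM xX yX; have [/eqP cov tP _] := and3P components_partition.
have inR z : z \in X -> z \in R by move=> zX; rewrite -cov; apply/bigcupP; exists X.
have := pblock_equivalence_partition (@connected_equiv M R) (inR x xX) (inR y yX).
by rewrite -/(components M) (def_pblock tP XM xX) yX => <-.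
Qed.

Lemma component_sub X : X \in components M -> X \subset R.
Proof. by have [/eqP <- _ _] := and3P components_partition; apply: bigcup_sup. Qed.

Lemma component_circuit X C x : X \in components M -> C \in circuits M ->
  x \in C -> x \in X -> C \subset X.
Proof.
move=> XM cC xC xX; have [/eqP cov tP _] := and3P components_partition.
have CR := subsetP (circuit_ground cC); apply/subsetP => y yC.
rewrite -(def_pblock tP XM xX) pblock_equivalence_partition ?CR //; last exact: connected_equiv.
by rewrite /connected_elts /=; apply/orP; right; apply/exists_inP; exists C; rewrite ?xC.
Qed.

(** A circuit lies within one component, so the simplification is the direct sum of its
    components. *)
Lemma indep_components (I : {set T}) : I \subset R ->
  indep N I = [forall X in components M, indep N (I :&: X)].
Proof.
move=> sI; apply/idP/forall_inP => [iI X _|h].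
  by apply: indepS iI; apply: subsetIl.
rewrite -simplification_indep //; apply: contraT => dI.
have [|C cC sC] := @dependent_circuit _ M I; first by rewrite /dependent sI.
have [x xC] := circuit_neq0 cC.
have [/eqP cov _ _] := and3P components_partition.
have /bigcupP[X XM xX] : x \in cover (components M).
  by rewrite cov (subsetP (circuit_ground cC)).
have sCX := component_circuit XM cC xC xX.
have /circuitP[_ /negP[]] := simplification_circuit cC.
by apply: indepS (h X XM); rewrite subsetI sC.
Qed.

Lemma shape_ext (L L' : matroid T) S P : ground L = ground L' ->
  (forall I : {set T}, I \subset ground L -> indep L I = indep L' I) ->
  has_shape L S P -> has_shape L' S P.
Proof.
move=> eG eI [tP cP dSP gL hL]; rewrite /has_shape -eG; split=> // I sI.
by rewrite -eI // hL.
Qed.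

Lemma component_ground X : X \in components M -> ground (restrict M X) = X.
Proof. by move=> XM; apply/setIidPr; apply: component_sub. Qed.

Lemma component_indep X (I : {set T}) : X \in components M -> I \subset X ->
  indep (restrict M X) I = indep N I.
Proof.
move=> XM sI; rewrite /= /restrict_indep /= sI /=; apply: simplification_indep.
exact: subset_trans sI (component_sub XM).
Qed.

Lemma component_rank X : X \in components M -> rank (restrict M X) X = rank N X.
Proof.
move=> XM; apply/eqP; rewrite eqn_leq; apply/andP; split; apply: rank_le => I sI iI.
  by apply: rank_ge => //; rewrite -(component_indep XM sI).
by apply: rank_ge => //; rewrite component_indep.
Qed.
End Components.

(** * Laminar and ternary matroids exclude the minors *)

(** The family and its capacities are pulled back along the isomorphism, so that laminarity can be
    tested on the ground set of [M] itself. An empty ground set has no point to define the map with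
    and gets the empty family. *)
Lemma laminarP (T : finType) (M : matroid T) : laminar M <->
  exists (A : {set {set T}}) (c : {set T} -> nat), laminar_family (ground M) A
    /\ forall I : {set T}, I \subset ground M ->
         indep M I = [forall X in A, #|I :&: X| <= c X].
Proof.
split=> [[U [E [A [c [lamA iso]]]]]|[A [c [lamA hM]]]]; last first.
  exists T, (ground M), A, c, lamA; apply: (iso_via_isomorphic (f := id)).
  split; [by move=> x y _ _| exact: imset_id|].
  by move=> I sI; rewrite imset_id /= /laminar_indep /= sI hM.
have [M0|[t0 t0M]] := set_0Vmem (ground M).
  exists set0, (fun=> 0); split.
    by apply/andP; split; apply/forall_inP => X; rewrite inE.
  move=> I; rewrite M0 subset0 => /eqP->; rewrite indep0.
  by apply/esym/forall_inP => X; rewrite inE.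
have [u0 _] : exists _ : U, True.
  by case: (iso) => f _; exists (val (f (Sub t0 t0M))).
have [f [injf imf hI]] := isomorphic_via u0 iso.
case/andP: (lamA) => /forall_inP sA /forall_inP lA.
pose pre (X : {set U}) := [set x in ground M | f x \in X].
have preK X : X \in A -> f @: pre X = X.
  move=> XA; apply/setP => y; apply/imsetP/idP => [[x + ->]|yX].
    by rewrite inE => /andP[].
  have /imsetP[x xM ey] : y \in f @: ground M by rewrite imf; apply: (subsetP (sA X XA)).
  by exists x => //; rewrite inE xM -ey.
have cpre (I : {set T}) (Y : {set U}) : I \subset ground M -> #|I :&: pre Y| = #|f @: I :&: Y|.
  move=> sI; have <- : f @: (I :&: pre Y) = f @: I :&: Y.
    apply/setP => y; rewrite !inE; apply/imsetP/andP => [[x]|[/imsetP[x xI ->] fxY]].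
      by rewrite !inE => /and3P[xI _ fxY] ->; rewrite imset_f.
    by exists x => //; rewrite !inE xI (subsetP sI).
  apply/esym/card_in_imset; apply: sub_in2 injf => x; rewrite inE => /andP[xI _].
  exact: (subsetP sI).
exists (pre @: A), (fun Y : {set T} => c (f @: Y)); split.
  apply/andP; split.
    by apply/forall_inP => _ /imsetP[X XA ->]; apply/subsetP => x; rewrite inE => /andP[].
  apply/forall_inP => _ /imsetP[X XA ->]; apply/forall_inP => _ /imsetP[Y YA ->].
  apply/implyP => /set0Pn[x]; rewrite !inE => /andP[/andP[_ xX] /andP[_ xY]].
  have XY : X :&: Y != set0 by apply/set0Pn; exists (f x); rewrite inE xX.
  have := lA X XA; move/forall_inP => /(_ Y YA); rewrite XY /=.
  have mono (X' Y' : {set U}) : X' \subset Y' -> pre X' \subset pre Y'.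
    by move=> s; apply/subsetP => z; rewrite !inE => /andP[-> /(subsetP s)].
  by case/orP=> /mono ->; rewrite ?orbT.
move=> I sI; rewrite -hI //= /laminar_indep /=.
have -> : f @: I \subset E by rewrite -[E]imf imsetS.
apply/forall_inP/forall_inP => h.
  by move=> _ /imsetP[X XA ->]; rewrite cpre // preK // h.
by move=> X XA; rewrite -cpre // -[X in c X]preK // h // imset_f.
Qed.

(** Each triangle of [Y_3] lifts to a circuit lying inside a member of the family that it overfills.
    The two members share the image of the common point, so they are nested. Inside the larger one,
    a point of its own triangle can be swapped for a point of the other triangle: the result is
    independent in [Y_3] but overfills the same member. *)
Lemma laminar_noY3 (T : finType) (M : matroid T) : laminar M -> ~ has_minor M Y3.
Proof.
move=> /laminarP[A [c [/andP[_ /forall_inP lA] hM]]].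
move=> /(has_minor_config Y3_ground ord0)[C [f [iC [injf fC fM hI]]]].
have sM (J : {set 'I_5}) : C :|: f @: J \subset ground M.
  rewrite subUset (indep_ground iC); apply/subsetP => _ /imsetP[i _ ->]; exact: fM.
(* A violated member [X] contains the whole circuit [D], since dropping a point outside [X] would
   keep the violation. Minimal dependence of [J] puts all of its image in [D]. *)
have key (J : {set 'I_5}) : ~~ indep Y3 J -> {in J, forall i, indep Y3 (J :\ i)} ->
    exists D X : {set T}, [/\ X \in A, D \subset C :|: f @: J, {in J, forall i, f i \in D}, D \subset X
      & c X < #|D|].
  move=> dJ hJ; have [|D cD sD] := @dependent_circuit _ M (C :|: f @: J).
    by rewrite /dependent sM -hI.
  have [sDM dD hD] := circuitP _ _ cD.
  have /forall_inPn[X XA] : ~~ [forall X in A, #|D :&: X| <= c X] by rewrite -hM.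
  rewrite -ltnNge => gt; exists D, X.
  have DX : D \subset X.
    apply: contraT => /subsetPn[x xD xX].
    have := hD x xD; rewrite hM; last exact: subset_trans (subD1set _ _) sDM.
    move/forall_inP => /(_ X XA); rewrite leqNgt.
    suff -> : (D :\ x) :&: X = D :&: X by rewrite gt.
    by apply/setP => y; rewrite !inE; case: (eqVneq y x) => [->|] //; rewrite (negbTE xX) !andbF.
  split=> //; last by move: gt; rewrite (setIidPl DX).
  move=> i iJ; apply: contraR dD => fiD.
  have := hJ i iJ; rewrite hI; apply: indepS; apply/subsetP => x xD.
  move: (subsetP sD x xD); rewrite !inE => /orP[->//|/imsetP[j jJ ex]].
  apply/orP; right; apply/imsetP; exists j => //; rewrite !inE jJ andbT.
  by apply: contraNneq fiD => <-; rewrite -ex.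
pose o0 := @Ordinal 5 0 isT; pose o1 := @Ordinal 5 1 isT; pose o2 := @Ordinal 5 2 isT.
pose o3 := @Ordinal 5 3 isT; pose o4 := @Ordinal 5 4 isT.
(* Trading [f j] for [f i] keeps the size and stays inside [X], so the capacity is still
   exceeded. *)
have swap (D X : {set T}) (J : {set 'I_5}) i j : X \in A -> D \subset C :|: f @: J -> D \subset X ->
    c X < #|D| -> i \notin J -> f j \in D -> f i \in X -> indep Y3 (i |: (J :\ j)) -> False.
  move=> XA sD DX gt iJ jD iX iY.
  have iD : f i \notin D.
    apply/negP => /(subsetP sD); rewrite inE (negbTE (fC i)) /=.
    by case/imsetP=> k kJ /injf e; rewrite e kJ in iJ.
  have sE : f i |: (D :\ f j) \subset C :|: f @: (i |: (J :\ j)).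
    rewrite subUset sub1set inE imset_f ?setU11 ?orbT //=; apply/subsetP => x.
    case/setD1P=> xj /(subsetP sD); rewrite !inE => /orP[->//|/imsetP[k kJ ex]].
    apply/orP; right; apply/imsetP; exists k; rewrite // !inE kJ andbT.
    by apply/orP; right; apply: contraNneq xj => <-; rewrite ex.
  have iE : indep M (f i |: (D :\ f j)) by apply: indepS sE _; rewrite -hI.
  have := iE; rewrite hM ?(indep_ground iE) // => /forall_inP/(_ X XA).
  rewrite (setIidPl _) ?subUset ?sub1set ?iX ?(subset_trans (subD1set _ _)) //.
  rewrite cardsU1 !inE (negbTE iD) andbF /=; move: gt; rewrite (cardsD1 (f j) D) jD.
  by move=> h1 h2; have := leq_ltn_trans h2 h1; rewrite ltnn.
have [||D1 [X1 [X1A sD1 fD1 DX1 gt1]]] := key [set o0; o1; o2].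
- by rewrite Y3_indep_mem card_ord5 !inE.
- by move=> i; rewrite !inE -orbA => /or3P[] /eqP->; rewrite Y3_indep_mem card_ord5 !inE.
have [||D2 [X2 [X2A sD2 fD2 DX2 gt2]]] := key [set o2; o3; o4].
- by rewrite Y3_indep_mem card_ord5 !inE.
- by move=> i; rewrite !inE -orbA => /or3P[] /eqP->; rewrite Y3_indep_mem card_ord5 !inE.
have X12 : X1 :&: X2 != set0.
  apply/set0Pn; exists (f o2); rewrite inE (subsetP DX1) ?(subsetP DX2) //.
    by apply: fD2; rewrite !inE eqxx.
  by apply: fD1; rewrite !inE eqxx orbT.
have f2 i : i \in [set o2; o3; o4] -> f i \in X2 by move=> /fD2; apply: (subsetP DX2).
have f1 i : i \in [set o0; o1; o2] -> f i \in X1 by move=> /fD1; apply: (subsetP DX1).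
have := lA X1 X1A; move/forall_inP => /(_ X2 X2A); rewrite X12 /= => /orP[s12|s21].
  apply: (swap D2 X2 [set o2; o3; o4] o0 o4) => //.
  - by rewrite !inE.
  - by apply: fD2; rewrite !inE.
  - by apply: (subsetP s12); apply: f1; rewrite !inE.
  by rewrite Y3_indep_mem card_ord5 !inE.
apply: (swap D1 X1 [set o0; o1; o2] o3 o1) => //.
- by rewrite !inE.
- by apply: fD1; rewrite !inE.
- by apply: (subsetP s21); apply: f2; rewrite !inE.
by rewrite Y3_indep_mem card_ord5 !inE.
Qed.

Import GRing.Theory.

(** * Vectors over the field with three elements, modulo a subspace *)

Section Ternary.
Local Open Scope ring_scope.

Lemma F3P (a : 'F_3) : [\/ a = 0, a = 1 | a = -1].
Proof.
case: a => [[|[|[|a]]] lta] //; [constructor 1|constructor 2|constructor 3]; exact: val_inj.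
Qed.

Lemma F3_neq0 (a : 'F_3) : a != 0 -> a = 1 \/ a = -1.
Proof. by case: (F3P a) => ->; [rewrite eqxx | left | right]. Qed.

Variables (m : nat).
Implicit Types (W : {vspace 'rV['F_3]_m}) (x y z w : 'rV['F_3]_m).

Lemma mem_add_line W x y :
  reflect (exists2 w, w \in W & exists k, x = w + k *: y) (x \in W + <[y]>)%VS.
Proof.
apply: (iffP memv_addP) => [[w wW [_ /vlineP[k ->] ->]]|[w wW [k ->]]].
  by exists w => //; exists k.
by exists w => //; exists (k *: y); rewrite ?memvZ ?memv_line.
Qed.

(* Over F_3 the nonzero ratios are 1 and -1, so two of any three agree. *)
Lemma F3_pigeonhole (u v w : 'F_3) : u != 0 -> v != 0 -> w != 0 ->
  [\/ u = v, u = w | v = w].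
Proof.
move=> /F3_neq0[]-> /F3_neq0[]-> /F3_neq0[]->;
  by [constructor 1 | constructor 2 | constructor 3].
Qed.

(** A projective line over [F_3] has only four points. Modulo [W], the last three vectors have both
    coordinates nonzero with respect to the first two, so two of them have the same ratio of
    coordinates and are parallel. *)
Lemma line5 W (x : nat -> 'rV['F_3]_m) :
  (forall i j, (i < 5)%N -> (j < 5)%N -> i != j -> x i \notin (W + <[x j]>)%VS) ->
  (forall i, (1 < i < 5)%N -> x i \in (W + <[x 0%N]> + <[x 1%N]>)%VS) -> False.
Proof.
move=> hn hs.
have co k : (1 < k < 5)%N -> exists w a b,
    [/\ w \in W, a != 0, b != 0 & x k = w + a *: x 0%N + b *: x 1%N].
  move=> /[dup] k1 /hs /mem_add_line[z /mem_add_line[w wW [a ->]] [b e]].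
  case/andP: k1 => k1 k5.
  exists w, a, b; split=> //.
    apply: contraNneq (hn k 1%N k5 isT _); last by rewrite neq_ltn k1 orbT.
    by move=> a0; apply/mem_add_line; exists w => //; exists b; rewrite e a0 scale0r addr0.
  apply: contraNneq (hn k 0%N k5 isT _); last by rewrite neq_ltn (ltnW k1) orbT.
  by move=> b0; apply/mem_add_line; exists w => //; exists a; rewrite e b0 scale0r addr0.
(* The product [a * b] stands for the ratio of [b] to [a], since nonzero squares equal one. *)
have same k l : (1 < k < 5)%N -> (1 < l < 5)%N -> k != l -> forall wk wl a b a' b',
    wk \in W -> wl \in W -> x k = wk + a *: x 0%N + b *: x 1%N ->
    x l = wl + a' *: x 0%N + b' *: x 1%N -> a != 0 -> a' != 0 -> a * b = a' * b' -> False.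
  move=> /andP[_ k5] /andP[_ l5] kl wk wl a b a' b' wkW wlW ek el a0 a'0 eab.
  have /negP := hn k l k5 l5 kl; apply; apply/mem_add_line.
  exists (wk - (a * a') *: wl); first by rewrite memvB // memvZ.
  exists (a * a'); rewrite ek el.
  have eb : b = a * a' * b'.
    have a2 : a * a = 1 by case: (F3_neq0 a0) => ->; rewrite ?mulr1 // mulrNN mulr1.
    by rewrite -mulrA -eab mulrA a2 mul1r.
  have ea : a = a * a' * a'.
    have a2 : a' * a' = 1 by case: (F3_neq0 a'0) => ->; rewrite ?mulr1 // mulrNN mulr1.
    by rewrite -mulrA a2 mulr1.
  by rewrite !scalerDr !scalerA -eb -ea addrA addrA subrK.
have [w2 [a2 [b2 [w2W a20 b20 e2]]]] := co 2%N isT.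
have [w3 [a3 [b3 [w3W a30 b30 e3]]]] := co 3%N isT.
have [w4 [a4 [b4 [w4W a40 b40 e4]]]] := co 4%N isT.
have [] := F3_pigeonhole (mulf_neq0 a20 b20) (mulf_neq0 a30 b30) (mulf_neq0 a40 b40).
- exact: (same 2%N 3%N _ _ _ w2 w3).
- exact: (same 2%N 4%N _ _ _ w2 w4).
- exact: (same 3%N 4%N _ _ _ w3 w4).
Qed.

(** Modulo [W], both [x3] and [x4] have three nonzero coordinates. Two of the three coordinatewise
    ratios agree, so subtracting a multiple of [x4] from [x3] kills two coordinates at once. *)
Lemma plane5 W (x0 x1 x2 x3 x4 : 'rV['F_3]_m) :
  x3 \in (W + <[x0]> + <[x1]> + <[x2]>)%VS -> x4 \in (W + <[x0]> + <[x1]> + <[x2]>)%VS ->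
  x3 \notin (W + <[x0]> + <[x1]>)%VS -> x3 \notin (W + <[x0]> + <[x2]>)%VS ->
  x3 \notin (W + <[x1]> + <[x2]>)%VS ->
  x4 \notin (W + <[x0]> + <[x1]>)%VS -> x4 \notin (W + <[x0]> + <[x2]>)%VS ->
  x4 \notin (W + <[x1]> + <[x2]>)%VS ->
  x3 \notin (W + <[x0]> + <[x4]>)%VS -> x3 \notin (W + <[x1]> + <[x4]>)%VS ->
  x3 \notin (W + <[x2]> + <[x4]>)%VS -> False.
Proof.
move=> h3 h4 n301 n302 n312 n401 n402 n412 n304 n314 n324.
have co x : x \in (W + <[x0]> + <[x1]> + <[x2]>)%VS ->
  x \notin (W + <[x0]> + <[x1]>)%VS -> x \notin (W + <[x0]> + <[x2]>)%VS ->
  x \notin (W + <[x1]> + <[x2]>)%VS -> exists w a b c,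
    [/\ w \in W, a != 0, b != 0, c != 0 & x = w + a *: x0 + b *: x1 + c *: x2].
  move=> /mem_add_line[z' /mem_add_line[z /mem_add_line[w wW [a ->]] [b ->]] [c e]].
  move=> n01 n02 n12; exists w, a, b, c; split=> //.
  - apply: contraNneq n12 => a0; apply/mem_add_line; exists (w + b *: x1); last first.
      by exists c; rewrite e a0 scale0r addr0.
    by apply/mem_add_line; exists w => //; exists b.
  - apply: contraNneq n02 => b0; apply/mem_add_line; exists (w + a *: x0); last first.
      by exists c; rewrite e b0 scale0r addr0.
    by apply/mem_add_line; exists w => //; exists a.
  apply: contraNneq n01 => c0; apply/mem_add_line; exists (w + a *: x0); last first.
    by exists b; rewrite e c0 scale0r addr0.
  by apply/mem_add_line; exists w => //; exists a.
have [w [a [b [c [wW a0 b0 c0 e3]]]]] := co x3 h3 n301 n302 n312.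
have [w' [a' [b' [c' [w'W a'0 b'0 c'0 e4]]]]] := co x4 h4 n401 n402 n412.
have sq (t : 'F_3) : t != 0 -> t * t = 1.
  by move=> /F3_neq0[] ->; rewrite ?mulr1 // mulrNN mulr1.
have key (s t s' t' u u' : 'F_3) y z v : s != 0 -> s' != 0 -> t != 0 -> t' != 0 ->
    x3 = w + s *: y + t *: z + u *: v -> x4 = w' + s' *: y + t' *: z + u' *: v ->
    s * s' = t * t' -> x3 \in (W + <[v]> + <[x4]>)%VS.
  move=> s0 s'0 t0 t'0 ex3 ex4 est; apply/mem_add_line.
  exists ((w - (s * s') *: w') + (u - (s * s') * u') *: v).
    apply/mem_add_line; exists (w - (s * s') *: w'); first by rewrite memvB // memvZ.
    by exists (u - (s * s') * u').
  exists (s * s'); rewrite ex3 ex4.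
  have es : s * s' * s' = s by rewrite -mulrA sq // mulr1.
  have et : s * s' * t' = t by rewrite est -mulrA sq // mulr1.
  rewrite !scalerDr !scalerA es et scalerBl.
  by apply/rowP => j; rewrite !mxE; ring.
have [] := F3_pigeonhole (mulf_neq0 a0 a'0) (mulf_neq0 b0 b'0) (mulf_neq0 c0 c'0) => e.
- by case/negP: n324; apply: (key a b a' b' c c' x0 x1).
- case/negP: n314; apply: (key a c a' c' b b' x0 x2) => //.
    by rewrite e3 addrAC.
  by rewrite e4 addrAC.
case/negP: n304; apply: (key b c b' c' a a' x1 x2) => //.
  by rewrite e3; apply/rowP => j; rewrite !mxE; ring.
by rewrite e4; apply/rowP => j; rewrite !mxE; ring.
Qed.
End Ternary.

Section TernaryMinor.
Variables (T : finType) (M : matroid T) (m : nat) (v : T -> 'rV['F_3]_m).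
Hypothesis hv : forall I : {set T}, I \subset ground M -> indep M I = free [seq v x | x in I].

(** Contracting [C] amounts to passing to the quotient by [span_of C]; [line5] and [plane5] work
    modulo that subspace instead of forming the quotient. *)
Definition span_of (I : {set T}) := <<[seq v x | x in I]>>%VS.

Lemma perm_enumU1 (x : T) (I : {set T}) : x \notin I -> perm_eq (enum (x |: I)) (x :: enum I).
Proof.
move=> xI; apply: uniq_perm; rewrite ?enum_uniq //=; first by rewrite mem_enum xI enum_uniq.
by move=> y; rewrite mem_enum !inE mem_enum.
Qed.

Lemma span_ofU1 x (I : {set T}) : span_of (x |: I) = (span_of I + <[v x]>)%VS.
Proof.
rewrite addvC -span_cons; apply: eq_span => y; rewrite inE; apply/imageP/predU1P.
  by case=> z /setU1P[->|zI] ->; [left | right; apply/imageP; exists z].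
by case=> [->|/imageP[z zI ->]]; [exists x; rewrite ?setU11 | exists z; rewrite // setU1r].
Qed.

Lemma indep_span x (I : {set T}) : x \in ground M -> x \notin I -> indep M I ->
  indep M (x |: I) = (v x \notin span_of I).
Proof.
move=> xM xI iI; have sI := indep_ground iI.
rewrite hv ?subUset ?sub1set ?xM // /image_mem.
rewrite (perm_free (perm_map v (perm_enumU1 xI))) free_cons.
by rewrite [X in _ && X](_ : _ = true) ?andbT // -hv.
Qed.

Variables (U : matroid 'I_5) (C : {set T}) (f : 'I_5 -> T).
Hypothesis cfg : minor_config M U C f.

Lemma config_span i (J : {set 'I_5}) : indep U J -> i \notin J ->
  indep U (i |: J) = (v (f i) \notin span_of (C :|: f @: J)).
Proof.
case: cfg => injf fC fM hI; rewrite !hI imsetU1 setUCA => iJ iJ'; apply: indep_span => //.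
rewrite inE (negbTE (fC i)) /=; apply: contra iJ' => /imsetP[j jJ /injf ->]; exact: jJ.
Qed.

Lemma span_config1 j : span_of (C :|: f @: [set j]) = (span_of C + <[v (f j)]>)%VS.
Proof. by rewrite imset_set1 setUC span_ofU1. Qed.

Lemma span_configU1 i (J : {set 'I_5}) :
  span_of (C :|: f @: (i |: J)) = (span_of (C :|: f @: J) + <[v (f i)]>)%VS.
Proof. by rewrite imsetU1 setUCA span_ofU1. Qed.
End TernaryMinor.

Lemma ternary_noU25 (T : finType) (M : matroid T) :
  ternary M -> ~ has_minor M (uniform 2 5).
Proof.
move=> [m [v hv]] /(@has_minor_config _ _ _ (uniform 2 5) erefl ord0)[C [f [iC cfg]]].
have iU (J : {set 'I_5}) : indep (uniform 2 5) J = (#|J| <= 2).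
  by rewrite /= /uniform_indep /= subsetT.
apply: (@line5 m (span_of v C) (fun k => v (f (inord k)))) => [i j i5 j5 ij|i /andP[i1 i5]].
  rewrite -span_config1 -(config_span hv cfg) ?iU ?cards1 //.
    by rewrite cardsU1 cards1; case: (_ \notin _).
  by rewrite !inE -val_eqE /= !inordK.
rewrite -span_config1 -span_configU1; apply: contraT; rewrite -(config_span hv cfg).
- by rewrite iU !cardsU1 cards1 !inE -!val_eqE /= !inordK //; move: i1; case: i i5 => [|[|i]].
- by rewrite iU cardsU1 cards1; case: (_ \notin _).
by rewrite !inE -!val_eqE /= !inordK //; move: i1; case: i i5 => [|[|i]].
Qed.

Lemma ternary_noU35 (T : finType) (M : matroid T) :
  ternary M -> ~ has_minor M (uniform 3 5).
Proof.
move=> [m [v hv]] /(@has_minor_config _ _ _ (uniform 3 5) erefl ord0)[C [f [iC cfg]]].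
have iU (J : {set 'I_5}) : indep (uniform 3 5) J = (#|J| <= 3).
  by rewrite /= /uniform_indep /= subsetT.
pose o k : 'I_5 := inord k.
have n3 i j k : uniq [:: i; j; k] -> v (f i) \notin (span_of v C + <[v (f j)]> + <[v (f k)]>)%VS.
  move=> u; rewrite -span_config1 -span_configU1 -(config_span hv cfg).
  - by rewrite iU !cardsU1 cards1; do 2!case: (_ \notin _).
  - by rewrite iU cardsU1 cards1; case: (_ \notin _).
  by move: u; rewrite /= !inE; case/and3P=> + _ _; rewrite orbC.
have d4 i j k l : uniq [:: i; j; k; l] ->
    v (f i) \in (span_of v C + <[v (f j)]> + <[v (f k)]> + <[v (f l)]>)%VS.
  move=> u; rewrite -span_config1 -!span_configU1; apply: contraT.
  rewrite -(config_span hv cfg).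
  - move: u; rewrite iU !cardsU1 cards1 /= !inE !negb_or => /and4P[/and3P[ij ik il] /andP[jk jl] kl _].
    by rewrite il ik ij [l == k]eq_sym kl [l == j]eq_sym jl [k == j]eq_sym jk.
  - by rewrite iU !cardsU1 cards1; do 2!case: (_ \notin _).
  move: u; rewrite /= !inE !negb_or => /and4P[/and3P[ij ik il] _ _ _].
  by rewrite il ik ij.
apply: (@plane5 m (span_of v C) (v (f (o 0))) (v (f (o 1))) (v (f (o 2))) (v (f (o 3))) (v (f (o 4))));
  by [apply: n3; rewrite /= !inE -!val_eqE /= !inordK | apply: d4; rewrite /= !inE -!val_eqE /= !inordK].
Qed.

(** * Laminarity and ternarity from the components *)

Section Code.
Local Open Scope ring_scope.
Variable F : finFieldType.

Lemma free_image (T : finType) (m : nat) (v : T -> 'rV[F]_m) (J : {set T}) :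
  free [seq v x | x in J] <->
  (forall g : T -> F, \sum_(x in J) g x *: v x = 0 -> {in J, forall x, g x = 0}).
Proof.
have e (g : T -> F) : \sum_(x in J) g x *: v x =
    \sum_(i < #|J|) g (enum_val i) *: (image_tuple v J)`_i.
  by rewrite (big_enum_val (fun x => g x *: v x)); apply: eq_bigr => i _; rewrite nth_image.
split=> [/(@freeP _ _ _ (image_tuple v J)) h g g0 x xJ|h].
  by rewrite -(enum_rankK_in xJ xJ); apply: (h (fun i => g (enum_val i))); rewrite -e.
apply/(@freeP _ _ _ (image_tuple v J)) => k k0 i.
pose g x := if [pick j | enum_val j == x] is Some j then k j else 0.
have gE j : g (enum_val j) = k j.
  by rewrite /g; case: pickP => [j' /eqP/enum_val_inj->//|/(_ j)]; rewrite eqxx.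
rewrite -gE; apply: h (enum_valP i); rewrite e -[RHS]k0.
by apply: eq_bigr => j _; rewrite gE.
Qed.

(* The vectors are the coordinate vectors modulo the code. *)
Lemma code_representation (T : finType) (code : pred {ffun T -> F}) :
  code [ffun=> 0] -> (forall g h, code g -> code h -> code [ffun x => g x + h x]) ->
  (forall a g, code g -> code [ffun x => a * g x]) ->
  exists m (v : T -> 'rV[F]_m), forall J : {set T},
    free [seq v x | x in J] <->
    (forall g, code g -> (forall x, x \notin J -> g x = 0) -> {in J, forall x, g x = 0}).
Proof.
move=> c0 cD cZ.
pose vec (g : {ffun T -> F}) : 'rV[F]_#|T| := \row_i g (enum_val i).
pose fn (u : 'rV[F]_#|T|) : {ffun T -> F} := [ffun x => u 0 (enum_rank x)].
have vecK : cancel vec fn by move=> g; apply/ffunP => x; rewrite ffunE mxE enum_rankK.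
have fnK : cancel fn vec by move=> u; apply/rowP => i; rewrite mxE ffunE enum_valK.
pose A := [set g | code g].
(* All codewords are taken as rows, so no basis is chosen; closure of the code under combinations
   makes the row space the code itself. *)
pose G : 'M[F]_(#|A|, #|T|) := \matrix_(i < #|A|) vec (enum_val i).
have memG g : (vec g <= G)%MS = code g.
  apply/idP/idP => [/submxP[D eD]|cg].
    pose w r : {ffun T -> F} := [ffun x => \sum_(i <- r) D 0 i * (enum_val i : {ffun T -> F}) x].
    have cw r : code (w r).
      elim: r => [|i r IH].
        suff -> : w [::] = [ffun=> 0] by [].
        by apply/ffunP => x; rewrite !ffunE big_nil.
      have ci : code (enum_val i) by have := enum_valP i; rewrite inE.
      suff -> : w (i :: r) = [ffun x => [ffun y => D 0 i * (enum_val i : {ffun T -> F}) y] x + w r x].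
        exact: cD (cZ _ _ ci) IH.
      by apply/ffunP => x; rewrite !ffunE big_cons.
    suff -> : g = w (index_enum _) by [].
    rewrite -[LHS]vecK eD; apply/ffunP => x; rewrite !ffunE mxE.
    by apply: eq_bigr => i _; rewrite !mxE enum_rankK.
  have gA : g \in A by rewrite inE.
  have -> : vec g = row (enum_rank_in gA g) G by rewrite rowK enum_rankK_in.
  exact: row_sub.
(* A row vector is killed by [cokermx G] exactly when it lies in the row space of [G], so linear
   relations among the rows of [cokermx G] are the codewords. *)
exists #|T|, (fun x => row (enum_rank x) (cokermx G)) => J.
have sumE (g : T -> F) : (forall x, x \notin J -> g x = 0) ->
    \sum_(x in J) g x *: row (enum_rank x) (cokermx G) = vec (finfun g) *m cokermx G.
  move=> g0; rewrite mulmx_sum_row (reindex enum_rank) /=; last first.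
    by exists enum_val => x _; rewrite ?enum_rankK ?enum_valK.
  rewrite big_mkcond /=; apply: eq_bigr => x _; rewrite mxE ffunE enum_rankK.
  by case: ifP => // /negbT/g0 ->; rewrite scale0r.
split=> [/free_image h g cg g0 x xJ|h].
  apply: (h g) xJ; rewrite sumE //; apply/eqP; rewrite -submxE.
  by rewrite (_ : finfun g = g) ?memG //; apply/ffunP => y; rewrite ffunE.
apply/free_image => g sg x xJ.
pose g' : {ffun T -> F} := [ffun y => if y \in J then g y else 0].
have g'0 y : y \notin J -> g' y = 0 by rewrite ffunE => /negbTE->.
have := h g' _ g'0 x xJ; rewrite ffunE xJ; apply.
rewrite -memG submxE; apply/eqP.
have -> : g' = finfun g' by apply/ffunP => y; rewrite ffunE.
rewrite -sumE // -[RHS]sg; apply: eq_bigr => y yJ; by rewrite ffunE yJ.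
Qed.
End Code.

Section Assemble.
Variables (T : finType) (N : matroid T).
Let M := simplification N.
Let R := ground M.
Implicit Types (x y : T) (X Y Q I J B D : {set T}).
Variables (S : {set T} -> {set T}) (P : {set T} -> {set {set T}}) (b : {set T} -> bool).
(* [b X] marks the components of rank at most one, whose size is not bounded
   by the shape. *)
Hypothesis tP : {in components M, forall X, trivIset (P X)}.
Hypothesis P3 : {in components M, forall X, {in P X, forall B : {set T}, #|B| = 3}}.
Hypothesis dSP : {in components M, forall X, [disjoint S X & cover (P X)]}.
Hypothesis XE : {in components M, forall X, X = S X :|: cover (P X)}.
Hypothesis bP : {in components M, forall X, b X -> P X = set0}.
Hypothesis indX : {in components M, forall X, forall I : {set T}, I \subset X -> indep N I =
  [forall B in P X, #|I :&: B| <= 2] && (b X || (#|I| < #|S X| + 2 * #|P X|))}.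

Let comp_disj X Y x : X \in components M -> Y \in components M -> x \in X -> x \in Y -> X = Y.
Proof.
move=> XM YM xX xY; have [_ tr _] := and3P (components_partition N).
by rewrite -(def_pblock tr XM xX) (def_pblock tr YM xY).
Qed.

Let triple_sub X B : X \in components M -> B \in P X -> B \subset X.
Proof. by move=> XM BP; rewrite (XE XM); apply: subsetU; rewrite bigcup_sup ?orbT. Qed.

Let triple_disj X Y B D x : X \in components M -> Y \in components M ->
  B \in P X -> D \in P Y -> x \in B -> x \in D -> B = D.
Proof.
move=> XM YM BP DP xB xD.
have eXY := comp_disj XM YM (subsetP (triple_sub XM BP) x xB) (subsetP (triple_sub YM DP) x xD).
by rewrite -eXY in DP; rewrite -(def_pblock (tP XM) BP xB) (def_pblock (tP XM) DP xD).
Qed.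

Let inS X x : X \in components M -> x \in X ->
  x \in S X \/ exists2 B, B \in P X & x \in B.
Proof.
move=> XM; rewrite {1}(XE XM) inE => /orP[|/bigcupP[B BP xB]]; first by left.
by right; exists B.
Qed.

Let S_sub X : X \in components M -> S X \subset X.
Proof. by move=> XM; rewrite {2}(XE XM) subsetUl. Qed.

Let S_notin X B x : X \in components M -> B \in P X -> x \in S X -> x \notin B.
Proof.
move=> XM BP xS; have := disjointFr (dSP XM) xS; move/negbT; apply: contra.
exact/subsetP/bigcup_sup.
Qed.

Let triple_dep X B : X \in components M -> B \in P X -> rank N B <= 2.
Proof.
move=> XM BP; rewrite leqNgt; apply/negP => gt.
have : indep N B by rewrite indep_rank eqn_leq rank_card (P3 XM BP).
rewrite (indX XM) ?(triple_sub XM) // => /andP[/forall_inP/(_ B BP)].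
by rewrite setIid (P3 XM BP).
Qed.

Section Laminar.
Variable rho : T -> T.
Hypothesis rhoP : {in nonloops N, forall x, rho x \in R
  /\ spans N [set x] (rho x) /\ spans N [set rho x] x}.

Let pre (Q : {set T}) := [set x in nonloops N | rho x \in Q].

(** A laminar family on representatives: components, the triples inside them, and single points,
    whose preimages under [rho] are the parallel classes. *)
Let fam := [set Q : {set T} | [|| Q \in components M,
  [exists X in components M, Q \in P X] | [exists r in R, Q == [set r]]]].

Let fam_comp Q : Q \in fam -> exists2 X, X \in components M & Q \subset X.
Proof.
rewrite inE => /or3P[QM|/exists_inP[X XM QP]|/exists_inP[r rR /eqP->]].
- by exists Q.
- by exists X; rewrite ?triple_sub.
have [/eqP cov _ _] := and3P (components_partition N).
have /bigcupP[X XM rX] : r \in cover (components M) by rewrite cov.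
by exists X; rewrite ?sub1set.
Qed.

Let fam_lam Q Q' x : Q \in fam -> Q' \in fam -> x \in Q -> x \in Q' ->
  (Q \subset Q') || (Q' \subset Q).
Proof.
move=> QF Q'F xQ xQ'; have [X XM sX] := fam_comp QF; have [X' X'M sX'] := fam_comp Q'F.
have eX := comp_disj XM X'M (subsetP sX x xQ) (subsetP sX' x xQ').
move: QF Q'F; rewrite !inE => /or3P[QM|/exists_inP[Y YM QP]|/exists_inP[r rR /eqP eQ]] Q'F.
- by rewrite (comp_disj QM XM xQ (subsetP sX x xQ)) eX sX' orbT.
- case/or3P: Q'F => [Q'M|/exists_inP[Y' Y'M Q'P]|/exists_inP[r rR /eqP eQ']].
  + by rewrite (comp_disj Q'M X'M xQ' (subsetP sX' x xQ')) -eX sX.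
  + by rewrite (triple_disj YM Y'M QP Q'P xQ xQ') subxx.
  by move: xQ'; rewrite eQ' => /set1P <-; rewrite sub1set xQ orbT.
by move: xQ; rewrite eQ => /set1P <-; rewrite sub1set xQ'.
Qed.

Let rank_pre Q : rank N (pre Q) <= rank N Q.
Proof.
have sub : pre Q \subset nonloops N by apply/subsetP => x; rewrite inE => /andP[].
rewrite -(repr_rank rhoP sub) rankS //.
by apply/subsetP => _ /imsetP[x + ->]; rewrite inE => /andP[].
Qed.

Let card_pre (I Q : {set T}) : I \subset nonloops N -> {in I &, injective rho} ->
  #|rho @: I :&: Q| = #|I :&: pre Q|.
Proof.
move=> sI injI; have <- : rho @: (I :&: pre Q) = rho @: I :&: Q.
  apply/setP => y; rewrite inE; apply/imsetP/andP => [[x]|[/imsetP[x xI ->] xQ]].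
    by rewrite !inE => /and3P[xI _ xQ] ->; rewrite imset_f.
  by exists x => //; rewrite !inE xI xQ andbT; have := subsetP sI x xI; rewrite inE.
by apply: card_in_imset; apply: sub_in2 injI => x; rewrite inE => /andP[].
Qed.

(** With ranks as capacities, independent sets obey every bound automatically. Conversely the set of
    loops has capacity zero, parallel classes have capacity at most one, triples at most two, and a
    component governed by a size bound has capacity below that bound. *)
Lemma laminar_of_shapes : laminar N.
Proof.
have nonM : nonloops N \subset ground N.
  by apply/subsetP => x; rewrite inE => /indep_ground; rewrite sub1set.
apply/laminarP; exists ((ground N :\: nonloops N) |: (pre @: fam)), (rank N); split.
  have sA (X : {set T}) : X \in pre @: fam -> X \subset nonloops N.
    by case/imsetP=> Q _ ->; apply/subsetP => x; rewrite inE => /andP[].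
  apply/andP; split; apply/forall_inP => X /setU1P[->|XA].
  - exact: subsetDl.
  - exact: subset_trans (sA X XA) nonM.
  - apply/forall_inP => Y /setU1P[->|YA]; apply/implyP; first by rewrite subxx.
    move=> /set0Pn[x]; rewrite inE => /andP[/setDP[_ nx] /(subsetP (sA Y YA))].
    by rewrite (negbTE nx).
  apply/forall_inP => Y /setU1P[->|YA]; apply/implyP => /set0Pn[x].
    by rewrite inE => /andP[/(subsetP (sA X XA)) xN /setDP[_]]; rewrite xN.
  have [Q QF eX] := imsetP XA; have [Q' Q'F eY] := imsetP YA.
  rewrite eX eY !inE => /andP[/andP[_ xQ] /andP[_ xQ']].
  have mono (Z Z' : {set T}) : Z \subset Z' -> pre Z \subset pre Z'.
    by move=> s; apply/subsetP => z; rewrite !inE => /andP[-> /(subsetP s)].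
  by case/orP: (fam_lam QF Q'F xQ xQ') => /mono ->; rewrite ?orbT.
move=> I sI; apply/idP/forall_inP => [iI X _|h].
  exact: rank_ge (subsetIr _ _) (indepS (subsetIl _ _) iI).
have hF Q : Q \in fam -> #|I :&: pre Q| <= rank N Q.
  move=> QF; apply: leq_trans (rank_pre Q); apply: h.
  by rewrite setU1r // imset_f.
have sIN : I \subset nonloops N.
  apply: contraT => /subsetPn[x xI xN].
  have := h _ (setU11 _ _); have -> : rank N (ground N :\: nonloops N) = 0.
    apply/eqP; rewrite -leqn0; apply: rank_le => J sJ iJ; rewrite leqn0 cards_eq0.
    apply/eqP/setP => y; rewrite inE; apply/negP => yJ.
    by have := subsetP sJ y yJ; rewrite inE (subsetP (indep_nonloops iJ) y yJ).
  rewrite leqn0 cards_eq0 => /eqP/setP/(_ x).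
  by rewrite !inE xI (subsetP sI) // andbT; move: xN; rewrite inE => ->.
(* This is where the singletons of [fam] enter: [I] holds at most one point of each parallel
   class. *)
have injI : {in I &, injective rho}.
  move=> x y xI yI exy; have rR : rho x \in R by case: (rhoP (subsetP sIN x xI)).
  have /hF : [set rho x] \in fam.
    by rewrite inE; apply/or3P; constructor 3; apply/exists_inP; exists (rho x).
  move=> /leq_trans/(_ (rank_card _ _)); rewrite cards1 => /card_le1_eqP; apply.
    by rewrite !inE yI exy eqxx andbT; have := subsetP sIN y yI; rewrite inE.
  by rewrite !inE xI eqxx andbT; have := subsetP sIN x xI; rewrite inE.
rewrite (indep_repr rhoP sIN injI) (indep_components (repr_sub rhoP sIN)).
apply/forall_inP => X XM; rewrite (indX XM) ?subsetIr //; apply/andP; split.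
  apply/forall_inP => B BP; rewrite -setIA (setIidPr (triple_sub XM BP)) card_pre //.
  apply: leq_trans (triple_dep XM BP); apply: hF.
  by rewrite inE; apply/or3P; constructor 2; apply/exists_inP; exists X.
have [//|nb] := boolP (b X); rewrite card_pre //=.
apply: leq_ltn_trans (hF X _) _; first by rewrite inE XM.
have [J /andP[sJ iJ] ->] := rank_ex N X.
by move: iJ; rewrite (indX XM) // (negbTE nb) => /andP[].
Qed.
End Laminar.

Section Ternary.
Local Open Scope ring_scope.

(** Labels the points of a triple by the three elements of [F_3], which yields the coordinates [t],
    [t + l], [t + 2 l] of a tetracode word. *)
Let sigma B x : 'F_3 := (index x (enum B))%:R.

Let sigma_inj B : #|B| = 3%N -> {in B &, injective (sigma B)}.
Proof.
move=> B3 x y xB yB; rewrite /sigma.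
have lt z : z \in B -> (index z (enum B) < 3)%N by move=> zB; rewrite -B3 cardE index_mem mem_enum.
move=> exy; suff e : index x (enum B) = index y (enum B).
  have := congr1 (nth x (enum B)) e; rewrite nth_index ?mem_enum //.
  by rewrite nth_index ?mem_enum.
move: exy (lt x xB) (lt y yB); move: (index x _) (index y _).
by do 3?[case=> [|]]; do 3?[case=> [|]].
Qed.

(* The tetracode consists of the words [(l, t, t + l, t + 2 l)]; here [l] is the
   value at the basepoint of a triple. *)
Let code_of (l t : {ffun {set T} -> 'F_3}) (g : T -> 'F_3) :=
  [forall X in components M,
    [forall s in S X, g s == if b X then 0 else l X]
    && [forall B in P X, [forall x in B, g x == t B + l X * sigma B x]]].

Let code : pred {ffun T -> 'F_3} := [pred g : {ffun T -> 'F_3} | [exists l, exists t, code_of l t g]].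

Let codeP (g : {ffun T -> 'F_3}) : reflect (exists l t : {ffun {set T} -> 'F_3}, forall X, X \in components M ->
    {in S X, forall s, g s = if b X then 0 else l X}
    /\ {in P X, forall B, {in B, forall x, g x = t B + l X * sigma B x}}) (code g).
Proof.
apply: (iffP existsP) => [[l /existsP[t /forall_inP h]]|[l [t h]]].
  exists l, t => X /h /andP[/forall_inP h1 /forall_inP h2]; split=> [s /h1/eqP//|B BP x xB].
  by apply/eqP; have /forall_inP := h2 B BP; apply.
exists l; apply/existsP; exists t; apply/forall_inP => X /h[h1 h2]; apply/andP; split.
  by apply/forall_inP => s /h1/eqP.
by apply/forall_inP => B BP; apply/forall_inP => x xB; apply/eqP; apply: h2.
Qed.

Let code0 : code [ffun=> 0].
Proof.
apply/codeP; exists [ffun=> 0], [ffun=> 0] => X _.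
split=> [s _|B _ x _]; rewrite !ffunE ?if_same //; by rewrite mul0r addr0.
Qed.

Let codeD (g h : {ffun T -> 'F_3}) : code g -> code h -> code [ffun x => g x + h x].
Proof.
move=> /codeP[l [t hg]] /codeP[l' [t' hh]]; apply/codeP.
exists [ffun X => l X + l' X], [ffun B => t B + t' B] => X XM.
have [[g1 g2] [h1 h2]] := (hg X XM, hh X XM); split=> [s sS|B BP x xB]; rewrite !ffunE.
  by rewrite g1 // h1 //; case: (b X); rewrite ?addr0.
by rewrite (g2 B BP) // (h2 B BP) //; ring.
Qed.

Let codeZ a (g : {ffun T -> 'F_3}) : code g -> code [ffun x => a * g x].
Proof.
move=> /codeP[l [t hg]]; apply/codeP.
exists [ffun X => a * l X], [ffun B => a * t B] => X XM.
have [g1 g2] := hg X XM; split=> [s sS|B BP x xB]; rewrite !ffunE.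
  by rewrite g1 //; case: (b X); rewrite ?mulr0.
by rewrite (g2 B BP) //; ring.
Qed.

Let card_split X J : X \in components M ->
  #|J :&: X| = (#|J :&: S X| + \sum_(B in P X) #|J :&: B|)%N.
Proof.
move=> XM; rewrite -(card_cover _ (tP XM)) {1}(XE XM) setIUr cardsU setIACA setIid.
by rewrite (disjoint_setI0 (dSP XM)) setI0 cards0 subn0.
Qed.

(** If [l X] is nonzero, the word vanishes nowhere on [S X] and at most once on each triple, so [J]
    reaches the forbidden size in [X]. If [l X] is zero, the word is constant on each triple, and
    every triple has a point outside [J]. *)
Let code_indep J : J \subset R -> indep N J -> forall g : {ffun T -> 'F_3}, code g ->
  (forall x, x \notin J -> g x = 0) -> {in J, forall x, g x = 0}.
Proof.
move=> sJ iJ g /codeP[l [t hg]] g0 x xJ.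
have [/eqP cov _ _] := and3P (components_partition N).
have /bigcupP[X XM xX] : x \in cover (components M) by rewrite cov (subsetP sJ).
have [g1 g2] := hg X XM.
have : indep N (J :&: X) by apply: indepS iJ; apply: subsetIl.
rewrite (indX XM) ?subsetIr // => /andP[/forall_inP J2 ltJ].
have {}J2 B : B \in P X -> (#|J :&: B| <= 2)%N.
  by move=> BP; have := J2 B BP; rewrite -setIA (setIidPr (triple_sub XM BP)).
have [bX|nb] := boolP (b X).
  have [xS|[B]] := inS XM xX; last by rewrite (bP XM bX) inE.
  by rewrite g1 // bX.
rewrite (negbTE nb) /= in ltJ g1.
have l0 : l X = 0.
  apply/eqP; apply: contraLR ltJ => l0; rewrite -leqNgt card_split //; apply: leq_add.
    rewrite subset_leq_card // subsetI subxx andbT; apply/subsetP => s sS.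
    by apply: contraR l0 => /g0; rewrite g1 // => ->.
  rewrite mulnC -sum_nat_const; apply: leq_sum => B BP.
  have := cardsID J B; rewrite (P3 XM BP) setIC.
  suff : (#|B :\: J| <= 1)%N by clear; lia.
  apply/card_le1_eqP => y z /setDP[yB yJ] /setDP[zB zJ].
  apply: (sigma_inj (P3 XM BP)) => //; apply: (mulfI l0); apply: (addrI (t B)).
  by rewrite -(g2 B BP y yB) -(g2 B BP z zB) !g0.
have [xS|[B BP xB]] := inS XM xX; first by rewrite g1.
have /subsetPn[y yB yJ] : ~~ (B \subset J).
  by apply/negP => BJ; have := J2 B BP; rewrite (setIidPr BJ) (P3 XM BP).
rewrite (g2 B BP x xB) l0 mul0r addr0.
by have := g2 B BP y yB; rewrite g0 // l0 mul0r addr0.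
Qed.

(** Some component is responsible. Either [J] contains one of its triples, or [J] is too large
    there; each case has its own codeword. *)
Let code_dep J : J \subset R -> ~~ indep N J -> exists g : {ffun T -> 'F_3}, [/\ code g,
  forall x, x \notin J -> g x = 0 & exists2 x, x \in J & g x != 0].
Proof.
move=> sJ; rewrite (indep_components sJ) => /forall_inPn[X XM].
rewrite (indX XM) ?subsetIr // negb_and.
have JB B : B \in P X -> J :&: X :&: B = J :&: B.
  by move=> BP; rewrite -setIA (setIidPr (triple_sub XM BP)).
have [/forall_inP J2|/forall_inPn[B BP]] := boolP [forall B in P X, #|J :&: X :&: B| <= 2]%N.
  rewrite /= negb_or -leqNgt => /andP[nb leJ].
  have {}J2 B : B \in P X -> (#|J :&: B| <= 2)%N by move=> BP; rewrite -JB // J2.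
  (* The upper bounds on the parts add up to the lower bound on [J], so all of them are
     equalities. *)
  have [SJ eB] : S X \subset J /\ {in P X, forall B, #|J :&: B| = 2%N}.
    have leS : (#|J :&: S X| <= #|S X|)%N by rewrite subset_leq_card // subsetIr.
    have leP : (\sum_(B in P X) #|J :&: B| <= 2 * #|P X|)%N.
      by rewrite mulnC -sum_nat_const; apply: leq_sum.
    rewrite card_split // in leJ; split=> [|B BP].
      apply/setIidPr/eqP; rewrite eqEcard subsetIr /=.
      by rewrite -(leq_add2r (2 * #|P X|)) (leq_trans leJ) // leq_add2l.
    have e : (2 * #|P X| = 2 + \sum_(D in P X | D != B) 2)%N.
      by rewrite mulnC -sum_nat_const (bigD1 B).
    rewrite (bigD1 B) //= e in leJ; apply/eqP; rewrite eqn_leq J2 //=.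
    rewrite -(leq_add2r (\sum_(D in P X | D != B) 2)) -(leq_add2l #|S X|) (leq_trans leJ) //.
    by rewrite leq_add // leq_add2l; apply: leq_sum => D /andP[DP _]; apply: J2.
  have X0 : exists x0 : T, x0 \in X.
    have [_ _ n0] := and3P (components_partition N).
    by apply/set0Pn; apply: contraNneq n0 => <-.
  have [x0 x0X] := X0.
  pose y B := odflt x0 [pick z in B :\: J].
  have yP B : B \in P X -> B :\: J = [set y B].
    move=> BP; have /cards1P[z ez] : #|B :\: J| == 1%N.
      by have := cardsID J B; rewrite setIC eB // (P3 XM BP) => /eqP; rewrite (eqn_add2l 2 _ 1).
    rewrite /y; case: pickP => [w|/(_ z)]; rewrite ez inE; last by rewrite eqxx.
    by move=> /eqP ->.
  pose blk x := pblock (P X) x.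
  (* The word with [l = 1] on [X], with the value at each triple's base shifted so that it vanishes
     at the one point [y B] missing from [J]. *)
  pose g : {ffun T -> 'F_3} := [ffun x => if x \in X then
     if x \in S X then 1 else sigma (blk x) x - sigma (blk x) (y (blk x)) else 0].
  have blkE B x : B \in P X -> x \in B -> blk x = B.
    by move=> BP xB; rewrite /blk (def_pblock (tP XM) BP xB).
  have gB B x : B \in P X -> x \in B -> g x = sigma B x - sigma B (y B).
    move=> BP xB; rewrite ffunE (blkE B) // (subsetP (triple_sub XM BP) x xB).
    by case: ifP => // xS; have := S_notin XM BP xS; rewrite xB.
  have gS s : s \in S X -> g s = 1 by move=> sS; rewrite ffunE sS (subsetP (S_sub XM)).
  exists g; split.
  - apply/codeP; exists [ffun Z => (Z == X)%:R], [ffun B => if B \in P X then - sigma B (y B) else 0].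
    move=> Y YM; have [eYX|neYX] := eqVneq Y X.
      rewrite eYX; split=> [s sS|B BP z zB]; first by rewrite gS // !ffunE eqxx (negbTE nb).
      by rewrite (gB B) // !ffunE eqxx BP mul1r addrC.
    have gY z : z \in Y -> g z = 0.
      move=> zY; rewrite ffunE; case: ifP => // zX.
      by rewrite (comp_disj XM YM zX zY) eqxx in neYX.
    split=> [s sS|B BP z zB].
      by rewrite gY ?(subsetP (S_sub YM)) // ffunE (negbTE neYX) if_same.
    rewrite gY ?(subsetP (triple_sub YM BP)) // !ffunE (negbTE neYX) mul0r addr0.
    case: ifP => // BX; case/eqP: neYX.
    by apply: (comp_disj YM XM (subsetP (triple_sub YM BP) z zB) (subsetP (triple_sub XM BX) z zB)).
  - move=> z zJ; have [zX|zX] := boolP (z \in X); last by rewrite ffunE (negbTE zX).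
    have [zS|[B BP zB]] := inS XM zX; first by rewrite (subsetP SJ) in zJ.
    rewrite (gB B) //; have : z \in B :\: J by rewrite inE zJ.
    by rewrite yP // => /set1P->; rewrite subrr.
  have [xS|[B BP xB]] := inS XM x0X.
    by exists x0; rewrite ?(subsetP SJ) // gS // oner_neq0.
  have /card_gt0P[z /setIP[zJ zB]] : (0 < #|J :&: B|)%N by rewrite eB.
  exists z => //; rewrite (gB B) // subr_eq0.
  have yB : y B \in B :\: J by rewrite yP // set11.
  have [yB' yJ] := setDP yB.
  apply: contraNneq yJ => /(sigma_inj (P3 XM BP)) <- //.
rewrite JB // -ltnNge => gt2 _.
have BJ : B \subset J.
  by apply/setIidPr/eqP; rewrite eqEcard subsetIr (P3 XM BP).
(* The indicator of the triple is the word with [l = 0] and [t = 1] on [B], zero elsewhere. *)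
exists [ffun x => (x \in B)%:R]; split.
- apply/codeP; exists [ffun=> 0], [ffun D => (D == B)%:R] => Y YM; split=> [s sS|D DP x xD]; rewrite !ffunE.
    rewrite if_same; case: (boolP (s \in B)) => // sB.
    have eYX := comp_disj YM XM (subsetP (S_sub YM) s sS) (subsetP (triple_sub XM BP) s sB).
    by rewrite eYX in sS; have := S_notin XM BP sS; rewrite sB.
  rewrite mul0r addr0; congr (nat_of_bool _)%:R; apply/idP/eqP => [xB|<-//].
  exact: (triple_disj YM XM DP BP xD xB).
- by move=> x xJ; rewrite ffunE; case: (boolP (x \in B)) => // /(subsetP BJ); rewrite (negbTE xJ).
have /card_gt0P[x xB] : (0 < #|B|)%N by rewrite (P3 XM BP).
by exists x; rewrite ?(subsetP BJ) // ffunE xB oner_neq0.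
Qed.

Variable rho : T -> T.
Hypothesis rhoP : {in nonloops N, forall x, rho x \in R
  /\ spans N [set x] (rho x) /\ spans N [set rho x] x}.

Lemma ternary_of_shapes : ternary N.
Proof.
have [m [v hv]] := code_representation code0 codeD codeZ.
have hR J : J \subset R -> indep N J = free [seq v x | x in J].
  move=> sJ; apply/idP/idP => [iJ|/hv h].
    apply/hv => g cg g0; exact: (code_indep sJ iJ cg g0).
  apply: contraT => /(code_dep sJ)[g [cg g0 [x xJ gx]]].
  by rewrite (h g cg g0 x xJ) eqxx in gx.
(* Loops receive the zero vector and parallel points the same vector. A set containing a loop or two
   parallel points thus fails to be free, since freeness is about sequences. *)
exists m, (fun x => if x \in nonloops N then v (rho x) else 0) => I sI.
have [sIN|] := boolP (I \subset nonloops N); last first.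
  move=> nI; rewrite (contraNF (@indep_nonloops _ _ I) nI); apply/esym/negbTE.
  have [x xI xN] := subsetPn nI; apply/negP => fr.
  have v0 : 0 \in [seq (if x \in nonloops N then v (rho x) else 0) | x in I].
    by apply/imageP; exists x; rewrite // (negbTE xN).
  by have := free_not0 fr v0; rewrite eqxx.
have eI : [seq (if x \in nonloops N then v (rho x) else 0) | x in I]
    = [seq v y | y <- [seq rho x | x in I]].
  rewrite /image_mem -map_comp; apply/eq_in_map => x; rewrite mem_enum => xI.
  by rewrite (subsetP sIN x xI).
rewrite eI; apply/idP/idP => [iI|fr].
  have injI := indep_repr_inj rhoP iI.
  have := iI; rewrite (indep_repr rhoP sIN injI) hR ?(repr_sub rhoP) //.
  rewrite (perm_free (perm_map v (_ : perm_eq (enum (rho @: I)) [seq rho x | x in I]))) //.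
  apply: uniq_perm; rewrite ?enum_uniq //.
    by rewrite map_inj_in_uniq ?enum_uniq // => x y; rewrite !mem_enum; apply: injI.
  move=> y; rewrite mem_enum; apply/imsetP/imageP => -[x xI ->]; by exists x.
have injI : {in I &, injective rho}.
  have /card_uniqP := map_uniq (free_uniq fr); rewrite size_image => cI.
  apply/imset_injP; rewrite -cI; apply/eqP/eq_card => y.
  by apply/imsetP/imageP => -[x xI ->]; exists x.
rewrite (indep_repr rhoP sIN injI) hR ?(repr_sub rhoP) //.
rewrite (perm_free (perm_map v (_ : perm_eq (enum (rho @: I)) [seq rho x | x in I]))) //.
apply: uniq_perm; rewrite ?enum_uniq //.
  by rewrite map_inj_in_uniq ?enum_uniq // => x y; rewrite !mem_enum; apply: injI.
move=> y; rewrite mem_enum; apply/imsetP/imageP => -[x xI ->]; by exists x.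
Qed.
End Ternary.
End Assemble.

Lemma component_shape (T : finType) (N : matroid T) (X : {set T}) :
  ~ has_minor N (uniform 2 5) -> ~ has_minor N (uniform 3 5) -> ~ has_minor N Y3 ->
  X \in components (simplification N) -> 1 < rank N X ->
  exists S P, has_shape (restrict (simplification N) X) S P /\ 3 <= #|S| + 2 * #|P|.
Proof.
move=> n25 n35 nY3 XM rX; have sXR := component_sub XM.
have [rho [_ sRN simpR]] := simplification_repr N.
have XN : X \subset ground N by apply: subset_trans sXR (subsetIl _ _).
have simpX : {in X &, forall x y, indep N [set x; y]}.
  move=> x y xX yX; have [->|xy] := eqVneq x y; last by apply: simpR; rewrite ?(subsetP sXR).
  by have := subsetP sRN y (subsetP sXR y yX); rewrite inE setUid.
have connX : {in X &, forall x y, x != y ->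
    exists2 C, C \in circuits N & [/\ x \in C, y \in C & C \subset X]}.
  move=> x y xX yX xy; have := component_connected XM xX yX.
  rewrite /connected_elts /= (negbTE xy) => /exists_inP[C cC /andP[xC yC]].
  exists C; first exact: simplification_circuit.
  by split=> //; apply: component_circuit XM cC xC xX.
have [S [P [sh le3]]] := shape_of_no_minors XN n25 n35 nY3 simpX connX rX.
exists S, P; split=> //; apply: shape_ext sh.
  by rewrite component_ground //; apply/setIidPr.
move=> I sI; rewrite component_indep //=; last by rewrite (subset_trans sI) ?subsetIr.
by rewrite /restrict_indep /= (subset_trans sI) ?subsetIr.
Qed.

Theorem theorem5p4 (T : finType) (N : matroid T) :
  let i := ternary N /\ laminar N in
  let ii := ~ has_minor N (uniform 2 5) /\ ~ has_minor N (uniform 3 5)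
            /\ ~ has_minor N Y3 in
  let iii := forall X : {set T}, X \in components (simplification N) ->
    let L := restrict (simplification N) X in
    rank L (ground L) <= 1
    \/ isomorphic L (uniform 2 4)
    \/ is_two_sum L (uniform 2 4) (uniform 2 4)
    \/ (exists n k : nat, 3 <= n /\ k <= n /\ circuit_with_U24s n k L) in
  (i <-> ii) /\ (ii <-> iii).
Proof.
move=> i ii iii.
have i_ii : i -> ii.
  case=> ternN lamN; split; first exact: ternary_noU25.
  by split; [exact: ternary_noU35 | exact: laminar_noY3].
have ii_iii : ii -> iii.
  move=> [n25 [n35 nY3]] X XM L.
  have [le1|gt1] := leqP (rank L (ground L)) 1; [by left | right].
  rewrite component_ground // component_rank // in gt1.
  have [S [P [sh le3]]] := component_shape n25 n35 nY3 XM gt1.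
  exact: shape_complete sh le3.
suff iii_i : iii -> i by split; split; tauto.
move=> h; pose M := simplification N.
have [rho [rhoP sRN simpR]] := simplification_repr N.
(* Chooses for every component its [S], its [P] and the flag at once; sets that are not components
   get a dummy triple. *)
have /fin_all_exists[D hD] : forall X : {set T}, exists D : {set T} * {set {set T}} * bool,
    X \in components M ->
    [/\ trivIset D.1.2, {in D.1.2, forall B : {set T}, #|B| = 3},
        [disjoint D.1.1 & cover D.1.2], X = D.1.1 :|: cover D.1.2
      & (D.2 -> D.1.2 = set0) /\
        forall I : {set T}, I \subset X -> indep N I =
          [forall B in D.1.2, #|I :&: B| <= 2] && (D.2 || (#|I| < #|D.1.1| + 2 * #|D.1.2|))].
  move=> X; have [XM|] := boolP (X \in components M); last by exists (set0, set0, true).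
  have [r1|/shape_sound[S [P [tP P3 dSP gE hI]]]] := h X XM; last first.
    exists (S, P, false) => _ /=; rewrite component_ground // in gE hI.
    split=> //; split=> // I sI; by rewrite -hI // component_indep.
  rewrite component_ground // component_rank // in r1.
  (* A component of rank at most one in a simple matroid has no two distinct points, so all its
     subsets are independent. The flag is set because the bound for [X] and no triples would exclude
     [X] itself. *)
  exists (X, set0, true) => _ /=.
  have no (p : pred {set T}) : [forall B in set0, p B] by apply/forall_inP => B; rewrite inE.
  rewrite /cover big_set0 setU0; split=> //.
  - by apply/trivIsetP => B B'; rewrite inE.
  - by move=> B; rewrite inE.
  - by rewrite disjoints_subset setC0 subsetT.
  split=> // I sI; rewrite no /=; have sXR := component_sub XM.
  have [->|[x xI]] := set_0Vmem I; first by rewrite indep0.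
  suff -> : I = [set x].
    by have := subsetP sRN x (subsetP sXR x (subsetP sI x xI)); rewrite inE.
  apply/eqP; rewrite eqEsubset sub1set xI andbT; apply/subsetP => y yI; rewrite inE.
  apply: contraLR r1 => yx; rewrite -ltnNge.
  have [xX yX] := (subsetP sI x xI, subsetP sI y yI).
  have -> : 2 = #|[set y; x]| by rewrite cards2 yx.
  apply: rank_ge; first by rewrite subUset !sub1set yX.
  by apply: simpR; rewrite ?(subsetP sXR).
split.
  apply: (@ternary_of_shapes _ N (fun X => (D X).1.1) (fun X => (D X).1.2) (fun X => (D X).2));
    try exact: rhoP; by move=> X /hD[? ? ? ? []].
apply: (@laminar_of_shapes _ N (fun X => (D X).1.1) (fun X => (D X).1.2) (fun X => (D X).2));
  try exact: rhoP; by move=> X /hD[? ? ? ? []].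
Qed.
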